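(* Let $\Lambda$ be a row-finite, source-free $k$-graph and let $\mathcal{G}_\Lambda$ be its path groupoid. For any $n\in\mathbb{N}$, the maps $\psi_n:\underline{P^n}\to\mathscr{P}_n$ defined in the context are continuous, equivariant sheaf morphisms (i.e. $\psi_n\in\operatorname{Hom}_{\mathcal{G}_\Lambda}(\underline{P^n},\mathscr{P}_n)$), and $$\psi_{n-1}\circ\underline{d_n}=\partial_n\circ\psi_n$$ (with $\psi_{-1}=\mathrm{id}_{\underline{\mathbb{Z}}}$). Furthermore, for any $\mathcal{G}_\Lambda$-sheaf $\mathscr{A}$, the induced map $\psi_n^*:H^n_{\mathscr{P}}(\mathcal{G}_\Lambda,\mathscr{A})\to H^n_{\underline{P}}(\mathcal{G}_\Lambda,\mathscr{A})$, $[c]\mapsto[c\circ\psi_n]$, satisfies $$\rho^n_{\underline{P}}\circ\psi_n^*=\rho^n_{\mathscr{P}}.$$ In particular, for any right $\Lambda$-module $\mathcal{A}$, the triangle formed by $\psi_n^*:H^n_{\mathscr{P}}(\mathcal{G}_\Lambda,\underline{\mathcal{A}})\to H^n_{\underline{P}}(\mathcal{G}_\Lambda,\underline{\mathcal{A}})$, $\rho^n_{\underline{P}}$ and $\rho^n_{\mathscr{P}}$, the latter two with values in $H^n(\mathcal{G}_\Lambda,\underline{\mathcal{A}})$, commutes.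
   Context: **$\Lambda$-modules.** Categories are viewed arrows-only: $\lambda\in\Lambda$ is a morphism with range $r(\lambda)$ and source $s(\lambda)$; objects are identified with identity morphisms; $\lambda\mu$ is defined when $s(\lambda)=r(\mu)$. A right $\Lambda$-module is a contravariant functor $\mathcal{A}:\Lambda\to\mathbf{Ab}$, with groups $\mathcal{A}_v$ and maps $\mathcal{A}(\lambda):\mathcal{A}_{r(\lambda)}\to\mathcal{A}_{s(\lambda)}$. $\mathbb{Z}^\Lambda$ is the constant module. $\Lambda^{*n}$ is the set of composable $n$-tuples ($s(\lambda_i)=r(\lambda_{i+1})$). $P^n$ is the $\Lambda$-module with $P^n_v$ free abelian on the $(\lambda_0,\dots,\lambda_n)\in\Lambda^{*(n+1)}$ with $s(\lambda_n)=v$, $P^n(\lambda)[\lambda_0,\dots,\lambda_n]=[\lambda_0,\dots,\lambda_n\lambda]$; $d_n[\lambda_0,\dots,\lambda_n]=[\lambda_1,\dots,\lambda_n]+\sum_{i=1}^n(-1)^i[\lambda_0,\dots,\lambda_{i-1}\lambda_i,\dots,\lambda_n]$ for $n\ge1$, and $d_0:P^0\to\mathbb{Z}^\Lambda$, $d_0[\lambda]=1$. **$k$-graphs and path groupoid.** A $k$-graph is a countable category $\Lambda$ with a functor $d:\Lambda\to\mathbb{N}^k$ such that $d(\lambda)=m+n$ implies there are unique $\mu,\nu$ with $\lambda=\mu\nu$, $d(\mu)=m$, $d(\nu)=n$. It is row-finite and source-free if $0<|\{\lambda:d(\lambda)=m,r(\lambda)=v\}|<\infty$ for all $m\in\mathbb{N}^k$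 and vertices (objects) $v$. $\Omega_k$ is the $k$-graph with objects $\mathbb{N}^k$, morphisms $(m,n)$ with $m\le n$, $r(m,n)=m$, $s(m,n)=n$, $d(m,n)=n-m$. $\Lambda^\infty$ is the set of degree-preserving functors $x:\Omega_k\to\Lambda$, with basic compact open sets $Z(\lambda)=\{x:x(0,d(\lambda))=\lambda\}$; $x(p)=x(p,p)$, $r(x)=x(0)$, $\sigma^p(x)(m,n)=x(m+p,n+p)$; if $s(\lambda)=r(y)$, $\lambda y$ is the unique $x$ with $x(0,d(\lambda))=\lambda$, $\sigma^{d(\lambda)}(x)=y$. $\mathcal{G}_\Lambda=\{(x,j-\ell,y):x,y\in\Lambda^\infty,\ j,\ell\in\mathbb{N}^k,\ \sigma^j(x)=\sigma^\ell(y)\}$, $r(x,n,y)=x$, $s(x,n,y)=y$, $(x,n,y)(y,m,z)=(x,n+m,z)$, unit space $\Lambda^\infty$, with basic compact open sets $Z(\lambda,\mu)=\{(\lambda z,d(\lambda)-d(\mu),\mu z):z\in\Lambda^\infty,\ r(z)=s(\lambda)\}$, $s(\lambda)=s(\mu)$. It is a locally compact Hausdorff étale groupoid. **$\mathcal{G}$-sheaves.** For an étale groupoid $\mathcal{G}$, a $\mathcal{G}$-sheaf is a space $\mathscr{A}$ with a local homeomorphism $\pi:\mathscr{A}\to\mathcal{G}^{(0)}$, abelian group fibers $\mathscr{A}(x)$ with continuous operations, and isomorphisms $a\mapsto\gamma\cdot a$, $\mathscr{A}(s(\gamma))\to\mathscr{A}(r(\gamma))$, functorial in $\gamma$ and jointly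 continuous in $(\gamma,a)$. Morphisms ($\operatorname{Hom}_{\mathcal{G}}$) are continuous, fiber-preserving, fiberwise additive, equivariant maps. $\mathcal{G}$-sheaves form an abelian category with enough injectives. $\underline{\mathbb{Z}}$ is the constant sheaf with trivial action. **The functor $\mathcal{A}\mapsto\underline{\mathcal{A}}$.** $\underline{\mathcal{A}}(x)=\varinjlim(\mathcal{A}_{x(p)},\mathcal{A}(x(p,q)))$ over $p\le q$ in $\mathbb{N}^k$, with natural maps $\varphi^x_p:\mathcal{A}_{x(p)}\to\underline{\mathcal{A}}(x)$; $\underline{\mathcal{A}}=\bigsqcup_x\underline{\mathcal{A}}(x)$ has basic open sets $S_{a,\lambda}=\{\varphi^y_{d(\lambda)}(a):y\in Z(\lambda)\}$, $a\in\mathcal{A}_{s(\lambda)}$, and action $(x,p-q,y)\cdot\varphi^y_q(b)=\varphi^x_p(b)$ whenever $\sigma^p(x)=\sigma^q(y)$, $b\in\mathcal{A}_{y(q)}$. For a morphism $\eta:\mathcal{A}\to\mathcal{B}$, $\underline{\eta}(\varphi^x_p(a))=\varphi^x_p(\eta(a))$. This functor is exact and $\underline{\mathbb{Z}^\Lambda}=\underline{\mathbb{Z}}$, so $\{\underline{P^n},\underline{d_n}\}$ is a resolution of $\underline{\mathbb{Z}}$. One identifies $\underline{P^n}(x)$ with the free abelian group on $\{((x,m,y),(\lambda_1,\dots,\lambda_n))\in\mathcal{G}_\Lambda\times\Lambda^{*n}:s(\lambda_n)=r(y)\}$ (for $n=0$: on the $(x,m,y)\in\mathcal{G}_\Lambda$)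 via $\varphi^x_p([\lambda_0,\dots,\lambda_n])\leftrightarrow[(x,p-d(\lambda_n),\lambda_n\sigma^p(x)),(\lambda_0,\dots,\lambda_{n-1})]$. **The resolution $\mathscr{P}$.** $\mathcal{G}^{(n)}$ is the space of composable $n$-tuples of $\mathcal{G}=\mathcal{G}_\Lambda$. $\mathscr{P}_n=\mathbb{Z}[\mathcal{G}^{(n+1)}]$ is the $\mathcal{G}$-sheaf with stalk at $x$ free abelian on the tuples $(\gamma_0,\dots,\gamma_n)$ with $r(\gamma_0)=x$, action $\gamma\cdot[\gamma_0,\dots,\gamma_n]=[\gamma\gamma_0,\gamma_1,\dots,\gamma_n]$, and topology with basis the sets $\{\sum_ia_i[e_i(z)]:z\in U\}$, where $U\subseteq\mathcal{G}^{(0)}$ is open, $a_i\in\mathbb{Z}$ (finite sum) and the $e_i$ are continuous local sections over $U$ of $(\gamma_0,\dots,\gamma_n)\mapsto r(\gamma_0)$ with open image. For $n\ge1$, $\partial_n[\gamma_0,\dots,\gamma_n]=(-1)^n[\gamma_0,\dots,\gamma_{n-1}]+\sum_{i=1}^n(-1)^{i-1}[\gamma_0,\dots,\gamma_{i-1}\gamma_i,\dots,\gamma_n]$, and $\partial_0:\mathscr{P}_0\to\underline{\mathbb{Z}}$, $\partial_0[\gamma]=1_{r(\gamma)}$. This is a resolution of $\underline{\mathbb{Z}}$. **The maps $\psi_n$.** For $n\ge0$, extended $\mathbb{Z}$-linearly, $\psi_n([(x,m,y),(\lambda_1,\dots,\lambda_n)])=(-1)^{\lceil n/2\rceil}[\gamma_0,\dots,\gamma_n]$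 with $\gamma_0=(x,m,y)$, $\gamma_1=(y,-d(\lambda_n),\lambda_ny)$, $\gamma_2=(\lambda_ny,-d(\lambda_{n-1}),\lambda_{n-1}\lambda_ny)$, …, $\gamma_n=(\lambda_2\cdots\lambda_ny,-d(\lambda_1),\lambda_1\cdots\lambda_ny)$; $\psi_{-1}=\mathrm{id}_{\underline{\mathbb{Z}}}$. **Cohomology and the maps $\rho$.** For a resolution $\{\mathscr{Q}_n,\vartheta_n\}$ of $\underline{\mathbb{Z}}$ (with augmentation $\vartheta_0$), $H^n_{\mathscr{Q}}(\mathcal{G},\mathscr{A})$ is the $n$th cohomology of $\operatorname{Hom}_{\mathcal{G}}(\mathscr{Q}_*,\mathscr{A})$ with boundary $f\mapsto f\circ\vartheta_{n+1}$; $H^n_{\mathscr{P}}$ and $H^n_{\underline{P}}$ are the cases of $\{\mathscr{P}_n,\partial_n\}$ and $\{\underline{P^n},\underline{d_n}\}$. $H^n(\mathcal{G},\mathscr{A})$ is equivariant sheaf cohomology (right derived functors of $\operatorname{Hom}_{\mathcal{G}}(\underline{\mathbb{Z}},\cdot)$), identified with Yoneda $\operatorname{Ext}^n_{\mathcal{G}}(\underline{\mathbb{Z}},\mathscr{A})$, i.e. for $n\ge1$ with classes of exact sequences $0\to\mathscr{A}\to\mathscr{R}_{n-1}\to\cdots\to\mathscr{R}_0\to\underline{\mathbb{Z}}\to0$ modulo the equivalence relation generated by morphisms of sequences that are identities on $\mathscr{A}$ and $\underline{\mathbb{Z}}$. The homomorphism $\rho^n_{\mathscr{Q}}:H^n_{\mathscr{Q}}(\mathcal{G},\mathscr{A})\to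 H^n(\mathcal{G},\mathscr{A})$ sends, for $n\ge1$, the class of a cocycle $c$ to the class of $0\to\mathscr{A}\to\mathscr{R}_c\to\mathscr{Q}_{n-2}\xrightarrow{\vartheta_{n-2}}\cdots\to\mathscr{Q}_0\xrightarrow{\vartheta_0}\underline{\mathbb{Z}}\to0$ (with $\mathscr{Q}_{-1}:=\underline{\mathbb{Z}}$), where $\mathscr{R}_c=(\mathscr{A}\oplus\mathscr{Q}_{n-1})/\{(c(q),-\vartheta_n(q)):q\in\mathscr{Q}_n\}$, with maps $a\mapsto[a,0]$ and $[a,p]\mapsto\vartheta_{n-1}(p)$; for $n=0$, $\rho^0_{\mathscr{Q}}(c)$ is the unique $\tilde{c}\in\operatorname{Hom}_{\mathcal{G}}(\underline{\mathbb{Z}},\mathscr{A})$ with $c=\tilde{c}\circ\vartheta_0$. *)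

(* Defs.v *)
From HB Require Import structures.
From Stdlib Require Import Relation_Operators.
From mathcomp Require Import all_boot all_order all_algebra.
From mathcomp Require Import generic_quotient ring_quotient.
From mathcomp Require Import all_classical.
From mathcomp Require Import topology_structure initial_topology.
From mathcomp Require Import product_topology subspace_topology function_spaces.
From mathcomp.multinomials Require Import freeg.

Set Implicit Arguments.
Unset Strict Implicit.
Unset Printing Implicit Defensive.

Import GRing.Theory.

Local Open Scope classical_set_scope.
Local Open Scope quotient_scope.
Local Open Scope ring_scope.

(* [B] is a subbase; the families used below are in fact bases. *)
Definition gentop (T : Type) (B : set (set T)) : Type := T.

Section GenTop.
Variables (T : choiceType) (B : set (set T)).
HB.instance Definition _ := Choice.on (gentop B).
HB.instance Definition _ :=
  @isSubBaseTopological.Build (gentop B) (set T) B id.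
End GenTop.

Definition local_homeo (X Y : topologicalType) (f : X -> Y) : Prop :=
  forall x : X, exists U : set X,
    [/\ open U, U x, set_inj U f, {within U, continuous f} &
        forall V : set X, open V -> V `<=` U -> open (f @` V)].

(* Z-linear extension of [f] to the free abelian group on [K]. *)
Section FreeLift.
Variables (K : choiceType) (M : zmodType) (f : K -> M).
Definition zlift (D : {freeg K}) : M := fglift (f : K -> zmodule M) D.

Lemma zlift_is_zmod_morphism : zmod_morphism zlift.
Proof. exact: (@lift_is_additive int K (zmodule M) f). Qed.

HB.instance Definition _ :=
  GRing.isZmodMorphism.Build {freeg K} M zlift zlift_is_zmod_morphism.

Lemma zliftU x : zlift << x >> = f x.
Proof. by rewrite /zlift liftU; exact: mulr1z. Qed.
End FreeLift.

(* Operations on tuples, written as sequences: [contract i] multiplies the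
   entries number i and i+1 (counted from 0), [mul_first] and [mul_last]
   multiply the first (last) entry on the left (right). *)
Section Tuples.
Variables (T : Type) (op : T -> T -> T).

Fixpoint contract (i : nat) (s : seq T) : seq T :=
  match i, s with
  | 0, a :: b :: s' => op a b :: s'
  | j.+1, a :: s' => a :: contract j s'
  | _, _ => s
  end.

Definition mul_first (a : T) (s : seq T) : seq T :=
  if s is b :: s' then op a b :: s' else [::].

Fixpoint mul_last (s : seq T) (a : T) : seq T :=
  match s with
  | [::] => [::]
  | [:: b] => [:: op b a]
  | b :: s' => b :: mul_last s' a
  end.
End Tuples.

Definition deg (k : nat) := {ffun 'I_k -> nat}.
Definition zdeg (k : nat) := {ffun 'I_k -> int}.

HB.instance Definition _ k := Countable.on (deg k).
HB.instance Definition _ k := GRing.Nmodule.on (deg k).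
HB.instance Definition _ k := Choice.on (zdeg k).
HB.instance Definition _ k := GRing.Zmodule.on (zdeg k).

Section Degrees.
Variable k : nat.
Implicit Types m n p : deg k.

Definition dle m n : bool := [forall i, (m i <= n i)%N].
Definition dsub n m : deg k := [ffun i => (n i - m i)%N].
Definition dmax m n : deg k := [ffun i => maxn (m i) (n i)].
Definition dint m : zdeg k := [ffun i => (m i)%:Z].

Lemma dleP m n : reflect (forall i, (m i <= n i)%N) (dle m n).
Proof. exact: forallP. Qed.

Lemma dle_refl m : dle m m.
Proof. by apply/dleP. Qed.

Lemma dle_trans n m p : dle m n -> dle n p -> dle m p.
Proof. by move=> /dleP a /dleP b; apply/dleP => i; apply: leq_trans (b i). Qed.

Lemma dle0 m : dle 0 m.
Proof. by apply/dleP => i; rewrite ffunE. Qed.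

Lemma dle_add2r p m n : dle m n -> dle (m + p) (n + p).
Proof. by move=> /dleP a; apply/dleP => i; rewrite !ffunE leq_add2r. Qed.

Lemma dle_maxl m n : dle m (dmax m n).
Proof. by apply/dleP => i; rewrite ffunE leq_maxl. Qed.

Lemma dle_maxr m n : dle n (dmax m n).
Proof. by apply/dleP => i; rewrite ffunE leq_maxr. Qed.

Lemma dsub_add2r p m n : dsub (n + p) (m + p) = dsub n m.
Proof. by apply/ffunP => i; rewrite !ffunE subnDr. Qed.
End Degrees.

(* [kcomp l m] is the composite of the composable pair (l, m); its value is
   irrelevant when [src l <> rng m]. *)
Record kgraph (k : nat) := KGraph {
  vtx : countType;
  arr : countType;
  rng : arr -> vtx;
  src : arr -> vtx;
  idm : vtx -> arr;
  kcomp : arr -> arr -> arr;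
  kdeg : arr -> deg k;
  rng_id : forall v, rng (idm v) = v;
  src_id : forall v, src (idm v) = v;
  rng_comp : forall l m, src l = rng m -> rng (kcomp l m) = rng l;
  src_comp : forall l m, src l = rng m -> src (kcomp l m) = src m;
  kcomp_id_l : forall l, kcomp (idm (rng l)) l = l;
  kcomp_id_r : forall l, kcomp l (idm (src l)) = l;
  kcompA : forall l m n, src l = rng m -> src m = rng n ->
    kcomp l (kcomp m n) = kcomp (kcomp l m) n;
  kdeg_id : forall v, kdeg (idm v) = 0;
  kdeg_comp : forall l m, src l = rng m -> kdeg (kcomp l m) = kdeg l + kdeg m;
  kfact : forall l m n, kdeg l = m + n ->
    exists! mn : arr * arr, [/\ src mn.1 = rng mn.2, l = kcomp mn.1 mn.2,
                               kdeg mn.1 = m & kdeg mn.2 = n]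
}.

Arguments idm {k L} v : rename.
Arguments kcomp {k L} l m : rename.
Arguments rng {k L} l : rename.
Arguments src {k L} l : rename.
Arguments kdeg {k L} l : rename.

Definition row_finite_source_free k (L : kgraph k) : Prop :=
  forall (m : deg k) (v : vtx L),
    let E := [set l : arr L | kdeg l = m /\ rng l = v] in
    E !=set0 /\ finite_set E.

(* A contravariant functor to abelian groups. The map A(l) : A_(r l) -> A_(s l)
   is given as [mact A hr hs : A u -> A v] for any [hr : rng l = u] and
   [hs : src l = v], so that no transport along equalities of vertices is needed
   to state functoriality. *)
Record rmod k (L : kgraph k) := RMod {
  mod_at :> vtx L -> zmodType;
  mact : forall (l : arr L) (u v : vtx L), rng l = u -> src l = v ->
    {additive mod_at u -> mod_at v};
  mact_id : forall (v : vtx L) (hr : rng (idm v) = v) (hs : src (idm v) = v) a,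
    mact hr hs a = a;
  mact_comp : forall (l m : arr L) (u v w : vtx L)
    (hl : rng l = u) (h : src l = v) (h' : rng m = v) (hm : src m = w)
    (hr : rng (kcomp l m) = u) (hs : src (kcomp l m) = w) a,
    mact hr hs a = mact h' hm (mact hl h a)
}.

Record rmod_hom k (L : kgraph k) (A B : rmod L) := RModHom {
  mod_map :> forall v, {additive A v -> B v};
  mod_map_nat : forall (l : arr L) u v (hr : rng l = u) (hs : src l = v) a,
    mod_map v (mact A hr hs a) = mact B hr hs (mod_map u a)
}.

Section ConstModule.
Variables (k : nat) (L : kgraph k).

Definition zmod_act (l : arr L) (u v : vtx L) (_ : rng l = u) (_ : src l = v) :
  {additive int -> int} := idfun.

Definition zconst : rmod L :=
  @RMod k L (fun _ => int) zmod_act (fun _ _ _ _ => erefl)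
    (fun _ _ _ _ _ _ _ _ _ _ _ _ => erefl).
End ConstModule.

Section BarModule.
Variables (k : nat) (L : kgraph k).

Definition composable (s : seq (arr L)) : bool :=
  sorted (fun a b => src a == rng b) s.

Definition pcellP n (v : vtx L) : pred (seq (arr L)) := fun s =>
  [&& size s == n.+1, composable s &
      if s is a :: s' then src (last a s') == v else false].

Definition pcell n v := {s : seq (arr L) | pcellP n v s}.

(* The generator [l_0, ..., l_n] of P^n_v (and 0 if [s] is not of this form). *)
Definition pgen n v (s : seq (arr L)) : {freeg (pcell n v)} :=
  if insub s is Some c then << (c : pcell n v) >> else 0.

Definition pact n (l : arr L) u v (_ : rng l = u) (_ : src l = v) :
    {additive {freeg (pcell n u)} -> {freeg (pcell n v)}} :=
  zlift (fun c : pcell n u => pgen n v (mul_last kcomp (val c) l)).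

Lemma pgenE n v (c : pcell n v) : pgen n v (val c) = << c >>.
Proof. by rewrite /pgen valK. Qed.

Lemma zlift_pgen n v (M : zmodType) (f : seq (arr L) -> M) s :
  pcellP n v s -> zlift (fun c : pcell n v => f (val c)) (pgen n v s) = f s.
Proof. by move=> h; rewrite /pgen insubT zliftU. Qed.

Lemma freeg_ext (K : choiceType) (M : zmodType) (f g : {additive {freeg K} -> M}) :
  (forall x, f << x >> = g << x >>) -> f =1 g.
Proof.
move=> h D; rewrite -(freeg_sumE D) !raddf_sum; apply: eq_bigr => x _.
have -> : << coeff x D *g x >> = << x >> *~ coeff x D :> {freeg K}.
  by rewrite freegU_mulz intz.
by rewrite !raddfMz h.
Qed.

Lemma pcellP_rcons n v s a :
  pcellP n v (rcons s a) =
  [&& size s == n, composable (rcons s a) & src a == v].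
Proof.
rewrite /pcellP size_rcons eqSS; case: s => [|b s] //=.
by rewrite last_rcons.
Qed.

Lemma mul_last_rcons s a l :
  mul_last kcomp (rcons s a) l = rcons s (kcomp a l) :> seq (arr L).
Proof. by elim: s => //= b s ->; case: s. Qed.

Lemma composable_rcons s (a b : arr L) : rng a = rng b ->
  composable (rcons s a) = composable (rcons s b).
Proof. by move=> h; case: s => //= c s; rewrite !rcons_path h. Qed.

Lemma pcellP_mul_last n u v s l : rng l = u -> src l = v ->
  pcellP n u s -> pcellP n v (mul_last kcomp s l).
Proof.
case/lastP: s => // s a hr hs; rewrite mul_last_rcons !pcellP_rcons.
case/and3P=> -> hc /eqP ha.
by rewrite -(@composable_rcons _ a) ?hc ?rng_comp ?src_comp ?ha ?hr ?hs /=.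
Qed.

Lemma pact_id n (v : vtx L) (hr : rng (idm v) = v) (hs : src (idm v) = v) a :
  pact n hr hs a = a.
Proof.
apply: (@freeg_ext _ _ (pact n hr hs) idfun) => c /=; rewrite zliftU.
rewrite -[RHS]pgenE; congr pgen; case: c => /= s.
case/lastP: s => // s b; rewrite pcellP_rcons mul_last_rcons.
by case/and3P=> _ _ /eqP <-; rewrite kcomp_id_r.
Qed.

Lemma pact_comp n (l m : arr L) (u v w : vtx L)
    (hl : rng l = u) (h : src l = v) (h' : rng m = v) (hm : src m = w)
    (hr : rng (kcomp l m) = u) (hs : src (kcomp l m) = w) a :
  pact n hr hs a = pact n h' hm (pact n hl h a).
Proof.
apply: (@freeg_ext _ _ (pact n hr hs) (pact n h' hm \o pact n hl h)) => c /=.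
rewrite !zliftU (@zlift_pgen _ _ _ (fun s => pgen n w (mul_last kcomp s m)))
  ?(pcellP_mul_last hl h) ?(valP c) //.
congr pgen; case: c => /= s; case/lastP: s => // s b.
rewrite pcellP_rcons !mul_last_rcons => /and3P[_ _ /eqP hb].
by rewrite kcompA ?hb ?hl ?h ?h'.
Qed.

Definition Pmod n : rmod L :=
  @RMod k L (fun v => {freeg (pcell n v)}) (@pact n) (@pact_id n) (@pact_comp n).

(* P^(n-1), with P^(-1) the constant module. *)
Definition lowPmod n : rmod L := if n is m.+1 then Pmod m else zconst L.

Definition pd n (v : vtx L) : {additive Pmod n v -> lowPmod n v} :=
  match n return {additive Pmod n v -> lowPmod n v} with
  | 0 => zlift (fun _ : pcell 0 v => 1 : int)
  | m.+1 => zlift (fun c : pcell m.+1 v =>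
      pgen m v (behead (val c)) +
      \sum_(1 <= i < m.+2)
         pgen m v (contract kcomp i.-1 (val c)) *~ (-1) ^+ i)
  end.

Lemma pcellP_behead n v (s : seq (arr L)) : pcellP n.+1 v s -> pcellP n v (behead s).
Proof.
by case: s => [|a [|b s]] //= /and3P[/eqP [] /= sz] /andP[_ hc] hl; apply/and3P; split=> //=; rewrite sz.
Qed.

Lemma path_eq_src (a b : arr L) s : src a = src b ->
  path (fun x y => src x == rng y) a s = path (fun x y => src x == rng y) b s.
Proof. by case: s => //= c s ->. Qed.

Lemma last_eq_src (a b : arr L) s : src a = src b -> src (last a s) = src (last b s).
Proof. by case: s. Qed.

Lemma path_contract i (x : arr L) s :
  (i.+1 < size s)%N -> path (fun x y => src x == rng y) x s ->
  path (fun x y => src x == rng y) x (contract kcomp i s) /\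
  src (last x (contract kcomp i s)) = src (last x s).
Proof.
elim: i x s => [|i IH] x [|a s] //=.
  case: s => [|b s] //= _ /and3P[hxa /eqP hab hb]; split.
    by rewrite rng_comp // hxa (@path_eq_src _ b) ?src_comp.
  by apply: last_eq_src; rewrite src_comp.
by rewrite ltnS => h /andP[-> /(IH _ _ h)[-> ->]].
Qed.

Lemma size_contract i (s : seq (arr L)) :
  (i.+1 < size s)%N -> size (contract kcomp i s) = (size s).-1.
Proof.
elim: i s => [|i IH] [|a s] //=; first by case: s.
by rewrite ltnS => h; rewrite IH //; case: s h.
Qed.

Lemma pcellP_contract n v i (s : seq (arr L)) : (i < n.+1)%N ->
  pcellP n.+1 v s -> pcellP n v (contract kcomp i s).
Proof.
move=> hi /and3P[/eqP sz hc hl]; apply/and3P; split.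
- by rewrite size_contract sz.
- case: s sz hc {hl} => // a s [sz]; case: i hi => [|i] hi /=.
    by case: s sz => // b s _ /= /andP[/eqP hab]; rewrite (@path_eq_src _ b) ?src_comp.
  by move=> /(path_contract (i := i))[] //; rewrite sz.
case: s sz hc hl => // a s [sz]; case: i hi => [|i] hi /=.
  by case: s sz => // b s _ /= /andP[/eqP hab _]; rewrite (@last_eq_src b (kcomp a b)) ?src_comp.
by move=> /(path_contract (i := i)); rewrite sz => /(_ hi)[_ ->].
Qed.

Lemma contract_mul_last i s (l : arr L) : (i.+1 < size s)%N -> composable s ->
  (if s is a :: s' then src (last a s') == rng l else false) ->
  contract kcomp i (mul_last kcomp s l) = mul_last kcomp (contract kcomp i s) l.
Proof.
elim: i s => [|i IH] [|a s] //=.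
  case: s => [|b [|c s]] //= _.
  by rewrite andbT => /eqP hab /eqP hb; rewrite kcompA.
case: s => // b s; rewrite ltnS => h /andP[hab hc] hl.
rewrite -[mul_last _ (b :: s) l]/(mul_last kcomp (b :: s) l) /= in h *.
have {IH} := IH (b :: s) h hc hl; rewrite /= => ->.
by case: i h => [|i] /=; case: s {hc hl} => [|c s].
Qed.

Lemma behead_mul_last s (l : arr L) : (1 < size s)%N ->
  behead (mul_last kcomp s l) = mul_last kcomp (behead s) l.
Proof. by case: s => [|a [|b s]]. Qed.

Lemma pd_nat n (l : arr L) u v (hr : rng l = u) (hs : src l = v) a :
  pd n v (mact (Pmod n) hr hs a) = mact (lowPmod n) hr hs (pd n u a).
Proof.
apply: (@freeg_ext _ _ (pd n v \o mact (Pmod n) hr hs)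
  (mact (lowPmod n) hr hs \o pd n u)) => c.
case: n a c => [|n] _ c /=; rewrite !zliftU.
  by rewrite (@zlift_pgen _ _ _ (fun=> 1)) ?(pcellP_mul_last hr hs) ?(valP c).
have hc := valP c.
rewrite (@zlift_pgen _ _ _ (fun s => pgen n v (behead s) + \sum_(1 <= i < n.+2)
         pgen n v (contract kcomp i.-1 s) *~ (-1) ^+ i)) ?(pcellP_mul_last hr hs) //.
pose f s := pgen n v (mul_last kcomp s l).
rewrite raddfD /= (@zlift_pgen _ _ _ f) ?pcellP_behead // /f.
have /and3P[/eqP sz hcomp hl] := hc.
rewrite behead_mul_last ?sz //; congr (_ + _).
rewrite raddf_sum big_nat [RHS]big_nat; apply: eq_bigr => i /andP[i0 hi].
have hi' : (i.-1 < n.+1)%N by case: i i0 hi.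
rewrite raddfMz /= (@zlift_pgen _ _ _ f) ?pcellP_contract // /f contract_mul_last ?sz //.
by rewrite hr; exact: hl.
Qed.

Definition pdiff n : rmod_hom (Pmod n) (lowPmod n) :=
  @RModHom k L (Pmod n) (lowPmod n) (@pd n) (@pd_nat n).
End BarModule.

(* Degree-preserving functors x : Omega_k -> L; [path_arr x h] is x(m, n) for
   [h : m <= n], and [path_vtx x m] is x(m) = x(m, m). *)
Record ipath k (L : kgraph k) := IPath {
  path_vtx :> deg k -> vtx L;
  path_arr : forall m n : deg k, dle m n -> arr L;
  path_rng : forall m n (h : dle m n), rng (path_arr h) = path_vtx m;
  path_src : forall m n (h : dle m n), src (path_arr h) = path_vtx n;
  path_id : forall m (h : dle m m), path_arr h = idm (path_vtx m);
  path_comp : forall m n p (h : dle m n) (h' : dle n p) (h'' : dle m p),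
    path_arr h'' = kcomp (path_arr h) (path_arr h');
  path_deg : forall m n (h : dle m n), kdeg (path_arr h) = dsub n m
}.

HB.instance Definition _ k (L : kgraph k) := gen_eqMixin (ipath L).
HB.instance Definition _ k (L : kgraph k) := gen_choiceMixin (ipath L).

Section Paths.
Variables (k : nat) (L : kgraph k).
Implicit Types (x y : ipath L) (p : deg k) (l : arr L).

Lemma ipathP x y :
  (forall m n (h : dle m n), path_arr x h = path_arr y h) -> x = y.
Proof.
move=> H.
have E : path_vtx x = path_vtx y.
  by apply/funext => m; rewrite -(path_rng x (dle_refl m)) H path_rng.
case: x y E H => xv xa ? ? ? ? ? [yv ya ? ? ? ? ?] /= E H.
have {}H : xa = ya.
  apply: functional_extensionality_dep => m.
  by apply: functional_extensionality_dep => n; apply/funext => h.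
subst yv ya; congr IPath; exact: Prop_irrelevance.
Qed.

Definition shift p x : ipath L.
Proof.
apply: (@IPath k L (fun m => x (m + p))
  (fun m n h => path_arr x (dle_add2r p h))).
- by move=> *; exact: path_rng.
- by move=> *; exact: path_src.
- by move=> *; exact: path_id.
- by move=> *; exact: path_comp.
- by move=> *; rewrite path_deg dsub_add2r.
Defined.

Definition cylinder l : set (ipath L) :=
  [set x | path_arr x (dle0 (kdeg l)) = l].

Lemma shiftD p q x : shift p (shift q x) = shift (p + q) x.
Proof.
apply: ipathP => m n h /=.
move: (dle_add2r _ _) (dle_add2r _ _); rewrite !addrA => h1 h2.
by rewrite (bool_irrelevance h1 h2).
Qed.

Lemma shift0 x : shift 0 x = x.
Proof.
apply: ipathP => m n h /=.
by move: (dle_add2r _ _); rewrite !addr0 => h1; rewrite (bool_irrelevance h1 h).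
Qed.

(* The path l y: the unique x in Z(l) with sigma^(d(l))(x) = y; irrelevant
   unless [src l = y 0]. *)
Definition prepend l y : ipath L :=
  xget y [set x | cylinder l x /\ shift (kdeg l) x = y].
End Paths.

Section Prepend.
Variables (k : nat) (L : kgraph k).
Implicit Types (l a b c : arr L) (m n p : deg k).

Lemma daddI m n p : m + n = m + p -> n = p.
Proof.
by move=> /ffunP e; apply/ffunP => i; have := e i; rewrite !ffunE => /addnI.
Qed.

Lemma dsubK m n : dle m n -> m + dsub n m = n.
Proof. by move=> /dleP h; apply/ffunP => i; rewrite !ffunE; exact: subnKC. Qed.

Lemma kfact_inj a b a' b' : src a = rng b -> src a' = rng b' ->
  kdeg a = kdeg a' -> kcomp a b = kcomp a' b' -> a = a' /\ b = b'.
Proof.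
move=> h h' d e; have db : kdeg b = kdeg b'.
  by apply: (@daddI (kdeg a)); rewrite -kdeg_comp // e d kdeg_comp.
have [mn [_ u]] := kfact (kdeg_comp h).
have e1 : mn = (a, b) by apply: u.
have e2 : mn = (a', b') by apply: u; split=> //=; rewrite ?d ?db.
by move: e2; rewrite e1 => -[].
Qed.

Lemma kdeg0 l : kdeg l = 0 -> l = idm (rng l).
Proof.
move=> d; have h : src l = rng (idm (src l)) by rewrite rng_id.
have h' : src (idm (rng l)) = rng l by rewrite src_id.
have e : kcomp l (idm (src l)) = kcomp (idm (rng l)) l.
  by rewrite kcomp_id_l kcomp_id_r.
have d' : kdeg l = kdeg (idm (rng l)) by rewrite kdeg_id.
by have [] := kfact_inj h h' d' e.
Qed.

Definition segP l m n b : Prop := exists a c,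
  [/\ src a = rng b, src b = rng c, l = kcomp a (kcomp b c), kdeg a = m
    & kdeg b = dsub n m].

Lemma segP_ex l m n : dle m n -> dle n (kdeg l) -> exists b, segP l m n b.
Proof.
move=> hmn hn; have e := esym (dsubK (dle_trans hmn hn)).
have [[a b'] [[/= h1 h2 h3 h4] _]] := kfact e.
have e' : kdeg b' = dsub n m + dsub (kdeg l) n.
  by apply: (@daddI m); rewrite h4 -e addrA (dsubK hmn) dsubK.
have [[b c] [[/= g1 g2 g3 g4] _]] := kfact e'.
by exists b, a, c; split=> //; rewrite ?h1 ?g2 ?rng_comp // h2 g2.
Qed.

Lemma segP_uniq l m n b b' : segP l m n b -> segP l m n b' -> b = b'.
Proof.
move=> [a [c [h1 h2 h3 h4 h5]]] [a' [c' [g1 g2 g3 g4 g5]]].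
have h : src a = rng (kcomp b c) by rewrite rng_comp.
have g : src a' = rng (kcomp b' c') by rewrite rng_comp.
have d : kdeg a = kdeg a' by rewrite h4.
have e : kcomp a (kcomp b c) = kcomp a' (kcomp b' c') by rewrite -h3.
have [_ e'] := kfact_inj h g d e.
have d' : kdeg b = kdeg b' by rewrite h5.
by have [] := kfact_inj h2 g2 d' e'.
Qed.

Section Ex.
Variables (l : arr L) (y : ipath L).
Hypothesis ly : src l = y 0.

Let w n := kcomp l (path_arr y (dle0 n)).

Lemma ex_deg n : kdeg (w n) = kdeg l + n.
Proof.
rewrite kdeg_comp ?path_rng // path_deg; congr (_ + _).
by apply/ffunP => i; rewrite !ffunE subn0.
Qed.

Lemma ex_le n : dle n (kdeg (w n)).
Proof. by rewrite ex_deg; apply/dleP => i; rewrite !ffunE leq_addl. Qed.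

Lemma ex_w n p (h : dle n p) : w p = kcomp (w n) (path_arr y h).
Proof. by rewrite /w (path_comp y (dle0 n) h) kcompA ?path_rng ?path_src. Qed.

Lemma ex_src n : src (w n) = y n.
Proof. by rewrite src_comp ?path_src ?path_rng. Qed.

Let pa m n (h : dle m n) : arr L := projT1 (cid (segP_ex h (ex_le n))).
Let paP m n (h : dle m n) : segP (w n) m n (pa h).
Proof. exact: projT2 (cid _). Qed.

Lemma ex_comp m n p (h : dle m n) (h' : dle n p) (h'' : dle m p) :
  src (pa h) = rng (pa h') /\ pa h'' = kcomp (pa h) (pa h').
Proof.
have [a [c [h1 h2 h3 h4 h5]]] := paP h.
have [a' [c' [g1 g2 g3 g4 g5]]] := paP h'.
have wc : src c = rng (path_arr y h').
  by rewrite path_rng -(ex_src n) h3 !src_comp ?rng_comp.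
have q1 : src a' = rng (kcomp (pa h') c') by rewrite rng_comp.
have q2 : src (kcomp a (pa h)) = rng (kcomp c (path_arr y h')).
  by rewrite src_comp // rng_comp.
have q3 : kdeg a' = kdeg (kcomp a (pa h)).
  by rewrite g4 kdeg_comp // h4 h5 dsubK.
have q4 : kcomp a' (kcomp (pa h') c') =
          kcomp (kcomp a (pa h)) (kcomp c (path_arr y h')).
  rewrite -g3 (ex_w h') h3 -[LHS]kcompA ?rng_comp ?src_comp //.
  by rewrite -(kcompA h2) // -[RHS]kcompA ?rng_comp.
have [e _] := kfact_inj q1 q2 q3 q4.
have hs : src (pa h) = rng (pa h') by rewrite -g1 e src_comp.
split=> //; apply: (segP_uniq (paP h'')); exists a, c'; split=> //.
- by rewrite rng_comp.
- by rewrite src_comp.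
- by rewrite g3 e -!kcompA ?rng_comp.
by rewrite kdeg_comp // h5 g5; apply: (@daddI m); rewrite addrA !dsubK.
Qed.

Lemma ex_id m (h : dle m m) : pa h = idm (rng (pa h)).
Proof.
apply: kdeg0; have [a [c [_ _ _ _ ->]]] := paP h.
by apply/ffunP => i; rewrite !ffunE subnn.
Qed.

Lemma ex_rng m n (h : dle m n) : rng (pa h) = rng (pa (dle_refl m)).
Proof.
have [e _] := ex_comp (dle_refl m) h h.
by rewrite -e {1}ex_id src_id.
Qed.

Lemma ex_srcE m n (h : dle m n) : src (pa h) = rng (pa (dle_refl n)).
Proof. by have [e _] := ex_comp h (dle_refl n) h. Qed.

Definition ex_path : ipath L.
Proof.
apply: (@IPath k L (fun m => rng (pa (dle_refl m))) (fun m n h => pa h)).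
- exact: ex_rng.
- exact: ex_srcE.
- by move=> m h; rewrite {1}ex_id ex_rng.
- by move=> m n p h h' h''; have [] := ex_comp h h' h''.
- by move=> m n h; have [a [c []]] := paP h.
Defined.

Lemma ex_cylinder : cylinder l ex_path.
Proof.
have [a [c [h1 h2 h3 h4 h5]]] := paP (dle0 (kdeg l)).
have ea := kdeg0 h4.
rewrite /cylinder /= -/pa.
have q1 : src l = rng (path_arr y (dle0 (kdeg l))) by rewrite path_rng.
have q2 : kdeg (pa (dle0 (kdeg l))) = kdeg l.
  by rewrite h5; apply/ffunP => i; rewrite !ffunE subn0.
have q3 : kcomp (pa (dle0 (kdeg l))) c = kcomp l (path_arr y (dle0 (kdeg l))).
  rewrite -/(w _) h3 ea -[LHS]kcomp_id_l rng_comp // -h1 ea src_id.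
  by rewrite rng_id.
by have [] := kfact_inj h2 q1 q2 q3.
Qed.

Lemma ex_shift : shift (kdeg l) ex_path = y.
Proof.
apply: ipathP => m n h /=; set h' := dle_add2r _ _.
apply: (segP_uniq (paP h')).
have h0 : dle n (n + kdeg l) by apply/dleP => i; rewrite !ffunE leq_addr.
exists (w m), (path_arr y h0).
split.
- by rewrite ex_src path_rng.
- by rewrite path_src path_rng.
- rewrite (ex_w h0) (ex_w h) kcompA ?path_src ?path_rng //; exact: ex_src.
- by rewrite ex_deg addrC.
by rewrite path_deg dsub_add2r.
Qed.
End Ex.

Lemma prependP (l : arr L) (y : ipath L) : src l = y 0 ->
  cylinder l (prepend l y) /\ shift (kdeg l) (prepend l y) = y.
Proof.
move=> h; apply: (@xgetPex _ y
  [set x | cylinder l x /\ shift (kdeg l) x = y]).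
by exists (ex_path h); split; [exact: ex_cylinder | exact: ex_shift].
Qed.
End Prepend.

(* A groupoid whose object (unit) space and arrow space are topological.
   [gmul g h] is relevant only when [gsrc g = grng h]. The definitions below
   make sense without continuity of the structure maps, so that being etale is
   not part of the record. *)
Record groupoid := Groupoid {
  gobj : topologicalType;
  garr : topologicalType;
  grng : garr -> gobj;
  gsrc : garr -> gobj;
  gunit : gobj -> garr;
  gmul : garr -> garr -> garr;
  ginv : garr -> garr;
  grng_unit : forall x, grng (gunit x) = x;
  gsrc_unit : forall x, gsrc (gunit x) = x;
  grng_mul : forall g h, gsrc g = grng h -> grng (gmul g h) = grng g;
  gsrc_mul : forall g h, gsrc g = grng h -> gsrc (gmul g h) = gsrc h;
  gmul1g : forall g, gmul (gunit (grng g)) g = g;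
  gmulg1 : forall g, gmul g (gunit (gsrc g)) = g;
  gmulA : forall g h i, gsrc g = grng h -> gsrc h = grng i ->
    gmul g (gmul h i) = gmul (gmul g h) i;
  grng_inv : forall g, grng (ginv g) = gsrc g;
  gsrc_inv : forall g, gsrc (ginv g) = grng g;
  gmulV : forall g, gmul g (ginv g) = gunit (grng g);
  gmulVg : forall g, gmul (ginv g) g = gunit (gsrc g)
}.

Section Sheaves.
Variable G : groupoid.

(* The data of a G-sheaf: the stalks, a family of sets generating the topology
   of the total space, and the action of an arrow g, as a map from the stalk at y
   to the stalk at x for any [hr : grng g = x] and [hs : gsrc g = y]. The
   axioms are in [is_gsheaf]. *)
Record sheaf_data := SheafData {
  stalk :> gobj G -> zmodType;
  sgen : set (set {x : gobj G & stalk x});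
  gact : forall (g : garr G) (x y : gobj G), grng g = x -> gsrc g = y ->
    stalk y -> stalk x
}.

Definition total (A : sheaf_data) : topologicalType := gentop (sgen (s := A)).

Definition point (A : sheaf_data) x (a : A x) : total A := existT _ x a.

Definition sproj (A : sheaf_data) (a : total A) : gobj G := projT1 a.

(* The fibre product of the total spaces over the unit space. *)
Definition fibprod_incl (A B : sheaf_data) (u : {x : gobj G & (A x * B x)%type}) :
  total A * total B :=
  (point (tagged u).1, point (tagged u).2).

Definition fibprod (A B : sheaf_data) : topologicalType :=
  initial_topology (@fibprod_incl A B).

(* The space of pairs (g, a) with a in the stalk at s(g). *)
Definition actdom_incl (A : sheaf_data) (u : {g : garr G & A (gsrc g)}) :
  garr G * total A := (tag u, point (tagged u)).

Definition actdom (A : sheaf_data) : topologicalType :=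
  initial_topology (@actdom_incl A).

Record is_gsheaf (A : sheaf_data) : Prop := IsGSheaf {
  sheaf_local_homeo : local_homeo (@sproj A);
  sheaf_add_continuous : continuous
    (fun u : fibprod A A => point ((tagged u).1 + (tagged u).2));
  sheaf_opp_continuous : continuous
    (fun u : total A => point (- tagged u));
  sheaf_act_additive : forall g x y (hr : grng g = x) (hs : gsrc g = y),
    zmod_morphism (gact (s := A) hr hs);
  sheaf_act_unit : forall x (hr : grng (gunit x) = x) (hs : gsrc (gunit x) = x)
    (a : A x), gact hr hs a = a;
  sheaf_act_mul : forall g h x y z
    (gr : grng g = x) (gs : gsrc g = y) (hr : grng h = y) (hs : gsrc h = z)
    (ghr : grng (gmul g h) = x) (ghs : gsrc (gmul g h) = z) (a : A z),
    gact ghr ghs a = gact gr gs (gact hr hs a);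
  sheaf_act_continuous : continuous
    (fun u : actdom A => point (gact (erefl (grng (tag u))) erefl (tagged u)))
}.

Definition fmap (A B : sheaf_data) := forall x, A x -> B x.
Definition amap (A B : sheaf_data) := forall x, {additive A x -> B x}.

Definition fmap_of_amap A B (f : amap A B) : fmap A B := fun x => f x.
Coercion fmap_of_amap : amap >-> fmap.

Definition acomp A B C (f : amap B C) (g : amap A B) : amap A C :=
  fun x => f x \o g x.

(* [f] belongs to Hom_G(A, B). *)
Definition is_hom A B (f : fmap A B) : Prop :=
  [/\ forall x, zmod_morphism (f x),
      forall g x y (hr : grng g = x) (hs : gsrc g = y) (a : A y),
        f x (gact hr hs a) = gact hr hs (f y a) &
      continuous (fun a : total A => point (f (tag a) (tagged a)))].

(* The constant sheaf Z. *)
Definition Zsheaf : sheaf_data :=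
  @SheafData (fun _ => int)
    [set S | exists (U : set (gobj G)) (c : int),
       open U /\ S = [set existT _ x c | x in U]]
    (fun _ _ _ _ _ c => c).

(* The sequence ..., Q 1, Q 0, Z, so that [low Q n] is Q_(n-1). *)
Definition low (Q : nat -> sheaf_data) (n : nat) : sheaf_data :=
  if n is m.+1 then Q m else Zsheaf.

Definition lowmap (Q R : nat -> sheaf_data) (f : forall n, fmap (Q n) (R n)) n :
    fmap (low Q n) (low R n) :=
  if n is m.+1 then f m else fun _ c => c.

(* Objects and maps ... -> Q 1 -> Q 0 -> Z of a resolution; [res_map 0] is the
   augmentation. The constructions below do not use exactness. *)
Record resolution := Resolution {
  res_obj :> nat -> sheaf_data;
  res_map : forall n, amap (res_obj n) (low res_obj n)
}.

Arguments res_map r n x : rename.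
Arguments lowmap {Q R} f n x c : rename.
Arguments is_hom {A B} f.

Section Cohomology.
Variables (Q : resolution) (A : sheaf_data).

Definition is_cocycle n (c : amap (Q n) A) : Prop :=
  is_hom c /\ forall x (q : Q n.+1 x), c x (res_map Q n.+1 x q) = 0.

Definition cohomologous n : amap (Q n) A -> amap (Q n) A -> Prop :=
  match n with
  | 0 => fun c c' => forall x q, c' x q = c x q
  | m.+1 => fun c c' => exists2 b : amap (Q m) A, is_hom b &
      forall x q, c' x q = c x q + b x (res_map Q m.+1 x q)
  end.

(* The class [c] in H^n_Q(G, A), as the set of the cocycles cohomologous to c. *)
Definition coclass n (c : amap (Q n) A) : set (amap (Q n) A) :=
  [set c' | is_cocycle c' /\ cohomologous c c'].

Definition HQ n : set (set (amap (Q n) A)) :=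
  [set coclass c | c in @is_cocycle n].
End Cohomology.

Arguments HQ : clear implicits.

(* A sequence 0 -> A -> R_m -> R_(m-1) -> ... -> R_0 -> Z -> 0. Here [ext_top] is
   R_m and [ext_low i] is R_i for i < m; the values of [ext_low] and [ext_map] at
   larger indices are irrelevant. [ext_map i] is R_i -> R_(i-1), with R_(-1) = Z. *)
Record extension (A : sheaf_data) (m : nat) := Extension {
  ext_top : sheaf_data;
  ext_low : nat -> sheaf_data;
  ext_incl : fmap A ext_top;
  ext_proj : fmap ext_top (low ext_low m);
  ext_map : forall i, fmap (low ext_low i.+1) (low ext_low i)
}.

Arguments ext_incl {A m} e x a.
Arguments ext_proj {A m} e x u.
Arguments ext_map {A m} e i x u.

Section Extensions.
Variables (A : sheaf_data) (m : nat).
Implicit Types E : extension A m.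

(* The kernel of the map leaving R_(i-1), which is zero on R_(-1) = Z. *)
Definition ext_ker E i x : set (low (ext_low E) i x) :=
  match i return set (low (ext_low E) i x) with
  | 0 => setT
  | j.+1 => [set u | ext_map E j x u = 0]
  end.

Arguments ext_ker : clear implicits.

Record is_exact_ext E : Prop := IsExactExt {
  ext_top_sheaf : is_gsheaf (ext_top E);
  ext_low_sheaf : forall i, (i < m)%N -> is_gsheaf (ext_low E i);
  ext_incl_hom : is_hom (ext_incl E);
  ext_proj_hom : is_hom (ext_proj E);
  ext_map_hom : forall i, (i < m)%N -> is_hom (ext_map E i);
  ext_exact_A : forall x, injective (ext_incl E x);
  ext_exact_top : forall x, range (ext_incl E x) = [set u | ext_proj E x u = 0];
  ext_exact_proj : forall x, range (ext_proj E x) = ext_ker E m x;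
  ext_exact_low : forall i, (i < m)%N -> forall x,
    range (ext_map E i x) = ext_ker E i x
}.

(* There is a morphism of exact sequences from E to E' that is the identity on A
   and on Z. *)
Definition ext_morph E E' : Prop :=
  [/\ is_exact_ext E, is_exact_ext E' &
   exists (ft : fmap (ext_top E) (ext_top E'))
          (f : forall i, fmap (ext_low E i) (ext_low E' i)),
   [/\ is_hom ft, forall i, (i < m)%N -> is_hom (f i),
       forall x a, ft x (ext_incl E x a) = ext_incl E' x a,
       forall x u, ext_proj E' x (ft x u) = lowmap f m x (ext_proj E x u) &
       forall i, (i < m)%N -> forall x u,
         ext_map E' i x (lowmap f i.+1 x u) = lowmap f i x (ext_map E i x u)]].

Definition ext_equiv : extension A m -> extension A m -> Prop :=
  clos_refl_sym_trans _ ext_morph.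
End Extensions.

(* Elements of H^n(G, A) are classes of representatives: elements of
   Hom_G(Z, A) for n = 0 and exact sequences up to Yoneda equivalence for n > 0.
   As extensions are too large for [set], classes are plain predicates, and are
   compared extensionally by [eq_class]. *)
Definition Hrep (A : sheaf_data) (n : nat) : Type :=
  if n is m.+1 then extension A m else fmap Zsheaf A.

Definition Hrep_valid A n : Hrep A n -> Prop :=
  match n return Hrep A n -> Prop with
  | 0 => @is_hom Zsheaf A
  | m.+1 => @is_exact_ext A m
  end.

Definition Hrep_equiv A n : Hrep A n -> Hrep A n -> Prop :=
  match n return Hrep A n -> Hrep A n -> Prop with
  | 0 => fun f g => forall x c, f x c = g x c
  | m.+1 => @ext_equiv A m
  end.

Definition Hclass A n (E : Hrep A n) : Hrep A n -> Prop :=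
  fun E' => Hrep_valid E' /\ Hrep_equiv E E'.

Definition eq_class A n (C C' : Hrep A n -> Prop) : Prop :=
  forall E, C E <-> C' E.

(* [C] is an element of H^n(G, A). *)
Definition inH A n (C : Hrep A n -> Prop) : Prop :=
  exists2 E, Hrep_valid E & eq_class C (Hclass E).

(* (V + W) / {(f u, - g u) : u in U} *)
Section PushoutGroup.
Variables (U V W : zmodType) (f : {additive U -> V}) (g : {additive U -> W}).

Definition pushout_rel : {pred V * W} :=
  fun v => `[< exists u, v = (f u, - g u) >].

Lemma pushout_rel_closed : zmod_closed pushout_rel.
Proof.
split=> [|_ _ /asboolP[u ->] /asboolP[v ->]]; apply/asboolP.
  by exists 0; rewrite !raddf0.
by exists (u - v); rewrite (raddfB f) (raddfB g) opprD.
Qed.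

HB.instance Definition _ :=
  GRing.isZmodClosed.Build (V * W)%type pushout_rel pushout_rel_closed.

Definition pushout : zmodType := Quotient.quot pushout_rel.

Definition pushout_pi (v : V * W) : pushout := \pi_(Quotient.quot pushout_rel) v.
Definition pushout_repr (v : pushout) : V * W := repr v.
End PushoutGroup.

Section PushoutSheaf.
Variables (Q R A : sheaf_data) (c : amap Q A) (th : amap Q R).

Definition pushout_proj (u : fibprod A R) :
  {x : gobj G & pushout (c x) (th x)} := existT _ (tag u) (pushout_pi _ _ (tagged u)).

(* (A + R) / {(c q, - th q) : q in Q}, with the quotient topology. *)
Definition pushout_sheaf : sheaf_data :=
  @SheafData (fun x => pushout (c x) (th x))
    [set S | open (pushout_proj @^-1` S)]
    (fun g x y hr hs u => let v := pushout_repr u in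
       pushout_pi _ _ (gact hr hs v.1, gact hr hs v.2)).
End PushoutSheaf.

(* 0 -> A -> R_c -> Q_(m-1) -> ... -> Q_0 -> Z -> 0 for a cocycle c on Q_(m+1). *)
Definition rho_ext (Q : resolution) A m (c : amap (Q m.+1) A) : extension A m :=
  @Extension A m (pushout_sheaf c (res_map Q m.+1)) Q
    (fun x a => pushout_pi _ _ (a, 0))
    (fun x u => res_map Q m x (pushout_repr u).2)
    (fun i x q => res_map Q i x q).

(* [E] is the image under rho of the cocycle [c], before passing to classes. *)
Definition rho_rep (Q : resolution) A n : amap (Q n) A -> Hrep A n -> Prop :=
  match n return amap (Q n) A -> Hrep A n -> Prop with
  | 0 => fun c ct => forall x q, c x q = ct x (res_map Q 0 x q)
  | m.+1 => fun c E => E = rho_ext c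
  end.

(* The image of a class X in H^n_Q(G, A): the union of the classes of the images
   of the cocycles in X. *)
Definition rho (Q : resolution) A n (X : set (amap (Q n) A)) : Hrep A n -> Prop :=
  fun E => exists c E0, [/\ X c, rho_rep c E0, Hrep_valid E0 & Hclass E0 E].

(* The image of a class X in H^n_R(G, A) under [c] |-> [c o f]. *)
Definition pullback (Q R : resolution) n (f : amap (Q n) (R n)) A
    (X : set (amap (R n) A)) : set (amap (Q n) A) :=
  [set c' | exists2 c, X c & coclass (acomp c f) c'].

(* The map induced by f is [c] |-> [c o f] and commutes with the maps rho to
   H^n(G, A). *)
Definition rho_triangle (Q R : resolution) n (f : amap (Q n) (R n)) A : Prop :=
  [/\ forall c : amap (R n) A, is_cocycle c ->
        is_cocycle (acomp c f) /\
        pullback f (coclass c) = coclass (acomp c f),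
      forall X, HQ R A n X -> HQ Q A n (pullback f X),
      forall X, HQ R A n X -> inH (rho X) &
      forall X, HQ R A n X -> eq_class (rho (pullback f X)) (rho X)].
End Sheaves.

Arguments res_map {G} r n x : rename.
Arguments lowmap {G Q R} f n x c : rename.
Arguments is_hom {G A B} f.
Arguments HQ {G} Q A n X.

Section BarSheaf.
Variable G : groupoid.
Implicit Types (x : gobj G) (s : seq (garr G)).

Definition gcomposable s : bool := sorted (fun g h => gsrc g == grng h) s.

(* G^(n+1), as a subspace of the product of n+1 copies of G *)
Definition gtuple n := {t : n.+1.-tuple (garr G) | gcomposable t}.

Definition gtuple_incl n (t : gtuple n) :
  prod_topology (fun _ : 'I_n.+1 => garr G) := tnth (val t).

Definition gtuple_space n : topologicalType := initial_topology (@gtuple_incl n).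

Definition gcellP n x : pred (seq (garr G)) := fun s =>
  [&& size s == n.+1, gcomposable s & if s is g :: _ then grng g == x else false].

Definition gcell n x := {s : seq (garr G) | gcellP n x s}.

(* The generator [g_0, ..., g_n] of the stalk at x (0 if [s] is not of this form). *)
Definition bgen n x s : {freeg (gcell n x)} :=
  if insub s is Some c then << (c : gcell n x) >> else 0.

Definition gtuple_rng n (t : gtuple n) : gobj G := grng (thead (val t)).

Definition is_section n (U : set (gobj G)) (e : gobj G -> gtuple_space n) : Prop :=
  [/\ forall z, U z -> gtuple_rng (e z) = z,
      {within U, continuous e} & open (e @` U)].

Definition bar_basis n : set (set {x : gobj G & {freeg (gcell n x)}}) :=
  [set S | exists (U : set (gobj G)) (N : nat) (a : 'I_N -> int)
                  (e : 'I_N -> gobj G -> gtuple_space n),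
     [/\ open U, forall i, is_section U (e i) &
         S = [set existT _ z (\sum_i bgen n z (val (e i z)) *~ a i) | z in U]]].

Definition bar_sheaf n : sheaf_data G :=
  @SheafData G (fun x => {freeg (gcell n x)}) (@bar_basis n)
    (fun g x y _ _ => zlift (fun c : gcell n y =>
       bgen n x (mul_first (@gmul G) g (val c)))).

Definition bar_map n : amap (bar_sheaf n) (low bar_sheaf n) :=
  match n return amap (bar_sheaf n) (low bar_sheaf n) with
  | 0 => fun x => zlift (fun _ : gcell 0 x => 1 : int)
  | m.+1 => fun x => zlift (fun c : gcell m.+1 x =>
      bgen m x (take m.+1 (val c)) *~ (-1) ^+ m.+1 +
      \sum_(1 <= i < m.+2)
        bgen m x (contract (@gmul G) i.-1 (val c)) *~ (-1) ^+ i.-1)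
  end.

Definition bar_resolution : resolution G := Resolution bar_map.
End BarSheaf.

Section PathGroupoid.
Variables (k : nat) (L : kgraph k).

Definition path_space : topologicalType := gentop (range (@cylinder k L)).

Definition path_arrP (t : ipath L * zdeg k * ipath L) : bool :=
  `[< exists j l : deg k, t.1.2 = dint j - dint l /\ shift j t.1.1 = shift l t.2 >].

Definition path_garr := {t : ipath L * zdeg k * ipath L | path_arrP t}.

Definition path_bisection (l m : arr L) : set path_garr :=
  [set g | exists2 z : ipath L, z 0 = src l &
     val g = (prepend l z, dint (kdeg l) - dint (kdeg m), prepend m z)].

Definition path_arrow_space : topologicalType :=
  gentop [set S : set path_garr |
    exists l m, src l = src m /\ S = path_bisection l m].

Lemma path_arrP_unit (x : ipath L) : path_arrP (x, 0, x).
Proof. by apply/asboolP; exists 0, 0; rewrite subrr. Qed.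

Definition path_unit (x : ipath L) : path_garr := exist _ (x, 0, x) (path_arrP_unit x).

(* The arrow (x, m, y), for a triple that belongs to the path groupoid. *)
Definition mkarr (x : ipath L) (m : zdeg k) (y : ipath L) : path_garr :=
  insubd (path_unit x) (x, m, y).

Definition path_grng (g : path_garr) : ipath L := (val g).1.1.
Definition path_gdeg (g : path_garr) : zdeg k := (val g).1.2.
Definition path_gsrc (g : path_garr) : ipath L := (val g).2.

Definition path_gmul (g h : path_garr) : path_garr :=
  mkarr (path_grng g) (path_gdeg g + path_gdeg h) (path_gsrc h).

Definition path_ginv (g : path_garr) : path_garr :=
  mkarr (path_gsrc g) (- path_gdeg g) (path_grng g).

Lemma mkarrE x m y : path_arrP (x, m, y) -> val (mkarr x m y) = (x, m, y).
Proof. by move=> h; rewrite /mkarr val_insubd h. Qed.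

Lemma dintD (j l : deg k) : dint (j + l) = dint j + dint l.
Proof. by apply/ffunP => i; rewrite !ffunE. Qed.

Lemma path_arrP_mul g h : path_gsrc g = path_grng h ->
  path_arrP (path_grng g, path_gdeg g + path_gdeg h, path_gsrc h).
Proof.
have /asboolP[j [l [em exy]]] := valP g.
have /asboolP[j' [l' [en eyz]]] := valP h.
rewrite /path_gsrc /path_grng /path_gdeg => e.
apply/asboolP; exists (j' + j), (l + l'); split=> /=.
  by rewrite em en !dintD opprD addrACA (addrC (dint j')) -addrACA.
by rewrite -!shiftD exy e shiftD addrC -shiftD eyz !shiftD addrC.
Qed.

Lemma path_arrP_inv g : path_arrP (path_gsrc g, - path_gdeg g, path_grng g).
Proof.
have /asboolP[j [l [e exy]]] := valP g; apply/asboolP.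
by exists l, j; rewrite /path_gdeg /= e opprB.
Qed.

Lemma val_gmul g h : path_gsrc g = path_grng h ->
  val (path_gmul g h) = (path_grng g, path_gdeg g + path_gdeg h, path_gsrc h).
Proof. by move=> e; rewrite mkarrE ?path_arrP_mul. Qed.

Lemma val_ginv g : val (path_ginv g) = (path_gsrc g, - path_gdeg g, path_grng g).
Proof. by rewrite mkarrE ?path_arrP_inv. Qed.

Lemma path_garrP (g h : path_garr) : path_grng g = path_grng h ->
  path_gdeg g = path_gdeg h -> path_gsrc g = path_gsrc h -> g = h.
Proof.
rewrite /path_grng /path_gdeg /path_gsrc => er ed es; apply: val_inj.
by rewrite [LHS]surjective_pairing [(val g).1]surjective_pairing er ed es -!surjective_pairing.
Qed.

Lemma path_grng_mul g h : path_gsrc g = path_grng h ->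
  path_grng (path_gmul g h) = path_grng g.
Proof. by move=> e; rewrite {1}/path_grng val_gmul. Qed.

Lemma path_gsrc_mul g h : path_gsrc g = path_grng h ->
  path_gsrc (path_gmul g h) = path_gsrc h.
Proof. by move=> e; rewrite {1}/path_gsrc val_gmul. Qed.

Lemma path_gdeg_mul g h : path_gsrc g = path_grng h ->
  path_gdeg (path_gmul g h) = path_gdeg g + path_gdeg h.
Proof. by move=> e; rewrite {1}/path_gdeg val_gmul. Qed.

Lemma path_grng_inv g : path_grng (path_ginv g) = path_gsrc g.
Proof. by rewrite {1}/path_grng val_ginv. Qed.

Lemma path_gsrc_inv g : path_gsrc (path_ginv g) = path_grng g.
Proof. by rewrite {1}/path_gsrc val_ginv. Qed.

Lemma path_gdeg_inv g : path_gdeg (path_ginv g) = - path_gdeg g.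
Proof. by rewrite {1}/path_gdeg val_ginv. Qed.

Let pE := (path_grng_mul, path_gsrc_mul, path_gdeg_mul,
           path_grng_inv, path_gsrc_inv, path_gdeg_inv).

Lemma path_gmul1g g : path_gmul (path_unit (path_grng g)) g = g.
Proof. by apply: path_garrP; rewrite ?pE //; exact: add0r. Qed.

Lemma path_gmulg1 g : path_gmul g (path_unit (path_gsrc g)) = g.
Proof. by apply: path_garrP; rewrite ?pE //; exact: addr0. Qed.

Lemma path_gmulA g h i : path_gsrc g = path_grng h -> path_gsrc h = path_grng i ->
  path_gmul g (path_gmul h i) = path_gmul (path_gmul g h) i.
Proof. by move=> e e'; apply: path_garrP; rewrite ?pE ?addrA ?pE. Qed.

Lemma path_gmulV g : path_gmul g (path_ginv g) = path_unit (path_grng g).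
Proof. by apply: path_garrP; rewrite ?pE //; exact: subrr. Qed.

Lemma path_gmulVg g : path_gmul (path_ginv g) g = path_unit (path_gsrc g).
Proof. by apply: path_garrP; rewrite ?pE //; exact: addNr. Qed.

Definition path_groupoid : groupoid :=
  @Groupoid path_space path_arrow_space path_grng path_gsrc path_unit path_gmul
    path_ginv (fun _ => erefl) (fun _ => erefl) path_grng_mul path_gsrc_mul
    path_gmul1g path_gmulg1 path_gmulA path_grng_inv path_gsrc_inv
    path_gmulV path_gmulVg.
End PathGroupoid.

Section DirectLimit.
Variables (k : nat) (L : kgraph k) (A : rmod L) (x : ipath L).

Definition step (p q : deg k) (h : dle p q) : {additive A (x p) -> A (x q)} :=
  mact A (path_rng x h) (path_src x h).

Lemma mact_eq (l l' : arr L) u v (hr : rng l = u) (hs : src l = v)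
    (hr' : rng l' = u) (hs' : src l' = v) a :
  l = l' -> mact A hr hs a = mact A hr' hs' a.
Proof.
move=> e; subst l'; by rewrite (Prop_irrelevance hr hr') (Prop_irrelevance hs hs').
Qed.

Lemma step_id p (h : dle p p) a : step h a = a.
Proof.
rewrite /step; have e := path_id x h.
by rewrite (mact_eq _ _ (rng_id _) (src_id _) _ e) mact_id.
Qed.

Lemma step_comp p q r (h : dle p q) (h' : dle q r) (h'' : dle p r) a :
  step h' (step h a) = step h'' a.
Proof.
have e := path_comp x h h' h''; rewrite /step.
have hm : src (path_arr x h) = rng (path_arr x h') by rewrite path_src path_rng.
have hr : rng (kcomp (path_arr x h) (path_arr x h')) = x p.
  by rewrite rng_comp // path_rng.
have hs : src (kcomp (path_arr x h) (path_arr x h')) = x r.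
  by rewrite src_comp // path_src.
rewrite (mact_eq (path_rng x h'') (path_src x h'') hr hs _ e).
by rewrite (mact_comp (path_rng x h) (path_src x h)
  (path_rng x h') (path_src x h')).
Qed.

Definition dl_pre := {p : deg k & A (x p)}.

Definition dl_rel : rel dl_pre := fun u v =>
  `[< exists (r : deg k) (hu : dle (tag u) r) (hv : dle (tag v) r),
        step hu (tagged u) = step hv (tagged v) >].

Lemma dl_rel_refl : reflexive dl_rel.
Proof. by move=> u; apply/asboolP; exists (tag u), (dle_refl _), (dle_refl _). Qed.

Lemma dl_rel_sym : symmetric dl_rel.
Proof.
by move=> u v; apply/asboolP/asboolP => -[r [hu [hv e]]]; exists r, hv, hu.
Qed.

Lemma dl_rel_trans : transitive dl_rel.
Proof.
move=> v u w /asboolP[r [hu [hv e]]] /asboolP[r' [hv' [hw e']]].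
apply/asboolP; exists (dmax r r').
have h1 := dle_maxl r r'; have h2 := dle_maxr r r'.
exists (dle_trans hu h1), (dle_trans hw h2).
rewrite -(step_comp hu h1) -(step_comp hw h2) e -e'.
by rewrite (step_comp hv h1 (dle_trans hv h1)) (step_comp hv' h2 (dle_trans hv h1)).
Qed.

Canonical dl_equiv := EquivRel dl_rel dl_rel_refl dl_rel_sym dl_rel_trans.

Definition dlim := {eq_quot dl_rel}.
HB.instance Definition _ := Choice.on dlim.

(* The natural map phi^x_p. *)
Definition dlphi (p : deg k) (a : A (x p)) : dlim :=
  \pi_dlim (existT (fun p => A (x p)) p a).

Lemma dlphi_eq p q (a : A (x p)) (b : A (x q)) :
  (exists (r : deg k) (hp : dle p r) (hq : dle q r), step hp a = step hq b) <->
  dlphi a = dlphi b.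
Proof.
split=> [h|/eqmodP/asboolP //]; by apply/eqmodP/asboolP.
Qed.

Lemma dlphi_step p q (h : dle p q) a : dlphi (step h a) = dlphi a.
Proof.
apply/dlphi_eq; exists q, (dle_refl q), h; by rewrite step_id.
Qed.

Lemma dlphi_surj (u : dlim) : exists p (a : A (x p)), u = dlphi a.
Proof. by exists (tag (repr u)), (tagged (repr u)); rewrite /dlphi -[LHS]reprK; case: (repr u). Qed.

Definition dladd (u v : dlim) : dlim :=
  dlphi (step (dle_maxl (tag (repr u)) (tag (repr v))) (tagged (repr u)) +
         step (dle_maxr (tag (repr u)) (tag (repr v))) (tagged (repr v))).
Definition dlopp (u : dlim) : dlim := dlphi (- tagged (repr u)).
Definition dlzero : dlim := dlphi (0 : A (x 0)).

Lemma dl_common (u v : dlim) : exists p (a b : A (x p)), u = dlphi a /\ v = dlphi b.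
Proof.
have [p [a ->]] := dlphi_surj u; have [q [b ->]] := dlphi_surj v.
by exists (dmax p q), (step (dle_maxl p q) a), (step (dle_maxr p q) b); rewrite !dlphi_step.
Qed.

Lemma dlphi_repr (u : dlim) : dlphi (tagged (repr u)) = u.
Proof. by rewrite /dlphi -[RHS]reprK; case: (repr u). Qed.

Lemma dladdE p (a b : A (x p)) : dladd (dlphi a) (dlphi b) = dlphi (a + b).
Proof.
rewrite /dladd.
have /dlphi_eq[r [h1 [h2 e]]] := dlphi_repr (dlphi a).
have /dlphi_eq[r' [h1' [h2' e']]] := dlphi_repr (dlphi b).
move: (tag _) (tag _) (tagged _) (tagged _) h1 h2 e h1' h2' e'.
move=> q q' c c' h1 h2 e h1' h2' e'.
apply/dlphi_eq; set m := dmax q q'; set R := dmax (dmax r r') m.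
have hr : dle r R by apply: dle_trans (dle_maxl _ _) (dle_maxl _ _).
have hr' : dle r' R by apply: dle_trans (dle_maxr _ _) (dle_maxl _ _).
have hm : dle m R by apply: dle_maxr.
have hp : dle p R by apply: dle_trans h2 hr.
exists R, hm, hp; rewrite !raddfD.
rewrite (step_comp _ _ (dle_trans h1 hr)) (step_comp _ _ (dle_trans h1' hr')).
rewrite -(step_comp h1 hr) e -(step_comp h1' hr') e'.
by rewrite !(step_comp _ _ hp).
Qed.

Lemma dloppE p (a : A (x p)) : dlopp (dlphi a) = dlphi (- a).
Proof.
rewrite /dlopp; have /dlphi_eq[r [h1 [h2 e]]] := dlphi_repr (dlphi a).
by apply/dlphi_eq; exists r, h1, h2; rewrite !raddfN e.
Qed.

Lemma dlzeroE p : dlphi (0 : A (x p)) = dlzero.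
Proof. by rewrite /dlzero -(dlphi_step (dle0 p)) raddf0. Qed.

Lemma dladdA : associative dladd.
Proof.
move=> u v w; have [p [a [b [-> ->]]]] := dl_common u v.
have [q [c ->]] := dlphi_surj w.
rewrite -(dlphi_step (dle_maxl p q) a) -(dlphi_step (dle_maxl p q) b).
by rewrite -(dlphi_step (dle_maxr p q) c) !dladdE addrA.
Qed.

Lemma dladdC : commutative dladd.
Proof. by move=> u v; have [p [a [b [-> ->]]]] := dl_common u v; rewrite !dladdE addrC. Qed.

Lemma dladd0 : left_id dlzero dladd.
Proof.
by move=> u; have [p [a ->]] := dlphi_surj u; rewrite -(dlzeroE p) dladdE add0r.
Qed.

Lemma dladdN : left_inverse dlzero dlopp dladd.
Proof.
by move=> u; have [p [a ->]] := dlphi_surj u; rewrite dloppE dladdE addNr dlzeroE.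
Qed.

HB.instance Definition _ :=
  GRing.isZmodule.Build dlim dladdA dladdC dladd0 dladdN.

Lemma dlphi_is_zmod_morphism p : zmod_morphism (@dlphi p).
Proof. by move=> a b; rewrite -dladdE -dloppE. Qed.

HB.instance Definition _ p :=
  @GRing.isZmodMorphism.Build (A (x p)) dlim (dlphi (p := p)) (@dlphi_is_zmod_morphism p).

Definition dllift (M : zmodType) (f : forall p, {additive A (x p) -> M})
  (_ : forall p q (h : dle p q) a, f q (step h a) = f p a) (u : dlim) : M :=
  f (tag (repr u)) (tagged (repr u)).

Section Lift.
Variables (M : zmodType) (f : forall p, {additive A (x p) -> M}).
Hypothesis hf : forall p q (h : dle p q) a, f q (step h a) = f p a.

Lemma dlliftE p (a : A (x p)) : dllift hf (dlphi a) = f p a.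
Proof.
rewrite /dllift; have /dlphi_eq[r [h1 [h2 e]]] := dlphi_repr (dlphi a).
by rewrite -(hf h1) e hf.
Qed.

Lemma dllift_is_zmod_morphism : zmod_morphism (dllift hf).
Proof.
move=> u v; have [p [a [b [-> ->]]]] := dl_common u v.
by rewrite -raddfB !dlliftE raddfB.
Qed.

HB.instance Definition _ :=
  GRing.isZmodMorphism.Build dlim M (dllift hf) dllift_is_zmod_morphism.
End Lift.
End DirectLimit.

Section Underline.
Variables (k : nat) (L : kgraph k).

(* b in A_(y(q)), seen in A_(x(p)) when y(q) = x(p) *)
Definition castv (A : rmod L) (u v : vtx L) (e : u = v) (a : A u) : A v :=
  eq_rect u (fun w => A w : Type) a v e.

(* The sets S_(a, l) *)
Definition underline_basis (A : rmod L) : set (set {x : ipath L & dlim A x}) :=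
  [set S | exists (l : arr L) (a : A (src l)),
     S = [set u | exists (y : ipath L) (e : src l = y (kdeg l)),
            cylinder l y /\ u = existT _ y (dlphi (castv e a))]].

(* The graph of the action of the arrow (x, m, y): (x, p - q, y) maps phi^y_q(b)
   to phi^x_p(b) whenever sigma^p(x) = sigma^q(y). *)
Definition underline_act_graph (A : rmod L) (x : ipath L) (m : zdeg k)
    (y : ipath L) (u : dlim A y) : set (dlim A x) :=
  [set v | exists (p q : deg k) (e : y q = x p) (b : A (y q)),
     [/\ m = dint p - dint q, shift p x = shift q y, u = dlphi b &
         v = dlphi (castv e b)]].

Arguments underline_act_graph {A} x m {y} u.

Definition underline (A : rmod L) : sheaf_data (path_groupoid L) :=
  @SheafData (path_groupoid L) (fun x => dlim A x) (@underline_basis A)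
    (fun g x y _ _ u => xget 0 (underline_act_graph x (path_gdeg g) u)).

Lemma underline_map_compat (A B : rmod L) (f : rmod_hom A B) (x : ipath L)
    p q (h : dle p q) (a : A (x p)) :
  (@dlphi _ _ B x q \o f (x q)) (step A x h a) = (@dlphi _ _ B x p \o f (x p)) a.
Proof. by rewrite /= mod_map_nat; exact: dlphi_step. Qed.

Definition underline_map (A B : rmod L) (f : rmod_hom A B) :
    amap (underline A) (underline B) :=
  fun x => dllift (underline_map_compat f (x := x)).

(* The identification of the sheaf of the constant module with the constant
   sheaf, phi^x_p(c) |-> c. *)
Definition underline_const : amap (underline (zconst L)) (Zsheaf (path_groupoid L)) :=
  fun x => dllift (A := zconst L) (x := x) (M := int)
    (f := fun _ => idfun) (fun _ _ _ _ => erefl).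

Definition underlineP (n : nat) : sheaf_data (path_groupoid L) := underline (Pmod L n).

Definition underline_diff n : amap (underlineP n) (low underlineP n) :=
  match n return amap (underlineP n) (low underlineP n) with
  | 0 => acomp underline_const (underline_map (pdiff L 0))
  | m.+1 => underline_map (pdiff L m.+1)
  end.

Definition underline_resolution : resolution (path_groupoid L) :=
  Resolution underline_diff.

(* (g_1, ..., g_n) for (l_1, ..., l_n) given in reverse order, starting at y. *)
Fixpoint psi_chain (y : ipath L) (ls : seq (arr L)) : seq (garr (path_groupoid L)) :=
  if ls is l :: ls' then
    mkarr y (- dint (kdeg l)) (prepend l y) :: psi_chain (prepend l y) ls'
  else [::].

Definition psi_gen n (x : ipath L) (g : path_garr L) (ls : seq (arr L)) :
    bar_sheaf (path_groupoid L) n x :=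
  bgen (G := path_groupoid L) n x (g :: psi_chain (path_gsrc g) (rev ls)) *~ (-1) ^+ uphalf n.

(* [psi] is the additive map with these values on generators, where
   phi^x_p [l_0, ..., l_n] is identified with
   [(x, p - d(l_n), l_n sigma^p(x)), (l_0, ..., l_(n-1))]. *)
Definition is_psi n (psi : amap (underlineP n) (bar_sheaf (path_groupoid L) n)) : Prop :=
  forall (x : ipath L) (p : deg k) (ls : seq (arr L)) (l : arr L),
    pcellP n (x p) (rcons ls l) ->
    psi x (dlphi (pgen n (x p) (rcons ls l) : Pmod L n (x p))) =
    psi_gen n x (mkarr x (dint p - dint (kdeg l)) (prepend l (shift p x))) ls.
End Underline.

(* Main.v *)
(* A chain map f : Q -> R of resolutions of Z by G-sheaves induces, for every
   cocycle c on R_(m+1), the morphism of extensions [a, p] |-> [a, f p] from the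
   pushout along c o f to the pushout along c, which is the identity on A and on
   Z; hence the triangle commutes. That the two resolutions are exact is seen on
   stalks, by contracting homotopies: [g_0, ..., g_n] |-> [r(g_0), g_0, ..., g_n]
   for the bar resolution and, before passing to the direct limits, the map
   [l_0, ..., l_n] |-> [l_0, ..., l_n, s(l_n)] for P, up to sign.

   For a sheaf whose projection is a local homeomorphism, continuity of fibrewise
   maps can be tested along local sections. In the bar sheaf these are the finite
   Z-combinations of tuples of continuous local sections of r, and in the sheaf of
   a module A the maps y |-> phi^y_p(a); psi sends the latter to the former.

   Listing (l_0, ..., l_n) backwards, psi takes phi^x_p [l_0, ..., l_n] to the
   tuple of arrows obtained by successively prefixing l_n, ..., l_0 to sigma^p(x),
   so that multiplying adjacent arrows amounts to composing adjacent l_i. This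
   turns the boundary of P into that of the bar resolution, with the order of the
   summands reversed. *)

From HB Require Import structures.
From Stdlib Require Import Relation_Operators.
From mathcomp Require Import all_boot all_algebra.
From mathcomp Require Import finmap all_classical.
From mathcomp Require Import topology_structure initial_topology.
From mathcomp Require Import supremum_topology product_topology subspace_topology.
From mathcomp Require Import function_spaces.
From mathcomp.multinomials Require Import freeg.
From mathcomp Require Import zify.
Require Import Defs.

Set Implicit Arguments.
Unset Strict Implicit.
Unset Printing Implicit Defensive.

Import GRing.Theory.

Local Open Scope classical_set_scope.
Local Open Scope quotient_scope.
Local Open Scope ring_scope.

(** * Continuity at a point *)

(** [rho] is defined as a union over the cocycles of a class, so cohomologous cocycles have to give
    equivalent extensions. In positive degrees this and the triangle are two instances of one
    construction, a morphism of extensions built from a chain map f and an identity c' o f = c + b o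
    d: the chain map psi with b = 0 gives the triangle, the identity with any b gives independence
    of the cocycle.

    The topologies are given by subbases, so the continuity of a generating section is itself a
    claim: two such sections that agree at a point must agree near it. For the bar sheaves this
    rests on freeness of the stalks and local injectivity of r, for module sheaves on the fact that
    equality in the limit is reached at a finite stage.

    The homotopies do not commute with the actions. They are therefore used stalk by stalk, and for
    P at a finite stage of the limit, to which a cycle of the limit has to be lifted.

    Sign of psi_n: reversing the order of the summands changes the n-th boundary by (-1)^n, so psi_n
    needs (-1)^(1 + ... + n), and n(n+1)/2 has the parity of the upper half of n. *)

Lemma existT_inj2 (I : Type) (P : I -> Type) (i : I) (a b : P i) :
  existT P i a = existT P i b -> a = b.
Proof.
(* Transport along the equality of tags, a proof of [i = i], which proof irrelevance replaces by
   [erefl]. *)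
move=> e; have h : forall u (E : existT P i a = u),
    eq_rect i P a (tag u) (f_equal tag E) = tagged u by move=> u; case: _ /.
by have /= := h _ e; rewrite (Prop_irrelevance (f_equal tag e) erefl).
Qed.

Section ContinuityAt.
Variables (T U : topologicalType).

(** Continuity at one point depends only on the germ ([near_cts]); this suits maps given by a
    formula near a point and by a default value elsewhere. *)
Definition cts (f : T -> U) (x : T) : Prop :=
  forall W, nbhs (f x) W -> \forall z \near x, W (f z).

Lemma cts_open (f : T -> U) x :
  (forall W, open W -> W (f x) -> \forall z \near x, W (f z)) -> cts f x.
Proof.
move=> h W; rewrite nbhsE => -[V [oV Vx] VW].
by apply: filterS (h V oV Vx) => z /VW.
Qed.

Lemma near_cts (f g : T -> U) x :
  cts f x -> (\forall z \near x, f z = g z) -> cts g x.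
Proof.
move=> cf e W hW; have ex := nbhs_singleton e; rewrite -ex in hW.
by apply: filterS (filterI (cf _ hW) e) => z [h <-].
Qed.

Lemma near_open (x : T) (P : set T) : (\forall z \near x, P z) ->
  exists W : set T, [/\ open W, W x & forall z, W z -> P z].
Proof.
move=> h; have : nbhs x P by [].
by rewrite nbhsE => -[W [oW Wx] hW]; exists W; split.
Qed.

End ContinuityAt.

Lemma cts_id (T : topologicalType) (x : T) : cts (fun z => z) x.
Proof. by []. Qed.

Lemma cts_comp (T U V : topologicalType) (f : T -> U) (g : U -> V) x :
  cts f x -> cts g (f x) -> cts (fun z => g (f z)) x.
Proof. by move=> cf cg W /cg /cf. Qed.

Lemma cts_pair (T U V : topologicalType) (f : T -> U) (g : T -> V) x :
  cts f x -> cts g x -> cts (fun z => (f z, g z)) x.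
Proof.
move=> cf cg W [[A B] /= [/cf hA /cg hB] AB].
by apply: filterS (filterI hA hB) => z [? ?]; apply: AB.
Qed.

Lemma cts_fst (U V : topologicalType) (u : U * V) : cts fst u.
Proof. by move=> W h; exists (W, setT) => [|[a b] []] //=; split=> //; exact: filterT. Qed.

Lemma cts_snd (U V : topologicalType) (u : U * V) : cts snd u.
Proof. by move=> W h; exists (setT, W) => [|[a b] []] //=; split=> //; exact: filterT. Qed.

Lemma gentop_open (S : choiceType) (B : set (set S)) (W : set S) :
  B W -> open (W : set (gentop B)).
Proof.
move=> BW; exists [set W] => [_ -> |]; last first.
  by apply/seteqP; split=> [z [_ -> //]|z Wz]; exists W.
exists [fset W]%fset; first by move=> i /fset1P ->; exact: mem_set.
by apply/seteqP; split=> z; [apply; exact/fset1P | move=> Wz i /fset1P ->].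
Qed.

(** The finite intersection of subbasic sets is indexed by a list, so that later proofs can go by
    induction on it. *)
Lemma nbhs_gentop (S : choiceType) (B : set (set S)) (x : gentop B) (W : set S) :
  nbhs x W -> exists D : seq (set S), [/\ forall V, V \in D -> B V,
    forall V, V \in D -> V x & forall z, (forall V, V \in D -> V z) -> W z].
Proof.
rewrite nbhsE => -[_ [[D' sD' <-] [I D'I Ix]] h].
have [D sD eI] := sD' _ D'I; exists (enum_fset D).
split=> [V VD|V VD|z hz].
- by have := sD V VD; rewrite inE.
- by move: Ix; rewrite /= -eI; apply.
- by apply: h; exists I => //; rewrite /= -eI => V; exact: hz.
Qed.

Lemma cts_gentop (T : topologicalType) (S : choiceType) (B : set (set S))
    (f : T -> gentop B) x :
  (forall W, B W -> W (f x) -> \forall z \near x, W (f z)) -> cts f x.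
Proof.
move=> h W /nbhs_gentop[D [hB hx hW]].
apply: (@filterS _ _ _ [set z | forall V, V \in D -> V (f z)]) => [z /hW //|].
elim: D hB hx {hW} => [|V D IH] hB hx; first by apply: filterE.
have h1 := h V (hB V (mem_head _ _)) (hx V (mem_head _ _)).
have h2 := IH (fun V' h' => hB V' (mem_behead (s := V :: D) h'))
  (fun V' h' => hx V' (mem_behead (s := V :: D) h')).
by apply: filterS (filterI h1 h2) => z [? hz] V'; rewrite inE => /orP[/eqP ->|/hz].
Qed.

Section Initial.
Variables (S : choiceType) (U : topologicalType) (i : S -> U).

Lemma cts_into_initial (T : topologicalType) (f : T -> initial_topology i) x :
  cts (fun z => i (f z)) x -> cts f x.
Proof.
move=> cf; apply: cts_open => _ [V oV <-] Vx.
by apply: cf; apply: open_nbhs_nbhs.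
Qed.

Lemma cts_initial (x : initial_topology i) : cts (i : initial_topology i -> U) x.
Proof. exact: initial_continuous. Qed.
End Initial.

Section ProdTopology.
Variables (I : finType) (V : topologicalType).

Lemma cts_into_prod (T : topologicalType) (f : T -> prod_topology (fun _ : I => V)) x :
  (forall i, cts (fun z => f z i) x) -> cts f x.
Proof.
move=> h; suff : f @ x --> f x by [].
apply/cvg_sup.
move=> i W; rewrite (@nbhsE (initial_topology _)) => -[_ [[O oO <-] Ox] hW].
have := h i O (open_nbhs_nbhs (conj oO Ox)).
by apply: filterS => z Oz; apply: hW.
Qed.

Lemma cts_proj i (x : prod_topology (fun _ : I => V)) :
  cts (fun u : prod_topology (fun _ : I => V) => u i) x.
Proof. exact: proj_continuous. Qed.
End ProdTopology.

(** * Continuous local sections of sheaves *)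

Definition loc_inj (E : topologicalType) (X : Type) (f : E -> X) : Prop :=
  forall a, exists V : set E, [/\ open V, V a & set_inj V f].

(** Near [t] both maps take values in one open set on which [p] is injective. Used with the
    projection of a sheaf and with the range map of a groupoid. *)
Lemma loc_inj_uniq (T E : topologicalType) (X : Type) (p : E -> X) (e f : T -> E) t :
  loc_inj p -> cts e t -> cts f t -> e t = f t ->
  (\forall z \near t, p (e z) = p (f z)) -> \forall z \near t, e z = f z.
Proof.
move=> inj ce cf ef pef; have [V [oV Ve injV]] := inj (e t).
have h1 := ce _ (open_nbhs_nbhs (conj oV Ve)).
rewrite ef in Ve; have h2 := cf _ (open_nbhs_nbhs (conj oV Ve)).
apply: filterS (filterI pef (filterI h1 h2)) => z [epf [V1 V2]].
by apply: injV epf; exact/mem_set.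
Qed.

Lemma local_homeo_loc_inj (E X : topologicalType) (f : E -> X) :
  local_homeo f -> loc_inj f.
Proof. by move=> h a; have [V [oV Va injV _ _]] := h a; exists V. Qed.

Lemma local_homeo_cts (E X : topologicalType) (f : E -> X) e :
  local_homeo f -> cts f e.
Proof.
move=> h; have [V [oV Ve _ + _]] := h e.
by rewrite (continuous_open_subspace _ oV) => /(_ e (mem_set Ve)).
Qed.

(** Near [e] the map [f] factors through [p]. This one criterion serves total spaces, fibre products
    and domains of actions. *)
Lemma cts_local_section (E X T : topologicalType) (p : E -> X) (s : X -> E)
    (f : E -> T) e :
  cts p e -> (\forall e' \near e, s (p e') = e') -> cts (fun z => f (s z)) (p e) ->
  cts f e.
Proof.
move=> cp sp /(cts_comp cp) cf.
by apply: near_cts cf _; apply: filterS sp => z ->.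
Qed.

Section Sections.
Variable G : groupoid.
Implicit Types (A B : sheaf_data G) (x z : gobj G).

(** A section is a function on the whole unit space of which only the germ at [x] matters; local
    sections are extended by 0, which avoids dependent functions on subsets. *)
Definition csec A x (s : forall z, A z) : Prop :=
  @cts (gobj G) (total A) (fun z => point (s z)) x.

Lemma near_csec A x (s t : forall z, A z) :
  csec x s -> (\forall z \near x, s z = t z) -> csec x t.
Proof. by move=> cs e; apply: near_cts cs _; apply: filterS e => z ->. Qed.

Lemma cts_sproj A : local_homeo (@sproj G A) -> forall e, cts (@sproj G A) e.
Proof. by move=> h e; exact: local_homeo_cts. Qed.

Lemma csec_uniq A x (s t : forall z, A z) : local_homeo (@sproj G A) ->
  csec x s -> csec x t -> s x = t x -> \forall z \near x, s z = t z.
Proof.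
move=> /local_homeo_loc_inj h cs ct st.
have e : point (s x) = point (t x) by rewrite st.
have : \forall z \near x, sproj (point (s z)) = sproj (point (t z)).
  by apply: filterE.
by move=> e'; apply: filterS (loc_inj_uniq h cs ct e e') => z e1; exact: existT_inj2 e1.
Qed.

Lemma csec_ex A x (a : A x) : local_homeo (@sproj G A) ->
  exists s : forall z, A z, s x = a /\ \forall z \near x, csec z s.
Proof.
move=> h; have [U [oU Ua injU _ opU]] := h (point a).
(* The inverse of the projection on [U], with default value 0 off the image of [U]. *)
pose s z : A z := xget 0 [set b : A z | U (point b)].
have sU z : (@sproj G A @` U) z -> U (point (s z)).
  by move=> [[z' b] Ub /= <-]; apply: (@xgetPex _ 0 [set b : A z' | U (point b)]); exists b.
have px : (@sproj G A @` U) x by exists (point a).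
exists s; split.
  have e1 : point (s x) = point a by apply: injU; rewrite ?inE //; exact: sU.
  exact: existT_inj2 e1.
have oV := opU _ oU (@subset_refl _ U).
apply: filterS (open_nbhs_nbhs (conj oV px)) => z Vz.
apply: cts_open => W oW Ws.
have hz : (@sproj G A @` (W `&` U)) z by exists (point (s z)) => //; split=> //; exact: sU.
apply: filterS (open_nbhs_nbhs (conj (opU _ (openI oW oU) (@subIsetr _ _ _)) hz)).
move=> z' [[z'' b] [Wb Ub] /= e]; subst z''.
suff -> : point (s z') = existT _ z' b by [].
by apply: injU; rewrite ?inE //; apply: sU; exists (existT _ z' b).
Qed.

(** On the total space, the section composed with the projection and the identity are continuous,
    lie over the same point and agree at [point a]; local injectivity makes them agree nearby. *)
Lemma near_section A x (s : forall z, A z) (a : A x) : local_homeo (@sproj G A) ->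
  csec x s -> s x = a -> \forall e \near (point a : total A), s (tag e) = tagged e.
Proof.
move=> h cs <-.
have c1 : cts (fun e : total A => point (s (sproj e))) (point (s x)).
  exact: (cts_comp (g := fun z => point (s z)) (cts_sproj h (e := point (s x))) cs).
have c2 := @cts_id _ (point (s x) : total A).
have : \forall e \near (point (s x) : total A), sproj (point (s (sproj e))) = sproj e.
  by apply: filterE.
move=> e'; have := loc_inj_uniq (local_homeo_loc_inj h) c1 c2 erefl e'.
by apply: filterS => -[z b] /= e1; exact: existT_inj2 e1.
Qed.

(* Near [point a], every point of the total space lies on the section [s]. *)
Lemma cts_total A (T : topologicalType) (f : total A -> T) x (s : forall z, A z) a :
  local_homeo (@sproj G A) -> csec x s -> s x = a ->
  cts (fun z => f (point (s z))) x -> cts f (point a).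
Proof.
move=> h cs sa cf; apply: (@cts_local_section _ _ _ (@sproj G A)
  (fun z => point (s z)) f (point a)) => //.
  exact: cts_sproj.
by apply: filterS (near_section h cs sa) => -[z b] /= <-.
Qed.

Lemma cts_fib1 A B (u : fibprod A B) :
  cts (fun v : fibprod A B => point (tagged v).1) u.
Proof. have c := @cts_comp (fibprod A B) _ _ (@fibprod_incl G A B) fst u.
by apply: c; [exact: cts_initial | exact: cts_fst]. Qed.

Lemma cts_fib2 A B (u : fibprod A B) :
  cts (fun v : fibprod A B => point (tagged v).2) u.
Proof. have c := @cts_comp (fibprod A B) _ _ (@fibprod_incl G A B) snd u.
by apply: c; [exact: cts_initial | exact: cts_snd]. Qed.

Definition fpoint A B x (a : A x) (b : B x) : fibprod A B := existT _ x (a, b).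

Lemma cts_fpoint A B (T : topologicalType) (r : T -> gobj G)
    (f : forall t, A (r t)) (g : forall t, B (r t)) t :
  cts (fun t => point (f t)) t -> cts (fun t => point (g t)) t ->
  cts (fun t => fpoint (f t) (g t)) t.
Proof. by move=> cf cg; apply: cts_into_initial; exact: cts_pair. Qed.

Lemma cts_fib_tag A B (u : fibprod A B) : local_homeo (@sproj G A) ->
  cts (fun v : fibprod A B => tag v) u.
Proof.
move=> h; exact: (cts_comp (g := @sproj G A) (@cts_fib1 A B u) (cts_sproj h (e := _))).
Qed.

Lemma near_fib A B x (s : forall z, A z) (t : forall z, B z) (a : A x) (b : B x) :
  local_homeo (@sproj G A) -> local_homeo (@sproj G B) ->
  csec x s -> csec x t -> s x = a -> t x = b ->
  \forall u \near fpoint a b, tagged u = (s (tag u), t (tag u)).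
Proof.
move=> hA hB cs ct sa tb.
have h1 := cts_fib1 (u := fpoint a b) (near_section hA cs sa).
have h2 := cts_fib2 (u := fpoint a b) (near_section hB ct tb).
by apply: filterS (filterI h1 h2) => -[z [a' b']] /= [-> ->].
Qed.

Lemma cts_fibprod A B (T : topologicalType) (f : fibprod A B -> T) x
    (s : forall z, A z) (t : forall z, B z) a b :
  local_homeo (@sproj G A) -> local_homeo (@sproj G B) ->
  csec x s -> csec x t -> s x = a -> t x = b ->
  cts (fun z => f (fpoint (s z) (t z))) x -> cts f (fpoint a b).
Proof.
move=> hA hB cs ct sa tb cf.
apply: (@cts_local_section (fibprod A B) (gobj G) T (fun u => tag u) (fun z => fpoint (s z) (t z)) f
  (fpoint a b)) => //.
  exact: (cts_fib_tag (u := fpoint a b) hA).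
by apply: filterS (near_fib hA hB cs ct sa tb) => -[z [a' b']] /= [-> ->].
Qed.

Definition apoint A (g : garr G) (a : A (gsrc g)) : actdom A := existT _ g a.

Lemma cts_actdom A (T : topologicalType) (f : actdom A -> T) g a
    (s : forall z, A z) :
  (forall g : garr G, cts (@gsrc G) g) ->
  local_homeo (@sproj G A) -> csec (gsrc g) s -> s (gsrc g) = a ->
  cts (fun h => f (apoint (s (gsrc h)))) g -> cts f (apoint (g := g) a).
Proof.
move=> csrc h cs sa cf.
have c0 : @cts (actdom A) _ (@actdom_incl G A) (apoint a) by exact: cts_initial.
apply: (@cts_local_section (actdom A) (garr G) T (fun u => tag u) (fun h => apoint (s (gsrc h))) f
  (apoint a)) => //.
  exact: (cts_comp (g := fst) c0 (@cts_fst _ _ _)).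
have := cts_comp (g := snd) c0 (@cts_snd _ _ _) (near_section h cs sa).
by apply: filterS => -[z b] /= <-.
Qed.

(** The graph of [s] over [U] is the neighbourhood wanted: the projection is inverted there by [s],
    whose continuity makes images of open sets open. *)
Lemma local_homeo_of_sections A :
  (forall e, cts (@sproj G A) e) ->
  (forall x (a : A x), exists U (s : forall z, A z),
    [/\ open U, U x, s x = a, forall z, U z -> csec z s &
        open ([set point (s z) | z in U] : set (total A))]) ->
  local_homeo (@sproj G A).
Proof.
move=> cp h [x a]; have [U [s [oU Ux sa cs oS]]] := h x a.
exists [set point (s z) | z in U]; split=> //.
- by exists x => //; rewrite sa.
- by move=> e e' /set_mem[z _ <-] /set_mem[z' _ <-] /= ->.
- by rewrite continuous_open_subspace // => e _; exact: cp.
move=> V oV sV; rewrite openE => z [e Ve /= <-].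
have [z' Uz' e'] := sV _ Ve; rewrite -e' /=.
have cV := cs _ Uz' V; rewrite e' in cV.
by apply: filterS (cV (open_nbhs_nbhs (conj oV Ve))) => z'' Vz''; exists (point (s z'')).
Qed.

Section Basis.
(** [bs U s] stands for: the graph of [s] over [U] is one of the generators of the topology. The
    constant sheaf, the bar sheaves and the sheaves of modules are all treated through this
    pattern. *)
Variables (A : sheaf_data G) (bs : set (gobj G) -> (forall z, A z) -> Prop).
Hypothesis bs_gen : forall S, sgen S ->
  exists U (s : forall z, A z), bs U s /\ S = [set existT _ z (s z) | z in U].
Hypothesis gen_bs : forall U (s : forall z, A z), bs U s ->
  @sgen G A [set existT _ z (s z) | z in U].
Hypothesis bs_open : forall U s, bs U s -> open U.
Hypothesis bs_uniq : forall U s V t x, bs U s -> bs V t -> U x -> V x ->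
  s x = t x -> \forall z \near x, s z = t z.
Hypothesis bs_ex : forall x (a : A x) W, nbhs x W ->
  exists U (s : forall z, A z), [/\ bs U s, U x, s x = a & U `<=` W].

(* The topology is only generated by the graphs of the [bs]-sections as a subbase:
   [bs_uniq] makes each section continuous for it. *)
Lemma bs_csec U s x : bs U s -> U x -> csec x s.
Proof.
move=> bU Ux; apply: cts_gentop => S /bs_gen[V [t [bV ->]]] [y Vy e].
have e0 : y = x := f_equal tag e.
subst y; move: (existT_inj2 e) => {}e.
have e' := bs_uniq bU bV Ux Vy (esym e).
apply: filterS (filterI e' (open_nbhs_nbhs (conj (bs_open bV) Vy))).
by move=> z [ez Vz]; exists z => //; rewrite ez.
Qed.

Lemma local_homeo_bs : local_homeo (@sproj G A).
Proof.
apply: local_homeo_of_sections.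
  move=> [x a] W hW; have [U [s [bU Ux sa UW]]] := bs_ex a hW.
  have oU : open ([set point (s z) | z in U] : set (total A)).
    by apply: gentop_open; exact: gen_bs.
  have xU : [set point (s z) | z in U] (point a) by exists x => //; rewrite sa.
  by apply: filterS (open_nbhs_nbhs (conj oU xU)) => _ [z Uz <-]; exact: UW.
move=> x a; have [U [s [bU Ux sa _]]] := bs_ex a (filterT : nbhs x setT).
exists U, s; split=> //; first exact: bs_open bU.
- by move=> z Uz; exact: bs_csec bU Uz.
- by apply: gentop_open; exact: gen_bs.
Qed.
End Basis.

Lemma is_gsheaf_of_sections A :
  (forall g : garr G, cts (@gsrc G) g) ->
  local_homeo (@sproj G A) ->
  (forall x (a b : A x), exists s t : forall z, A z,
    [/\ s x = a, t x = b, csec x s, csec x t & csec x (fun z => s z + t z)]) ->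
  (forall x (a : A x), exists s : forall z, A z,
    [/\ s x = a, csec x s & csec x (fun z => - s z)]) ->
  (forall g x y (hr : grng g = x) (hs : gsrc g = y),
    zmod_morphism (gact (s := A) hr hs)) ->
  (forall x (hr : grng (gunit x) = x) (hs : gsrc (gunit x) = x)
    (a : A x), gact hr hs a = a) ->
  (forall g h x y z
    (gr : grng g = x) (gs : gsrc g = y) (hr : grng h = y) (hs : gsrc h = z)
    (ghr : grng (gmul g h) = x) (ghs : gsrc (gmul g h) = z) (a : A z),
    gact ghr ghs a = gact gr gs (gact hr hs a)) ->
  (forall (g : garr G) (a : A (gsrc g)), exists s : forall z, A z,
    [/\ s (gsrc g) = a, csec (gsrc g) s &
      @cts (garr G) (total A)
        (fun h => point (gact (erefl (grng h)) erefl (s (gsrc h)))) g]) ->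
  is_gsheaf A.
Proof.
move=> csrc lh hadd hopp act_add act1 actM hact; split=> //.
- move=> [x [a b]]; have [s [t [sa tb cs ct cst]]] := hadd x a b.
  exact: (cts_fibprod
    (f := fun u : fibprod A A => point ((tagged u).1 + (tagged u).2)) lh lh cs ct sa tb).
- move=> [x a]; have [s [sa cs cs']] := hopp x a.
  exact: (cts_total (f := fun u : total A => point (- tagged u)) lh cs sa).
- move=> [g a]; have [s [sa cs cact]] := hact g a.
  exact: (cts_actdom
    (f := fun u : actdom A => point (gact (erefl (grng (tag u))) erefl (tagged u)))
    csrc lh cs sa).
Qed.

Section GSheaf.
Variable A : sheaf_data G.
Hypothesis hA : is_gsheaf A.
Let lh := sheaf_local_homeo hA.

Lemma csecD x (s t : forall z, A z) : csec x s -> csec x t -> csec x (fun z => s z + t z).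
Proof.
move=> cs ct.
apply: (cts_comp (g := fun u : fibprod A A => point ((tagged u).1 + (tagged u).2))
  (cts_fpoint cs ct)).
exact: sheaf_add_continuous hA (fpoint (s x) (t x)).
Qed.

Lemma csecN x (s : forall z, A z) : csec x s -> csec x (fun z => - s z).
Proof.
move=> cs; apply: (cts_comp (g := fun u : total A => point (- tagged u)) cs).
exact: sheaf_opp_continuous hA (point (s x)).
Qed.

Lemma csec0 x : csec x (fun z => 0 : A z).
Proof.
have [s [_ /nbhs_singleton cs]] := csec_ex (0 : A x) lh.
by apply: near_csec (csecD cs (csecN cs)) _; apply: filterE => z; rewrite subrr.
Qed.

Lemma csec_act (g : garr G) (s : forall z, A z) : csec (gsrc g) s ->
  (forall g : garr G, cts (@gsrc G) g) ->
  @cts (garr G) (total A)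
    (fun h => point (gact (erefl (grng h)) erefl (s (gsrc h)))) g.
Proof.
move=> cs csrc.
have c : cts (fun h => apoint (s (gsrc h))) g.
  apply: cts_into_initial; apply: cts_pair; first exact: cts_id.
  exact: (cts_comp (g := fun z => point (s z)) (csrc g) cs).
apply: (cts_comp (g := fun u : actdom A =>
  point (gact (erefl (grng (tag u))) erefl (tagged u))) c).
exact: (sheaf_act_continuous hA (x := apoint (s (gsrc g)))).
Qed.
End GSheaf.

Lemma csec_hom A B (f : fmap A B) x (s : forall z, A z) :
  is_hom f -> csec x s -> csec x (fun z => f z (s z)).
Proof.
move=> [_ _ cf] cs.
apply: (cts_comp (g := fun a : total A => point (f (tag a) (tagged a))) cs).
exact: cf (point (s x)).
Qed.

Lemma hom_of_sections A B (f : fmap A B) :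
  local_homeo (@sproj G A) ->
  (forall x, zmod_morphism (f x)) ->
  (forall g x y (hr : grng g = x) (hs : gsrc g = y) (a : A y),
     f x (gact hr hs a) = gact hr hs (f y a)) ->
  (forall x (a : A x), exists s : forall z, A z,
    [/\ s x = a, csec x s & csec x (fun z => f z (s z))]) ->
  is_hom f.
Proof.
move=> lh fD fact h; split=> // -[x a]; have [s [sa cs cfs]] := h x a.
exact: (cts_total (f := fun a : total A => point (f (tag a) (tagged a))) lh cs sa cfs).
Qed.
End Sections.

(** * Pushouts, extensions and comparison of resolutions *)

Section PushoutGroupTheory.
Variables (U V W : zmodType) (f : {additive U -> V}) (g : {additive U -> W}).
Let p := pushout_pi f g.

Lemma pushout_pi_is_zmod_morphism : zmod_morphism p.
Proof. move=> v w; exact: (pi_is_zmod_morphism (Quotient.quot (pushout_rel f g))). Qed.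

Lemma pushout_piB v w : p (v - w) = p v - p w.
Proof. exact: pushout_pi_is_zmod_morphism. Qed.

Lemma pushout_piN v : p (- v) = - p v.
Proof. by rewrite -[- v]sub0r pushout_piB -(subrr v) pushout_piB subrr sub0r. Qed.

Lemma pushout_piD v w : p (v + w) = p v + p w.
Proof. by rewrite -[w in LHS]opprK pushout_piB pushout_piN opprK. Qed.

Lemma pushout_reprK u : p (pushout_repr u) = u.
Proof. exact: reprK. Qed.

Lemma pushout_eq v w : p v = p w <-> exists u, v = (w.1 + f u, w.2 - g u).
Proof.
have e : (v - w \in pushout_rel f g) = (p v == p w).
  by rewrite Quotient.idealrBE.
have e' u : v = (w.1 + f u, w.2 - g u) <-> v - w = (f u, - g u).
  case: w {e} => a b; split=> [->|/eqP] /=.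
    by congr pair; rewrite addrC addKr.
  by rewrite subr_eq => /eqP ->; congr pair; rewrite addrC.
split=> [/eqP|[u /e' h]]; last by apply/eqP; rewrite -e; apply/asboolP; exists u.
by rewrite -e => /asboolP[u /e' h]; exists u.
Qed.

(** Maps out of the pushout are defined on a chosen representative; this measures how far that
    choice can be from a given pair. *)
Lemma pushout_reprE v : exists u, pushout_repr (p v) = (v.1 + f u, v.2 - g u).
Proof. by apply/pushout_eq; rewrite pushout_reprK. Qed.
End PushoutGroupTheory.

(** * Pushouts of sheaves *)

Section PushoutSheafTheory.
Variables (G : groupoid) (Q R A : sheaf_data G) (c : amap Q A) (th : amap Q R).
Hypothesis csrc : forall g : garr G, cts (@gsrc G) g.
Hypotheses (hA : is_gsheaf A) (hR : is_gsheaf R) (hQ : is_gsheaf Q).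
Hypotheses (hc : is_hom c) (hth : is_hom th).
Let lA := sheaf_local_homeo hA.
Let lR := sheaf_local_homeo hR.
Let lQ := sheaf_local_homeo hQ.
Let P := pushout_sheaf c th.

Definition pp x (a : A x) (b : R x) : P x := pushout_pi (c x) (th x) (a, b).

Lemma pp_surj x (u : P x) : exists a b, u = pp a b.
Proof.
exists (pushout_repr u).1, (pushout_repr u).2.
by rewrite /pp -surjective_pairing pushout_reprK.
Qed.

Lemma pp_eq x (a a' : A x) (b b' : R x) :
  pp a b = pp a' b' <-> exists q, a = a' + c x q /\ b = b' - th x q.
Proof.
split=> [/pushout_eq[q [-> ->]]|[q [-> ->]]]; first by exists q.
by apply/pushout_eq; exists q.
Qed.

Lemma ppD x (a a' : A x) (b b' : R x) : pp (a + a') (b + b') = pp a b + pp a' b'.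
Proof. by rewrite /pp -pushout_piD. Qed.

Lemma ppN x (a : A x) (b : R x) : pp (- a) (- b) = - pp a b.
Proof. by rewrite /pp -pushout_piN. Qed.

Lemma pp_repr x (a : A x) (b : R x) :
  exists q, pushout_repr (pp a b) = (a + c x q, b - th x q).
Proof. exact: pushout_reprE. Qed.

(** The action is computed on a representative; another one differs by (c q, - th q), and
    equivariance of [c] and [th] sends this to the relation of g q. *)
Lemma pp_act g x y (hr : grng g = x) (hs : gsrc g = y) (a : A y) (b : R y) :
  gact hr hs (pp a b) = pp (gact hr hs a) (gact hr hs b).
Proof.
have [q e] := pp_repr a b; rewrite /gact /= /gact e /=; apply/pp_eq.
have ec : c x (gact hr hs q) = gact hr hs (c y q) by have [_ + _] := hc; apply.
have et : th x (gact hr hs q) = gact hr hs (th y q) by have [_ + _] := hth; apply.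
exists (gact hr hs q); rewrite ec et.
have eA := sheaf_act_additive hA hr hs; have eR := sheaf_act_additive hR hr hs.
(* The action is additive only by hypothesis; packing it as an additive map gives access to the
   general lemmas on such maps. The same device recurs below. *)
pose fA := GRing.isZmodMorphism.Build _ _ _ eA.
pose aA : {additive A y -> A x} := HB.pack (gact (s := A) hr hs) fA.
pose fR := GRing.isZmodMorphism.Build _ _ _ eR.
pose aR : {additive R y -> R x} := HB.pack (gact (s := R) hr hs) fR.
by split; [exact: (raddfD aA) | exact: (raddfB aR)].
Qed.

Lemma csec_pp x (s : forall z, A z) (t : forall z, R z) :
  csec x s -> csec x t -> @csec G P x (fun z => pp (s z) (t z)).
Proof.
move=> cs ct.
apply: (cts_comp (g := @pushout_proj _ Q R A c th : fibprod A R -> total P) (cts_fpoint cs ct)).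
apply: cts_gentop => W oW Wx.
by apply: open_nbhs_nbhs.
Qed.

(** The graph of [s, t] is open: a pair (a', b') over it differs from (s, t) by (c q, - th q). If w
    is a local section through q, then (s + c w, t - th w) passes through (a', b') and has the same
    image as (s, t). *)
Lemma pushout_local_homeo : local_homeo (@sproj G P).
Proof.
apply: local_homeo_of_sections.
  move=> [x u]; apply: cts_open => W oW Wx.
  apply: open_nbhs_nbhs; split=> //; apply: gentop_open.
  rewrite /= openE => v Wv.
  exact: (cts_fib_tag lA (open_nbhs_nbhs (conj oW Wv))).
move=> x u; have [a [b ->]] := pp_surj u.
have [s [sa cs]] := csec_ex a lA; have [t [tb ct]] := csec_ex b lR.
have [U [oU Ux hU]] := near_open (filterI cs ct).
exists U, (fun z => pp (s z) (t z)); split=> //; first by rewrite sa tb.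
  by move=> z /hU[? ?]; exact: csec_pp.
apply: gentop_open; rewrite /= openE => -[z0 [a' b']] /= [z Uz e].
have ez : z = z0 := f_equal tag e.
subst z0; move: (existT_inj2 e) => {}e.
have /pp_eq[q [ea eb]] : pp a' b' = pp (s z) (t z) by [].
have [w [wq cw]] := csec_ex q lQ; have [csz ctz] := hU _ Uz.
have c1 := csecD hA csz (csec_hom hc (nbhs_singleton cw)).
have c2 := csecD hR ctz (csecN hR (csec_hom hth (nbhs_singleton cw))).
have e1 : s z + c z (w z) = a' by rewrite wq.
have e2 : t z - th z (w z) = b' by rewrite wq.
have hn := near_fib lA lR c1 c2 e1 e2.
have hz := cts_fib_tag (u := fpoint a' b') lA (open_nbhs_nbhs (conj oU Uz)).
apply: filterS (filterI hn hz) => -[z' [a'' b'']] /= [[-> ->] Uz'].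
exists z' => //; rewrite /pushout_proj /=; congr existT.
by apply/esym/pp_eq; exists (w z').
Qed.

Lemma pushout_is_gsheaf : is_gsheaf P.
Proof.
apply: is_gsheaf_of_sections => //; first exact: pushout_local_homeo.
- move=> x u v; have [a [b ->]] := pp_surj u; have [a' [b' ->]] := pp_surj v.
  have [s [sa /nbhs_singleton cs]] := csec_ex a lA.
  have [t [tb /nbhs_singleton ct]] := csec_ex b lR.
  have [s' [sa' /nbhs_singleton cs']] := csec_ex a' lA.
  have [t' [tb' /nbhs_singleton ct']] := csec_ex b' lR.
  exists (fun z => pp (s z) (t z)), (fun z => pp (s' z) (t' z)); split.
  + by rewrite sa tb.
  + by rewrite sa' tb'.
  + exact: csec_pp.
  + exact: csec_pp.
  apply: near_csec (csec_pp (csecD hA cs cs') (csecD hR ct ct')) _.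
  by apply: filterE => z; rewrite ppD.
- move=> x u; have [a [b ->]] := pp_surj u.
  have [s [sa /nbhs_singleton cs]] := csec_ex a lA.
  have [t [tb /nbhs_singleton ct]] := csec_ex b lR.
  exists (fun z => pp (s z) (t z)); split; first by rewrite sa tb.
    exact: csec_pp.
  apply: near_csec (csec_pp (csecN hA cs) (csecN hR ct)) _.
  by apply: filterE => z; rewrite ppN.
- move=> g x y hr hs u v; have [a [b ->]] := pp_surj u.
  have [a' [b' ->]] := pp_surj v.
  rewrite -ppN -ppD !pp_act (sheaf_act_additive hA) (sheaf_act_additive hR).
  by rewrite ppD ppN.
- move=> x hr hs u; have [a [b ->]] := pp_surj u.
  by rewrite pp_act (sheaf_act_unit hA) (sheaf_act_unit hR).
- move=> g h x y z gr gs hr hs ghr ghs u; have [a [b ->]] := pp_surj u.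
  rewrite !pp_act (sheaf_act_mul hA gr gs hr hs ghr ghs).
  by rewrite (sheaf_act_mul hR gr gs hr hs ghr ghs).
move=> g u; have [a [b ->]] := pp_surj u.
have [s [sa /nbhs_singleton cs]] := csec_ex a lA.
have [t [tb /nbhs_singleton ct]] := csec_ex b lR.
exists (fun z => pp (s z) (t z)); split; [by rewrite sa tb | exact: csec_pp |].
pose fs h := gact (erefl (grng h)) erefl (s (gsrc h)).
pose ft h := gact (erefl (grng h)) erefl (t (gsrc h)).
have c1 := csec_act hA cs csrc.
have c2 := csec_act hR ct csrc.
have c3 := cts_fpoint (r := @grng G) (f := fs) (g := ft) c1 c2.
have c4 : @cts (garr G) (total P) (fun h => pushout_proj c th (fpoint (fs h) (ft h))) g.
  apply: (cts_comp (g := @pushout_proj _ Q R A c th : fibprod A R -> total P) c3).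
  by apply: cts_gentop => W oW Wx; apply: open_nbhs_nbhs.
apply: near_cts c4 _; apply: filterE => h.
by rewrite pp_act.
Qed.
End PushoutSheafTheory.

Section ZeroMap.
Variables (U V : zmodType).
Definition zero_map (_ : U) : V := 0.
Lemma zero_map_is_zmod_morphism : zmod_morphism zero_map.
Proof. by move=> x y; rewrite /zero_map subr0. Qed.
HB.instance Definition _ := GRing.isZmodMorphism.Build U V zero_map zero_map_is_zmod_morphism.
End ZeroMap.

(** * Exact resolutions and the extension attached to a cocycle *)

Section Resolutions.
Variable G : groupoid.
Hypothesis csrc : forall g : garr G, cts (@gsrc G) g.
Implicit Types (A : sheaf_data G) (Q R : resolution G) (x z : gobj G).

Record exact_resolution Q : Prop := ExactResolution {
  res_sheaf : forall n, is_gsheaf (Q n);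
  res_hom : forall n, is_hom (res_map Q n);
  res_surj : forall x (m : int), exists q, res_map Q 0 x q = m;
  res_dd : forall n x q, res_map Q n x (res_map Q n.+1 x q) = 0;
  res_exact : forall n x q, res_map Q n x q = 0 -> exists q', res_map Q n.+1 x q' = q
}.

Lemma csec_Zcst x (m : int) : @csec G (Zsheaf G) x (fun=> m).
Proof.
apply: cts_gentop => _ [U [m' [oU ->]]] [y Uy e].
have e0 : y = x := f_equal tag e.
subst y; move: (existT_inj2 e) => <-.
by apply: filterS (open_nbhs_nbhs (conj oU Uy)) => z Uz; exists z.
Qed.

Lemma Zsheaf_local_homeo : local_homeo (@sproj G (Zsheaf G)).
Proof.
apply: (@local_homeo_bs G (Zsheaf G)
  (fun U s => open U /\ exists m : int, s = fun=> m)).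
- by move=> _ [U [m [oU ->]]]; exists U, (fun=> m); split=> //; split=> //; exists m.
- by move=> U _ [oU [m ->]]; exists U, m.
- by move=> U s [].
- by move=> U _ V _ x [_ [m ->]] [_ [m' ->]] _ _ ->; apply: filterE.
move=> x m W; rewrite nbhsE => -[U [oU Ux] UW].
by exists U, (fun=> m); split=> //; split=> //; exists m.
Qed.

Lemma is_homD A B (b b' : amap A B) : is_gsheaf A -> is_gsheaf B -> is_hom b ->
  is_hom b' -> is_hom (fun x a => b x a + b' x a).
Proof.
move=> hA hB hb hb'; have lA := sheaf_local_homeo hA; apply: hom_of_sections => //.
- by move=> x a a'; rewrite !raddfB opprD addrACA.
- move=> g x y hr hs a; have [_ + _] := hb; have [_ + _] := hb'.
  rewrite /fmap_of_amap => -> ->.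
  pose fB := GRing.isZmodMorphism.Build _ _ _ (sheaf_act_additive hB hr hs).
  pose aB : {additive B y -> B x} := HB.pack (gact (s := B) hr hs) fB.
  by rewrite -[RHS]/(aB _) raddfD.
move=> x a; have [s [sa /nbhs_singleton cs]] := csec_ex a lA.
by exists s; split=> //; exact: (csecD hB (s := fun z => b z (s z))
  (t := fun z => b' z (s z)) (csec_hom hb cs) (csec_hom hb' cs)).
Qed.

Lemma is_hom0 A B : is_gsheaf A -> is_gsheaf B ->
  is_hom (fun x => @zero_map (A x) (B x) : {additive A x -> B x}).
Proof.
move=> hA hB; have lA := sheaf_local_homeo hA; apply: hom_of_sections => //.
- by move=> x; exact: zero_map_is_zmod_morphism.
- move=> g x y hr hs a; rewrite /zero_map.
  pose fB := GRing.isZmodMorphism.Build _ _ _ (sheaf_act_additive hB hr hs).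
  pose aB : {additive B y -> B x} := HB.pack (gact (s := B) hr hs) fB.
  by rewrite -[RHS]/(aB _) raddf0.
move=> x a; have [s [sa /nbhs_singleton cs]] := csec_ex a lA.
by exists s; split=> //; exact: (csec0 hB (x := x)).
Qed.

Lemma is_hom_comp A B C (f : fmap B C) (g : fmap A B) :
  is_hom f -> is_hom g -> is_hom (fun x a => f x (g x a)).
Proof.
move=> [fD fact fc] [gD gact' gc]; split.
- by move=> x a b; rewrite gD fD.
- by move=> *; rewrite gact' fact.
by move=> a; exact: (cts_comp (gc a) (fc _)).
Qed.

Section Extension.
Variables (Q : resolution G) (A : sheaf_data G).
Hypotheses (hQ : exact_resolution Q) (hA : is_gsheaf A).

(** Independence of the representative is d d = 0. *)
Lemma rho_ext_projE m (c : amap (Q m.+1) A) x (a : A x) (q : Q m x) :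
  @ext_proj _ _ _ (rho_ext c) x (pp c (res_map Q m.+1) a q) = res_map Q m x q.
Proof.
have [q' e] := pp_repr c (res_map Q m.+1) a q.
by rewrite /= e /= raddfB [X in _ - X](res_dd hQ) subr0.
Qed.

Lemma res_range m (c : amap (Q m.+1) A) i x :
  range (res_map Q i x) = @ext_ker _ _ _ (rho_ext c) i x.
Proof.
apply/seteqP; split=> [_ [q _ <-]|v hv].
  by case: i q => [|j] q //=; exact: res_dd.
suff [q e] : exists q, res_map Q i x q = v by exists q.
by case: i v hv => [|j] v hv; [exact: res_surj | exact: res_exact].
Qed.

Lemma rho_ext_exact m (c : amap (Q m.+1) A) : is_cocycle c -> is_exact_ext (rho_ext c).
Proof.
move=> [hc c0]; have lA := sheaf_local_homeo hA.
have hth := res_hom hQ m.+1; have hQm := res_sheaf hQ m.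
have lQ := sheaf_local_homeo hQm.
have hP : is_gsheaf (pushout_sheaf c (res_map Q m.+1)).
  by apply: pushout_is_gsheaf => //; exact: res_sheaf.
pose P x a b := @pp _ _ _ _ c (res_map Q m.+1) x a b.
split=> //.
- by move=> i _; exact: res_sheaf.
- apply: hom_of_sections => //.
  + by move=> x a b; rewrite -[LHS]/(P x (a - b) 0) /P -[X in pp _ _ _ X](subrr 0) ppD ppN.
  + move=> g x y hr hs a; rewrite -[RHS]/(gact hr hs (P y a 0)) pp_act //.
    rewrite -[LHS]/(P x _ _) /P; congr pp.
    pose fB := GRing.isZmodMorphism.Build _ _ _ (sheaf_act_additive hQm hr hs).
    pose aB : {additive Q m y -> Q m x} := HB.pack (gact (s := Q m) hr hs) fB.
    by rewrite -[RHS]/(aB _) raddf0.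
  move=> x a; have [s [sa /nbhs_singleton cs]] := csec_ex a lA.
  by exists s; split=> //; exact: (csec_pp (c := c) (th := res_map Q m.+1) cs (csec0 hQm (x := x))).
- apply: hom_of_sections; first exact: sheaf_local_homeo hP.
  + move=> x u v; have [a [b ->]] := pp_surj u; have [a' [b' ->]] := pp_surj v.
    by rewrite -ppN -ppD !rho_ext_projE raddfB.
  + move=> g x y hr hs u; have [a [b ->]] := pp_surj u.
    rewrite pp_act // !rho_ext_projE.
    by have [_ + _] := res_hom hQ m; apply.
  move=> x u; have [a [b ->]] := pp_surj u.
  have [s [sa /nbhs_singleton cs]] := csec_ex a lA.
  have [t [tb /nbhs_singleton ct]] := csec_ex b lQ.
  exists (fun z => pp c (res_map Q m.+1) (s z) (t z)).
  split; [by rewrite sa tb | exact: csec_pp |].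
  apply: near_csec (csec_hom (res_hom hQ m) ct) _.
  by apply: filterE => z; rewrite rho_ext_projE.
- by move=> i _; exact: res_hom.
(* Injectivity on A is where the cocycle condition enters: [a, 0] = [a', 0] gives q with a = a' + c
   q and d q = 0, so q is a boundary and c q = 0. *)
- move=> x a a' /pp_eq[q [-> /esym/eqP]].
  rewrite sub0r oppr_eq0 => /eqP/(res_exact hQ)[q' <-].
  by rewrite [c x _]c0 addr0.
- move=> x; apply/seteqP; split=> [_ [a _ <-]|u /=].
    by rewrite /= -[pushout_pi _ _ (a, _)]/(P x a 0) [LHS]rho_ext_projE raddf0.
  have [a [b ->]] := pp_surj u; rewrite -[LHS]/(@ext_proj _ _ _ (rho_ext c) x _) rho_ext_projE.
  (* If b = d q, then [a, b] = [a + c q, 0]. *)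
  move=> /(res_exact hQ)[q <-]; exists (a + c x q) => //.
  by apply/pp_eq; exists q; rewrite subrr.
- move=> x; rewrite -res_range; apply/seteqP; split=> [_ [u _ <-]|_ [q _ <-]].
    by have [a [b ->]] := pp_surj u; exists b => //; rewrite rho_ext_projE.
  by exists (P x 0 q) => //; rewrite rho_ext_projE.
by move=> i _ x; rewrite -res_range.
Qed.
End Extension.
End Resolutions.

(** * The morphism of extensions induced by a chain map *)

Section Comparison.
Variables (G : groupoid) (Q R : resolution G).
Hypothesis csrc : forall g : garr G, cts (@gsrc G) g.
Hypotheses (hQ : exact_resolution Q) (hR : exact_resolution R).
Variable f : forall n, amap (Q n) (R n).
Hypothesis hf : forall n, is_hom (f n).
Hypothesis f_chain : forall n x (q : Q n x),
  lowmap (fun m => f m) n x (res_map Q n x q) = res_map R n x (f n x q).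
Variable A : sheaf_data G.
Hypothesis hA : is_gsheaf A.

(* The morphism is [a, p] |-> [a - b p, f p]. *)
Lemma rho_ext_morph m (c : amap (Q m.+1) A) (c' : amap (R m.+1) A)
    (b : amap (Q m) A) : is_cocycle c -> is_cocycle c' -> is_hom b ->
  (forall x q, c' x (f m.+1 x q) = c x q + b x (res_map Q m.+1 x q)) ->
  ext_morph (rho_ext c) (rho_ext c').
Proof.
move=> hc hc' hb e; split; [exact: rho_ext_exact | exact: rho_ext_exact |].
have lA := sheaf_local_homeo hA; have lQ := sheaf_local_homeo (res_sheaf hQ m).
pose th := res_map Q m.+1; pose th' := res_map R m.+1.
pose ft x (u : pushout_sheaf c th x) : pushout_sheaf c' th' x :=
  pp c' th' ((pushout_repr u).1 - b x (pushout_repr u).2) (f m x (pushout_repr u).2).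
(* Well defined: the relation of q' goes to the relation of f q', the term b (d q') being absorbed
   by c' f = c + b d. *)
have ftE x a q : ft x (pp c th a q) = pp c' th' (a - b x q) (f m x q).
  have [q' eq'] := pp_repr c th a q.
  rewrite /ft eq' /=; apply/pp_eq; exists (f m.+1 x q'); split.
    by rewrite (e x q') raddfB opprB [RHS]addrACA; congr (_ + _); exact: addrC.
  by rewrite raddfB; congr (_ - _); exact: (f_chain (n := m.+1)).
have hP : is_gsheaf (pushout_sheaf c th).
  by case: hc => ? _; apply: pushout_is_gsheaf => //;
    [exact: res_sheaf | exact: res_sheaf | exact: res_hom].
have hbact g x y (hr : grng g = x) (hs : gsrc g = y) (a : Q m y) :
  b x (gact hr hs a) = gact hr hs (b y a) by have [_ + _] := hb; apply.
have hfact g x y (hr : grng g = x) (hs : gsrc g = y) (a : Q m y) :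
  f m x (gact hr hs a) = gact hr hs (f m y a) by have [_ + _] := hf m; apply.
exists ft, (fun n => f n); split=> //.
- apply: hom_of_sections; first exact: sheaf_local_homeo hP.
  + move=> x u v; have [a [q ->]] := pp_surj u; have [a' [q' ->]] := pp_surj v.
    rewrite -ppN -ppD !ftE -ppN -ppD !raddfB; congr pp.
    exact: addrACA.
  + move=> g x y hr hs u; have [a [q ->]] := pp_surj u.
    rewrite (pp_act hA (res_sheaf hQ m)) ?ftE; [| by case: hc | exact: res_hom].
    rewrite (pp_act hA (res_sheaf hR m)) ?ftE; [| by case: hc' | exact: res_hom].
    by rewrite (sheaf_act_additive hA) hbact hfact.
  move=> x u; have [a [q ->]] := pp_surj u.
  have [s [sa /nbhs_singleton cs]] := csec_ex a lA.
  have [t [tb /nbhs_singleton ct]] := csec_ex q lQ.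
  exists (fun z => pp c th (s z) (t z)).
  split; [by rewrite sa tb | exact: csec_pp |].
  have c1 := csecD hA cs (csecN hA (s := fun z => b z (t z)) (csec_hom hb ct)).
  have c2 := csec_hom (hf m) ct.
  apply: near_csec (csec_pp (c := c') (th := th') c1 c2) _.
  by apply: filterE => z; rewrite ftE.
- by move=> i _; exact: hf.
- move=> x a; have e0 := ftE x a (0 : Q m x); rewrite [b x _]raddf0 subr0 in e0.
  by apply: etrans e0 _; rewrite [f m x _]raddf0.
- move=> x u; have [a [q ->]] := pp_surj u.
  have e1 := rho_ext_projE hQ c a q.
  have e2 := rho_ext_projE hR c' (a - b x q) (f m x q).
  by rewrite [ext_proj (e := rho_ext c) _]e1 [ft x _]ftE [LHS]e2; exact/esym/f_chain.
by move=> i _ x u; exact/esym/f_chain.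
Qed.
End Comparison.

Lemma is_hom_id (G : groupoid) (A : sheaf_data G) : is_hom (fun x (a : A x) => a).
Proof. by split=> // -[x a] W h; apply: filterS h => -[z b]. Qed.

(** * Cohomology classes and the triangle *)

Section Equivalence.
Variables (G : groupoid) (A : sheaf_data G).

Lemma Hrep_equiv_sym n (E E' : Hrep A n) : Hrep_equiv E E' -> Hrep_equiv E' E.
Proof. by case: n E E' => [|n] E E' h; [move=> x c; rewrite h | exact: rst_sym]. Qed.

Lemma Hrep_equiv_trans n (E E' E'' : Hrep A n) :
  Hrep_equiv E E' -> Hrep_equiv E' E'' -> Hrep_equiv E E''.
Proof.
case: n E E' E'' => [|n] E E' E'' h h'; first by move=> x c; rewrite h h'.
exact: rst_trans h h'.
Qed.

Lemma Hclass_eq n (E E' : Hrep A n) : Hrep_equiv E E' -> eq_class (Hclass E) (Hclass E').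
Proof.
move=> h D; split=> -[vD eD]; split=> //; apply: Hrep_equiv_trans eD => //.
exact: Hrep_equiv_sym.
Qed.

Variable Q : resolution G.
Hypotheses (hQ : exact_resolution Q) (hA : is_gsheaf A).

Lemma cohomologous_refl n (c : amap (Q n) A) : cohomologous c c.
Proof.
case: n c => [|n] c //=; exists (fun x => @zero_map (Q n x) (A x)).
  by apply: is_hom0 => //; exact: res_sheaf.
by move=> x q; rewrite /zero_map addr0.
Qed.

Lemma cohomologous_trans n (c c' c'' : amap (Q n) A) :
  cohomologous c c' -> cohomologous c' c'' -> cohomologous c c''.
Proof.
case: n c c' c'' => [|n] c c' c'' /=; first by move=> h h' x q; rewrite h' h.
move=> [b hb h] [b' hb' h']; exists (fun x => b x \+ b' x : {additive _ -> _}).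
  exact: (is_homD (res_sheaf hQ n) hA hb hb').
by move=> x q; rewrite h' h addrA.
Qed.
End Equivalence.

Section Representatives.
Variables (G : groupoid) (A : sheaf_data G).
Hypothesis csrc : forall g : garr G, cts (@gsrc G) g.
Hypothesis hA : is_gsheaf A.

(* In degree 0 a cocycle kills the image of [res_map Q 1], that is, the kernel of the
   augmentation, and so descends to Z. *)
Lemma rho_rep_ex (Q : resolution G) n (c : amap (Q n) A) :
  exact_resolution Q -> is_cocycle c -> exists E, rho_rep c E /\ Hrep_valid E.
Proof.
move=> hQ; case: n c => [|n] c hc; last first.
  by exists (rho_ext c); split=> //; exact: rho_ext_exact.
have [homc c0] := hc; have homt := res_hom hQ 0.
pose ct : fmap (Zsheaf G) A := fun x m => c x (xget 0 [set q | res_map Q 0 x q = m]).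
have ctE x q : ct x (res_map Q 0 x q) = c x q.
  rewrite /ct; case: xgetP => [q' _ /= e|/(_ q) /(_ erefl) []].
  have /(res_exact hQ)[r er] : res_map Q 0 x (q' - q) = 0.
    by rewrite raddfB /= e subrr.
  by apply/eqP; rewrite -subr_eq0 -raddfB -er c0.
have Zsurj x (m : int) : exists q, res_map Q 0 x q = m by exact: res_surj.
exists ct; split; first by move=> x q; rewrite ctE.
apply: hom_of_sections; first exact: Zsheaf_local_homeo.
- move=> x m m'; have [q <-] := Zsurj x m; have [q' <-] := Zsurj x m'.
  by rewrite -[X in ct x X](raddfB (res_map Q 0 x)) !ctE raddfB.
- move=> g x y hr hs m; have [q <-] := Zsurj y m.
  have -> : gact hr hs (res_map Q 0 y q) = res_map Q 0 x (gact hr hs q).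
    by have [_ + _] := homt; move=> h; rewrite [RHS]h.
  by rewrite !ctE; have [_ + _] := homc; apply.
move=> x m; have [q eq] := Zsurj x m.
have [s [sq /nbhs_singleton cs]] := csec_ex q (sheaf_local_homeo (res_sheaf hQ 0)).
exists (fun=> m); split=> //; first exact: csec_Zcst.
(* The augmentation of the section [s] is a continuous section of the constant sheaf with value m at
   x, hence equal to m near x. *)
have ct1 := csec_hom homt cs; have cm := @csec_Zcst G x m.
have e1 : res_map Q 0 x (s x) = m by rewrite sq.
have hn := csec_uniq (Zsheaf_local_homeo (G := G)) ct1 cm e1.
apply: near_csec (csec_hom homc cs) _.
by apply: filterS hn => z <-; rewrite [RHS]ctE.
Qed.

Section TwoResolutions.
Variables Q R : resolution G.
Hypotheses (hQ : exact_resolution Q) (hR : exact_resolution R).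
Variable f : forall n, amap (Q n) (R n).
Hypothesis hf : forall n, is_hom (f n).
Hypothesis f_chain : forall n x (q : Q n x),
  lowmap (fun m => f m) n x (res_map Q n x q) = res_map R n x (f n x q).

(** Applied to two different resolutions for the triangle, and with Q = R and f the identity for the
    independence of [rho] from the cocycle. *)
Lemma rho_rep_equiv n (c : amap (Q n) A) (c' : amap (R n) A) E E' :
  is_cocycle c -> is_cocycle c' -> cohomologous c (acomp c' (f n)) ->
  rho_rep c E -> rho_rep c' E' -> Hrep_equiv E E'.
Proof.
case: n c c' E E' => [|n] c c' E E' hc hc' /=; last first.
  by move=> [b hb e] -> ->; apply: rst_step;
    exact: (rho_ext_morph csrc hQ hR hf f_chain hA hc hc' hb e).
move=> e h h' x m; have [q <-] := res_surj hQ x m.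
by rewrite -[LHS]h -[LHS]e [LHS]h' -(f_chain (n := 0)).
Qed.
End TwoResolutions.

Lemma rho_coclass (Q : resolution G) n (c : amap (Q n) A) E :
  exact_resolution Q -> is_cocycle c -> rho_rep c E -> Hrep_valid E ->
  eq_class (rho (coclass c)) (Hclass E).
Proof.
move=> hQ hc hE vE D; split=> [[c1 [E0 [[hc1 e1] h0 v0 [vD hD]]]]|[vD hD]].
  split=> //; apply: Hrep_equiv_trans hD.
  (* Over the identity chain map, the coboundary between [c] and [c1] provides the morphism of
     extensions. *)
  apply: (rho_rep_equiv (f := fun n x => idfun) hQ hQ _ _ hc hc1) => //.
  - by move=> m; exact: is_hom_id.
  - by move=> [|m].
  by case: (n) c c1 {hc hc1 hE h0} e1.
exists c, E; split=> //; split=> //; exact: cohomologous_refl.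
Qed.

Theorem rho_triangle_of_chain_map (Q R : resolution G)
    (f : forall n, amap (Q n) (R n)) :
  exact_resolution Q -> exact_resolution R -> (forall n, is_hom (f n)) ->
  (forall n x (q : Q n x),
     lowmap (fun m => f m) n x (res_map Q n x q) = res_map R n x (f n x q)) ->
  forall n, rho_triangle (f n) A.
Proof.
move=> hQ hR hf f_chain n.
have cocf (c : amap (R n) A) : is_cocycle c -> is_cocycle (acomp c (f n)).
  move=> [hc c0]; split; first exact: (is_hom_comp hc (hf n)).
  move=> x q; rewrite -[RHS](c0 x (f n.+1 x q)).
  by congr (c x _); exact: (f_chain n.+1).
have pbE (c : amap (R n) A) : is_cocycle c -> pullback (f n) (coclass c) = coclass (acomp c (f n)).
  move=> hc; apply/seteqP; split=> [c' [c1 [hc1 e1] [hc' e']]|c' [hc' e']].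
    split=> //; apply: (cohomologous_trans hQ hA _ e').
    case: (n) c c1 e1 f_chain {cocf e' hc' hc1 hc c'} => [|m] c c1 /=.
      by move=> e1 f_chain x q; rewrite /= e1.
    move=> [b hb e1] f_chain; exists (acomp b (f m)).
      exact: (is_hom_comp hb (hf m)).
    move=> x q; rewrite /= e1; congr (_ + b x _).
    exact/esym/(f_chain m.+1).
  by exists c; split=> //; exact: cohomologous_refl.
(* Both sides of the triangle are single classes, represented by the images of c and of c o f;
   comparing these two representatives yields the last two claims. *)
have rhoE X : HQ R A n X -> exists E E', [/\ Hrep_valid E, Hrep_equiv E' E,
    eq_class (rho X) (Hclass E) & eq_class (rho (pullback (f n) X)) (Hclass E')].
  move=> [c hc <-]; have [E [hE vE]] := rho_rep_ex hR hc.
  have [E' [hE' vE']] := rho_rep_ex hQ (cocf _ hc).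
  exists E, E'; split=> //; last by rewrite pbE //; exact: (rho_coclass hQ (cocf _ hc)).
    exact: (rho_rep_equiv hQ hR hf f_chain (cocf _ hc) hc (cohomologous_refl hQ hA _) hE' hE).
  exact: rho_coclass hR hc _ _.
split.
- by move=> c hc; split; [exact: cocf | exact: pbE].
- by move=> _ [c hc <-]; exists (acomp c (f n)); [exact: cocf | rewrite pbE].
- by move=> X /rhoE[E [E' [vE _ h _]]]; exists E.
move=> X /rhoE[E [E' [_ e h h']]] D.
by rewrite (h D) (h' D); exact: Hclass_eq.
Qed.
End Representatives.

(** * The bar resolution of an etale groupoid *)

Record etale (G : groupoid) : Prop := Etale {
  etale_rng : forall g : garr G, cts (@grng G) g;
  etale_src : forall g : garr G, cts (@gsrc G) g;
  etale_inj : loc_inj (@grng G);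
  etale_section : forall g : garr G, exists e : gobj G -> garr G,
    e (grng g) = g /\ \forall z \near grng g, cts e z /\ grng (e z) = z;
  (* continuity of the product on composable pairs, tested on pairs of maps *)
  etale_mul : forall (T : topologicalType) (e f : T -> garr G) t,
    cts e t -> cts f t -> (\forall z \near t, gsrc (e z) = grng (f z)) ->
    cts (fun z => gmul (e z) (f z)) t
}.

(* A continuous family of tuples of arrows is represented by the list of its
   coordinate functions. *)
Section Families.
Variables (T U : topologicalType).

Fixpoint ctsl (es : seq (T -> U)) (t : T) : Prop :=
  if es is e :: es' then cts e t /\ ctsl es' t else True.

Definition ev (es : seq (T -> U)) (t : T) : seq U := [seq e t | e <- es].

Lemma ctsl_nth d es t i : ctsl es t -> (i < size es)%N -> cts (nth d es i) t.
Proof. by elim: es i => [|e es IH] [|i] //= [ce ces] // h; exact: IH. Qed.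

Lemma ctsl_map (I : Type) (F : I -> T -> U) (r : seq I) t :
  (forall i, cts (F i) t) -> ctsl [seq F i | i <- r] t.
Proof. by move=> h; elim: r => //= i r ->. Qed.

Lemma nth_ev d g es t i : (i < size es)%N -> nth g (ev es t) i = nth d es i t.
Proof. by move=> h; rewrite /ev (nth_map d). Qed.
End Families.

Definition compl (T U V : Type) (es : seq (U -> V)) (p : T -> U) : seq (T -> V) :=
  [seq (fun z => e (p z)) | e <- es].

Lemma ctsl_comp (T U V : topologicalType) (es : seq (U -> V)) (p : T -> U) t :
  cts p t -> ctsl es (p t) -> ctsl (compl es p) t.
Proof.
move=> cp; elim: es => //= e es IH [ce /IH]; split=> //; exact: cts_comp cp ce.
Qed.

Lemma ev_comp (T U V : topologicalType) (es : seq (U -> V)) (p : T -> U) t :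
  ev (compl es p) t = ev es (p t).
Proof. by rewrite /ev /compl -map_comp. Qed.

(** * Continuous families of composable tuples *)

Section GroupoidPaths.
Variable G : groupoid.

Implicit Types x y : gobj G.

(** Composability in a recursive form that carries the prescribed range: the tail is again such a
    tuple, based at the source of the head. *)
Fixpoint gpath (y : gobj G) (s : seq (garr G)) : bool :=
  if s is g :: s' then (grng g == y) && gpath (gsrc g) s' else true.

Lemma gpath_path (g : garr G) s :
  path (fun g h => gsrc g == grng h) g s = gpath (gsrc g) s.
Proof. by elim: s g => //= h s IH g; rewrite IH eq_sym. Qed.

Lemma gcellPE n x (s : seq (garr G)) : gcellP n x s = (size s == n.+1) && gpath x s.
Proof.
rewrite /gcellP; case: s => [|g s] //; rewrite /gcomposable [sorted _ _]gpath_path /=.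
by rewrite [(grng g == x) && _]andbC.
Qed.

Lemma gcellP_take n x (s : seq (garr G)) : gcellP n.+1 x s -> gcellP n x (take n.+1 s).
Proof.
rewrite !gcellPE => /andP[/eqP sz h]; rewrite size_takel ?sz // eqxx /=.
by elim: (n.+1) s x h {sz} => [|m IH] [|g s] x //= /andP[-> /IH].
Qed.

Lemma gpath_contract i x (s : seq (garr G)) : (i.+1 < size s)%N ->
  gpath x s -> gpath x (contract (@gmul G) i s).
Proof.
elim: i x s => [|i IH] x [|g s] //= h /andP[e].
  case: s h => //= g' s _ /andP[/eqP e' h'].
  by rewrite grng_mul ?e // gsrc_mul ?e'.
by rewrite e; exact: IH.
Qed.

Lemma size_gcontract i (s : seq (garr G)) : (i.+1 < size s)%N ->
  size (contract (@gmul G) i s) = (size s).-1.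
Proof.
elim: i s => [|i IH] [|a s] //=; first by case: s.
by rewrite ltnS => h; rewrite IH //; case: s h.
Qed.

Lemma gcellP_contract n i x (s : seq (garr G)) : (i < n.+1)%N ->
  gcellP n.+1 x s -> gcellP n x (contract (@gmul G) i s).
Proof.
move=> hi; rewrite !gcellPE => /andP[/eqP sz h].
by rewrite size_gcontract ?sz // eqxx gpath_contract ?sz.
Qed.

Lemma gcellP_mul_first n x y g (s : seq (garr G)) : grng g = x -> gsrc g = y ->
  gcellP n y s -> gcellP n x (mul_first (@gmul G) g s).
Proof.
rewrite !gcellPE; case: s => // h s hr hs /= /and3P[-> /eqP e hp].
by rewrite grng_mul ?gsrc_mul ?hr ?hs ?e // eqxx.
Qed.

Lemma bgenE n x (c : gcell n x) : bgen n x (val c) = << c >>.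
Proof. by rewrite /bgen valK. Qed.

Lemma zlift_bgen n x (M : zmodType) (f : seq (garr G) -> M) s :
  gcellP n x s -> zlift (fun c : gcell n x => f (val c)) (bgen n x s) = f s.
Proof. by move=> h; rewrite /bgen insubT zliftU. Qed.

Lemma bar_ext n x (M : zmodType) (f f' : {additive bar_sheaf G n x -> M}) :
  (forall s, gcellP n x s -> f (bgen n x s) = f' (bgen n x s)) -> f =1 f'.
Proof. by move=> h; apply: freeg_ext => c; rewrite -bgenE; apply: h; exact: valP. Qed.

Lemma gact_bgen n g x y (hr : grng g = x) (hs : gsrc g = y) s : gcellP n y s ->
  gact (s := bar_sheaf G n) hr hs (bgen n y s) = bgen n x (mul_first (@gmul G) g s).
Proof. by move=> h; exact: (zlift_bgen (fun s => bgen n x (mul_first _ g s))). Qed.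

Hypothesis hG : etale G.

(** Arrow by arrow: the first one is determined near t by its range, as r is locally injective, and
    its source is the base point of the remaining tuple. *)
Lemma ev_uniq (T : topologicalType) (es fs : seq (T -> garr G)) (b : T -> gobj G) t :
  ctsl es t -> ctsl fs t ->
  (\forall z \near t, gpath (b z) (ev es z)) ->
  (\forall z \near t, gpath (b z) (ev fs z)) ->
  ev es t = ev fs t -> \forall z \near t, ev es z = ev fs z.
Proof.
elim: es fs b => [|e es IH] [|f fs] b //=; first by move=> *; apply: filterE.
move=> [ce ces] [cf cfs] he hf [eef efs].
have h1 : \forall z \near t, e z = f z.
  apply: (loc_inj_uniq (etale_inj hG) ce cf eef).
  by apply: filterS (filterI he hf) => z [/andP[/eqP -> _] /andP[/eqP -> _]].
have p1 : \forall z \near t, gpath (gsrc (e z)) (ev es z).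
  by apply: filterS he => z /andP[].
have p2 : \forall z \near t, gpath (gsrc (e z)) (ev fs z).
  by apply: filterS (filterI h1 hf) => z [-> /andP[]].
have h2 := IH fs (fun z => gsrc (e z)) ces cfs p1 p2 efs.
by apply: filterS (filterI h1 h2) => z [-> ->].
Qed.

(** A local section e of r through the first arrow g is followed by sections through the other
    arrows, found near s(g) and composed with z |-> s(e z). *)
Lemma ev_ex x s : gpath x s -> exists es : seq (gobj G -> garr G),
  ev es x = s /\ \forall z \near x, ctsl es z /\ gpath z (ev es z).
Proof.
elim: s x => [|g s IH] x /=; first by move=> _; exists [::]; split=> //; apply: filterE.
move=> /andP[/eqP <- /IH[es [es1 es2]]].
have [e [eg he]] := etale_section hG g.
exists (e :: compl es (fun z => gsrc (e z))); split; first by rewrite /= [ev _ _]ev_comp eg es1.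
have ce : cts (fun z => gsrc (e z)) (grng g).
  by apply: (cts_comp (f := e) (nbhs_singleton he).1); exact: etale_src.
rewrite -{1}eg in es2; apply: filterS (filterI he (ce _ es2)) => z [[cz ez] [c1 p1]].
split; last by rewrite /= ez eqxx [ev _ _]ev_comp.
split=> //; apply: ctsl_comp => //; apply: (cts_comp (f := e)) => //; exact: etale_src.
Qed.

Lemma gcell_tuple n x s : gcellP n x s -> exists t : gtuple G n, tval (val t) = s.
Proof.
case/and3P=> sz hc _; have hc' : gcomposable (Tuple sz) by [].
by exists (exist _ (Tuple sz) hc').
Qed.

Lemma gtuple_gcell n (t : gtuple G n) : gcellP n (gtuple_rng t) (val t).
Proof.
have ht := valP t; rewrite /gcellP size_tuple eqxx [gcomposable _]ht /=.
by rewrite /gtuple_rng -[sval t]/(val t); case/tupleP: (val t) => g s; rewrite theadE /=.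
Qed.

Definition coords n : seq (gtuple_space G n -> garr G) :=
  [seq (fun t => tnth (val t) i) | i <- enum 'I_n.+1].

Lemma ev_coords n (t : gtuple_space G n) : ev (coords n) t = val t.
Proof. by rewrite /ev /coords -map_comp -[RHS]map_tnth_enum. Qed.

Lemma cts_coord n i (t : gtuple_space G n) :
  cts (fun t : gtuple_space G n => tnth (val t) i) t.
Proof.
apply: (@cts_comp (gtuple_space G n) _ _ (@gtuple_incl G n) (fun u => u i)).
  exact: cts_initial.
exact: cts_proj.
Qed.

Lemma ctsl_coords n (t : gtuple_space G n) : ctsl (coords n) t.
Proof. by apply: ctsl_map => i; exact: cts_coord. Qed.

Definition tuple_rng n (t : gtuple_space G n) : gobj G := gtuple_rng t.

Lemma cts_tuple_rng n (t : gtuple_space G n) : cts (@tuple_rng n) t.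
Proof.
exact: (cts_comp (g := @grng G) (@cts_coord n ord0 t) (etale_rng hG (g := _))).
Qed.

Definition good n x (es : seq (gobj G -> garr G)) : Prop :=
  ctsl es x /\ \forall z \near x, gcellP n z (ev es z).

Lemma is_section_good n U (e : gobj G -> gtuple_space G n) x :
  open U -> is_section U e -> U x -> exists es, good n x es /\ forall z, ev es z = val (e z).
Proof.
move=> oU [er ce _] Ux; exists (compl (coords n) e).
have evE z : ev (compl (coords n) e) z = val (e z) by rewrite ev_comp ev_coords.
split=> //; split.
  apply: ctsl_comp; last exact: ctsl_coords.
  by move: ce; rewrite (continuous_open_subspace _ oU) => /(_ x (mem_set Ux)).
apply: filterS (open_nbhs_nbhs (conj oU Ux)) => z Uz.
by rewrite evE -{1}(er z Uz); exact: gtuple_gcell.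
Qed.

Lemma section_ex n U es x : open U -> U x ->
  (forall z, U z -> ctsl es z /\ gcellP n z (ev es z)) ->
  exists e : gobj G -> gtuple_space G n,
    is_section U e /\ forall z, U z -> ev es z = val (e z).
Proof.
move=> oU Ux h; have [t0 _] := gcell_tuple (h x Ux).2.
pose e z : gtuple_space G n := xget t0 [set t | tval (val t) = ev es z].
have eE z : U z -> ev es z = val (e z).
  move=> Uz; apply/esym.
  by apply: (@xgetPex _ t0 [set t | tval (val t) = ev es z]); exact: gcell_tuple (h z Uz).2.
have re z : U z -> tuple_rng (e z) = z.
  move=> Uz; have := gtuple_gcell (e z); rewrite -[gtuple_rng _]/(tuple_rng _) -eE //.
  have := (h z Uz).2; rewrite /gcellP; case: (ev es z) => [|g s].
    by rewrite !andbF.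
  by case/and3P=> _ _ /eqP <- /and3P[_ _ /eqP].
have ce z : U z -> cts e z.
  move=> Uz; apply: cts_into_initial; apply: cts_into_prod => i.
  (* Default values for [nth]; an arrow exists because tuples have n + 1 > 0 entries. *)
  have [g [d _]] : exists (g : garr G) (d : gobj G -> garr G), True.
    by exists (tnth (val t0) ord0), (fun=> tnth (val t0) ord0).
  have sz : size es = n.+1.
    by have := (h z Uz).2; rewrite gcellPE size_map => /andP[/eqP].
  have isz : (i < size es)%N by rewrite sz.
  suff : @cts (gobj G) (garr G) (fun z => tnth (val (e z)) i) z by [].
  have cn := ctsl_nth (d := d) (h z Uz).1 isz; apply: (near_cts cn).
  apply: filterS (open_nbhs_nbhs (conj oU Uz)) => z' Uz'.
  by rewrite (tnth_nth g) -eE // (nth_ev d).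
exists e; split=> //; split=> //.
  by rewrite (continuous_open_subspace _ oU) => z /set_mem; exact: ce.
(* The image is open: near e z, a tuple t equals the value of the section at r(t), since both depend
   continuously on t, have the same range and agree at e z. *)
rewrite openE => _ [z Uz <-].
have cr := @cts_tuple_rng n (e z).
have hn := open_nbhs_nbhs (conj oU Uz); rewrite -{1}(re z Uz) in hn.
have cU := cr _ hn.
have : \forall t \near e z, ev (compl es (@tuple_rng n)) t = ev (coords n) t.
  apply: (ev_uniq (b := @tuple_rng n)).
  - by apply: ctsl_comp => //; rewrite re //; exact: (h z Uz).1.
  - exact: ctsl_coords.
  - apply: filterS cU => t Ut; rewrite ev_comp.
    by have := (h _ Ut).2; rewrite gcellPE => /andP[].
  - apply: filterE => t; rewrite ev_coords.
    by have := gtuple_gcell t; rewrite gcellPE => /andP[].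
  by rewrite ev_comp ev_coords re // eE.
move=> hU; apply: filterS (filterI cU hU) => t [Ut]; rewrite ev_comp ev_coords eE // => et.
by exists (tuple_rng t) => //; apply: val_inj; exact: val_inj.
Qed.
End GroupoidPaths.

(** * Integral combinations of continuous tuples; the bar sheaves *)

Section Combinations.
Variable G : groupoid.
Hypothesis hG : etale G.
Implicit Types x y : gobj G.
Local Notation bar := (bar_sheaf G).
Local Notation fam := (seq (gobj G -> garr G)).

(** A germ-level form of the generating sections [bar_bs]: open images are not asked for, and any
    finite index type is allowed, so that a sum is indexed by a disjoint union. *)
Definition lin n x (u : forall z, bar n z) : Prop :=
  exists (I : finType) (a : I -> int) (es : I -> fam),
    (forall i, good n x (es i)) /\
    \forall z \near x, u z = \sum_i bgen n z (ev (es i) z) *~ a i.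

Lemma lin_near n x (u v : forall z, bar n z) :
  lin x u -> (\forall z \near x, u z = v z) -> lin x v.
Proof.
move=> [I [a [es [h e]]]] uv; exists I, a, es; split=> //.
by apply: filterS (filterI e uv) => z [<- ->].
Qed.

Lemma lin0 n x : lin x (fun z => 0 : bar n z).
Proof.
exists void, (fun=> 0), (fun=> [::]); split; first by case.
by apply: filterE => z; rewrite big1 // => -[].
Qed.

Lemma linD n x (u v : forall z, bar n z) :
  lin x u -> lin x v -> lin x (fun z => u z + v z).
Proof.
move=> [I [a [es [h e]]]] [J [b [fs [h' e']]]].
exists (I + J)%type, (fun i => match i with inl i => a i | inr j => b j end),
  (fun i => match i with inl i => es i | inr j => fs j end); split; first by case.
by apply: filterS (filterI e e') => z [-> ->]; rewrite big_sumType.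
Qed.

Lemma linMz n x (u : forall z, bar n z) m : lin x u -> lin x (fun z => u z *~ m).
Proof.
move=> [I [a [es [h e]]]]; exists I, (fun i => a i * m), es; split=> //.
apply: filterS e => z ->; rewrite mulrz_suml.
by apply: eq_bigr => i _; rewrite mulrzA.
Qed.

Lemma linN n x (u : forall z, bar n z) : lin x u -> lin x (fun z => - u z).
Proof. by move=> /(linMz (- 1)) h; apply: lin_near h _; apply: filterE => z; rewrite mulrN1z. Qed.

Lemma lin_sum n x (I : Type) (r : seq I) (u : I -> forall z, bar n z) :
  (forall i, lin x (u i)) -> lin x (fun z => \sum_(i <- r) u i z).
Proof.
move=> h; elim: r => [|i r IH].
  by apply: lin_near (lin0 n x) _; apply: filterE => z; rewrite big_nil.
by apply: lin_near (linD (h i) IH) _; apply: filterE => z; rewrite big_cons.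
Qed.

Lemma lin_bgen n x es : good n x es -> lin x (fun z => bgen n z (ev es z)).
Proof.
move=> h; exists unit, (fun=> 1), (fun=> es); split=> //.
by apply: filterE => z; rewrite (big_pred1 tt) // => -[].
Qed.

(* Tuples of the combination that coincide at x coincide near x, so every relation
   between the generators at x persists near x. *)
Lemma lin_eq0 n x (u : forall z, bar n z) :
  lin x u -> u x = 0 -> \forall z \near x, u z = 0.
Proof.
move=> [I [a [es [h e]]]] ux0.
have hx : \sum_i bgen n x (ev (es i) x) *~ a i = 0 by rewrite -(nbhs_singleton e).
have : \forall z \near x, forall ij : I * I,
    ev (es ij.1) x = ev (es ij.2) x -> ev (es ij.1) z = ev (es ij.2) z.
  apply: filter_forall => -[i j] /=.
  have [eij|neq] := pselect (ev (es i) x = ev (es j) x); last first.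
    by apply: filterE => z /neq.
  have [[ci gi] [cj gj]] := (h i, h j).
  have gp k : \forall z \near x, gpath z (ev (es k) z).
    by apply: filterS (h k).2 => z; rewrite gcellPE => /andP[].
  have := ev_uniq hG (b := id) ci cj (gp i) (gp j) eij.
  by apply: filterS => z ->.
move=> hn; apply: filterS (filterI e hn) => z [-> hz].
(* Moves a tuple at x to the generator at z of a family through it; by [hz] the choice of the family
   is irrelevant. The linear extension takes u x = 0 to u z. *)
pose phi (s : seq (garr G)) : bar n z :=
  if [pick i | ev (es i) x == s] is Some i then bgen n z (ev (es i) z) else 0.
rewrite -[RHS](raddf0 (zlift (fun c : gcell n x => phi (val c)))) -hx raddf_sum.
apply: eq_bigr => i _; rewrite raddfMz /= zlift_bgen; last exact: (nbhs_singleton (h i).2).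
rewrite /phi; case: pickP => [j /eqP eji|/(_ i)]; last by rewrite eqxx.
by have /= -> := hz (j, i) eji.
Qed.

Lemma lin_uniq n x (u v : forall z, bar n z) :
  lin x u -> lin x v -> u x = v x -> \forall z \near x, u z = v z.
Proof.
move=> hu hv e; have := lin_eq0 (linD hu (linN hv)); rewrite e subrr => /(_ erefl).
by apply: filterS => z /eqP; rewrite subr_eq0 => /eqP.
Qed.

Definition bar_bs n (U : set (gobj G)) (s : forall z, bar n z) : Prop :=
  open U /\ exists N (a : 'I_N -> int) (e : 'I_N -> gobj G -> gtuple_space G n),
    (forall i, is_section U (e i)) /\
    s = fun z => \sum_i bgen n z (val (e i z)) *~ a i.

Lemma lin_bs n U (s : forall z, bar n z) x : bar_bs U s -> U x -> lin x s.
Proof.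
move=> [oU [N [a [e [he ->]]]]] Ux.
have /choice[es hes] : forall i, exists es, good n x es /\ forall z, ev es z = val (e i z).
  by move=> i; exact: (is_section_good oU (he i) Ux).
exists 'I_N, a, es; split=> [i|]; first exact: (hes i).1.
by apply: filterE => z; apply: eq_bigr => i _; rewrite (hes i).2.
Qed.

(** Sections through the finitely many tuples in the support of [a], taken over a common open set
    inside [W], with the coefficients of [a]. *)
Lemma bar_bs_ex n x (a : bar n x) W : nbhs x W ->
  exists U (s : forall z, bar n z), [/\ bar_bs U s, U x, s x = a & U `<=` W].
Proof.
move=> hW; pose N := size (dom a); pose c i := tnth (in_tuple (dom a)) i : gcell n x.
have /choice[es hes] : forall i : 'I_N, exists es : fam,
    ev es x = val (c i) /\ \forall z \near x, ctsl es z /\ gcellP n z (ev es z).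
  move=> i; have := valP (c i); rewrite gcellPE => /andP[/eqP sz /(ev_ex hG)[es [e h]]].
  exists es; split=> //; apply: filterS h => z [? hp]; split=> //.
  by rewrite gcellPE hp andbT -sz -e !size_map.
have hn : \forall z \near x, W z /\
    forall i, ctsl (es i) z /\ gcellP n z (ev (es i) z).
  by apply: filterI => //; apply: filter_forall => i; exact: (hes i).2.
have [U [oU Ux hU]] := near_open hn.
have /choice[e he] : forall i, exists e : gobj G -> gtuple_space G n,
    is_section U e /\ forall z, U z -> ev (es i) z = val (e z).
  by move=> i; apply: section_ex Ux _ => // z Uz; exact: (hU z Uz).2.
exists U, (fun z => \sum_i bgen n z (val (e i z)) *~ coeff (c i) a); split=> //.
- split=> //; exists N, (fun i => coeff (c i) a), e; split=> // i; exact: (he i).1.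
- rewrite -[RHS]freeg_sumE [RHS]big_tnth; apply: eq_bigr => i _.
  rewrite -(he i).2 // (hes i).1 bgenE -/(c i).
  by rewrite freegU_mulz intz.
by move=> z /hU[].
Qed.

Lemma bar_local_homeo_csec n : local_homeo (@sproj G (bar n)) /\
  forall U (s : forall z, bar n z) x, bar_bs U s -> U x -> csec x s.
Proof.
have h1 S : @sgen G (bar n) S ->
    exists U (s : forall z, bar n z), bar_bs U s /\ S = [set existT _ z (s z) | z in U].
  move=> [U [N [a [e [oU he ->]]]]].
  exists U, (fun z => \sum_i bgen n z (val (e i z)) *~ a i); split=> //.
  by split=> //; exists N, a, e.
have h2 U (s : forall z, bar n z) : bar_bs U s ->
    @sgen G (bar n) [set existT _ z (s z) | z in U].
  by move=> [oU [N [a [e [he ->]]]]]; exists U, N, a, e.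
have h3 U (s : forall z, bar n z) : bar_bs U s -> open U by case.
have h4 U (s : forall z, bar n z) V t x : bar_bs U s -> bar_bs V t -> U x -> V x ->
    s x = t x -> \forall z \near x, s z = t z.
  by move=> hs ht Ux Vx; apply: lin_uniq; [exact: lin_bs hs Ux | exact: lin_bs ht Vx].
split; first exact: local_homeo_bs h1 h2 h3 h4 (@bar_bs_ex n).
by move=> U s x; exact: (bs_csec h1 h3 h4).
Qed.

Lemma bar_local_homeo n : local_homeo (@sproj G (bar n)).
Proof. exact: (bar_local_homeo_csec n).1. Qed.

(** A generating section with the same value at x agrees with [u] near x by [lin_uniq], and is
    continuous. *)
Lemma csec_lin n x (u : forall z, bar n z) : lin x u -> csec x u.
Proof.
move=> hu; have [U [s [bU Ux sx _]]] := bar_bs_ex (u x) (filterT : nbhs x setT).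
apply: near_csec ((bar_local_homeo_csec n).2 _ _ _ bU Ux) _.
exact: lin_uniq (lin_bs bU Ux) hu sx.
Qed.

Lemma lin_ex n x (a : bar n x) : exists u : forall z, bar n z, u x = a /\ lin x u.
Proof.
have [U [s [bU Ux sx _]]] := bar_bs_ex a (filterT : nbhs x setT).
by exists s; split=> //; exact: lin_bs bU Ux.
Qed.

(** The translate of a family near s(f x) by a local section [f] of r; it describes the action near
    the arrow f x. *)
Definition mul_first_fam (f : gobj G -> garr G) (es : fam) : fam :=
  if es is e :: es' then
    (fun z => gmul (f z) (e (gsrc (f z)))) :: compl es' (fun z => gsrc (f z))
  else [::].

Lemma ev_mul_first f es z :
  ev (mul_first_fam f es) z = mul_first (@gmul G) (f z) (ev es (gsrc (f z))).
Proof. by case: es => //= e es; rewrite [ev _ _]ev_comp. Qed.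

Lemma good_mul_first n x f es : cts f x -> (\forall z \near x, grng (f z) = z) ->
  good n (gsrc (f x)) es -> good n x (mul_first_fam f es).
Proof.
move=> cf rf [ces ges].
have csf : cts (fun z => gsrc (f z)) x.
  by apply: (cts_comp cf); exact: etale_src.
have hg := csf _ ges; split; last first.
  apply: filterS (filterI rf hg) => z [rz gz]; rewrite ev_mul_first.
  exact: gcellP_mul_first gz.
case: es ces ges hg => //= e es [ce ces] ges hg; split; last exact: ctsl_comp.
apply: (etale_mul hG cf (f := fun z => e (gsrc (f z)))); first exact: (cts_comp csf ce).
by apply: filterS hg => z; rewrite gcellPE => /andP[_ /andP[/eqP]].
Qed.

Lemma bar_is_gsheaf n : is_gsheaf (bar n).
Proof.
have csrc := etale_src hG; have lh := @bar_local_homeo n.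
apply: is_gsheaf_of_sections => //.
- move=> x a b; have [u [<- hu]] := lin_ex a; have [v [<- hv]] := lin_ex b.
  by exists u, v; split=> //; apply: csec_lin => //; exact: linD.
- move=> x a; have [u [<- hu]] := lin_ex a.
  by exists u; split=> //; apply: csec_lin => //; exact: linN.
- by move=> g x y hr hs a b; exact: raddfB.
- move=> x hr hs a.
  apply: (bar_ext (f := zlift _) (f' := idfun)) => s hs'.
  rewrite [LHS](gact_bgen hr hs hs'); congr bgen.
  move: hs'; rewrite gcellPE; case: s => // g s /andP[_ /andP[/eqP <- _]] /=.
  by rewrite gmul1g.
- move=> g h x y z gr gs hr hs ghr ghs a.
  pose act1 := zlift (fun c : gcell n z => bgen n x (mul_first (@gmul G) (gmul g h) (val c))).
  pose act2 := zlift (fun c : gcell n z => bgen n y (mul_first (@gmul G) h (val c))).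
  pose act3 := zlift (fun c : gcell n y => bgen n x (mul_first (@gmul G) g (val c))).
  apply: (bar_ext (f := act1) (f' := act3 \o act2)) => s hs'.
  have e2 : act2 (bgen n z s) = _ := gact_bgen hr hs hs'.
  rewrite [LHS](gact_bgen ghr ghs hs') -[RHS]/(act3 (act2 (bgen n z s))) e2.
  rewrite [RHS](gact_bgen gr gs (gcellP_mul_first hr hs hs')); congr bgen.
  move: hs' {e2}; rewrite gcellPE; case: s => // k s /andP[_ /andP[/eqP e _]] /=.
  by rewrite gmulA ?gs ?hr ?hs ?e.
move=> g a; have [u [ua hu]] := lin_ex a; exists u; split=> //; first exact: csec_lin.
(* Every arrow h near g is f(r(h)), so h acts on u(s(h)) by giving v(r(h)), where v is the translate
   of u by f; and v is again a combination of continuous tuples. *)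
have [f [fg hf]] := etale_section hG g.
have [cf rf] := nbhs_singleton hf.
have hrf : \forall z \near grng g, grng (f z) = z by apply: filterS hf => z [].
have [I [b [es [hes hu']]]] := hu.
pose v z := \sum_i bgen n z (ev (mul_first_fam f (es i)) z) *~ b i : bar n z.
have hv : lin (grng g) v.
  exists I, b, (fun i => mul_first_fam f (es i)); split; last by apply: filterE.
  by move=> i; apply: good_mul_first => //; rewrite fg.
have crng := etale_rng hG (g := g).
have cv : @cts (garr G) (total (bar n)) (fun h => point (v (grng h))) g.
  exact: (cts_comp (g := fun z => point (v z)) crng (csec_lin hv)).
apply: near_cts cv _.
have hfh : \forall h \near g, f (grng h) = h.
  apply: (loc_inj_uniq (etale_inj hG) _ (@cts_id _ g)) => //.
    exact: (cts_comp crng cf).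
  exact: crng hrf.
have hgood : \forall z \near gsrc g, forall i, gcellP n z (ev (es i) z).
  by apply: filter_forall => i; exact: (hes i).2.
apply: filterS (filterI hfh (csrc g _ (filterI hu' hgood))) => h [fh [-> hz]].
congr point; rewrite /v.
pose aB : {additive bar n (gsrc h) -> bar n (grng h)} :=
  zlift (fun c : gcell n (gsrc h) => bgen n (grng h) (mul_first (@gmul G) h (val c))).
rewrite -[RHS]/(aB _) (raddf_sum aB); apply: eq_bigr => i _; rewrite (raddfMz aB).
by rewrite [aB _](gact_bgen erefl erefl (hz i)) ev_mul_first fh.
Qed.
End Combinations.

(** * The boundary of the bar complex and its contraction *)

Section BarMaps.
Variable G : groupoid.
Implicit Types x y : gobj G.
Local Notation bar := (bar_sheaf G).
Local Notation fam := (seq (gobj G -> garr G)).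
Local Notation op := (@gmul G).

Lemma bar_mapE n x s : gcellP n.+1 x s ->
  bar_map n.+1 x (bgen n.+1 x s) = bgen n x (take n.+1 s) *~ (-1) ^+ n.+1 +
    \sum_(i < n.+1) bgen n x (contract op i s) *~ (-1) ^+ i.
Proof.
move=> h; have <- : \sum_(1 <= i < n.+2) bgen n x (contract op i.-1 s) *~ (-1) ^+ i.-1 =
    \sum_(i < n.+1) bgen n x (contract op i s) *~ (-1) ^+ i by rewrite big_add1 big_mkord.
exact: (zlift_bgen (fun s => bgen n x (take n.+1 s) *~ (-1) ^+ n.+1 +
    \sum_(1 <= i < n.+2) bgen n x (contract op i.-1 s) *~ (-1) ^+ i.-1)).
Qed.

Lemma bar_map0E x s : gcellP 0 x s -> bar_map 0 x (bgen 0 x s) = 1.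
Proof. by move=> h; exact: (zlift_bgen (fun=> 1 : int)). Qed.

Lemma take_mul_first n g (s : seq (garr G)) :
  take n.+1 (mul_first op g s) = mul_first op g (take n.+1 s).
Proof. by case: s. Qed.

Lemma contract_mul_first i g (s : seq (garr G)) x : (i.+1 < size s)%N -> gsrc g = x ->
  gpath x s -> contract op i (mul_first op g s) = mul_first op g (contract op i s).
Proof.
case: i s => [|i] [|h [|h' s]] //= _ <- /and3P[/eqP e /eqP e' _].
by rewrite gmulA // e.
Qed.

Lemma bar_map_act n (g : garr G) x y (hr : grng g = x) (hs : gsrc g = y) (a : bar n y) :
  bar_map n x (gact hr hs a) = gact (s := low bar n) hr hs (bar_map n y a).
Proof.
pose aB m : {additive bar m y -> bar m x} :=
  zlift (fun c : gcell m y => bgen m x (mul_first op g (val c))).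
case: n a => [|n] a.
  apply: (bar_ext (f := bar_map 0 x \o aB 0) (f' := bar_map 0 y)) => s h /=.
  rewrite [aB 0 _](gact_bgen hr hs h) [RHS](bar_map0E h) [LHS]bar_map0E //.
  exact: gcellP_mul_first h.
apply: (bar_ext (f := bar_map n.+1 x \o aB n.+1) (f' := aB n \o bar_map n.+1 y)) => s h.
have e1 : aB n.+1 (bgen n.+1 y s) = _ := gact_bgen hr hs h.
have h' := gcellP_mul_first hr hs h.
rewrite -[LHS]/(bar_map n.+1 x (aB n.+1 _)) e1 -[RHS]/(aB n (bar_map n.+1 y _)).
rewrite (bar_mapE h') (bar_mapE h) (raddfD (aB n)) (raddfMz (aB n)) (raddf_sum (aB n)).
have e2 t (ht : gcellP n y t) : aB n (bgen n y t) = _ := gact_bgen hr hs ht.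
rewrite e2 ?gcellP_take // take_mul_first; congr (_ + _).
apply: eq_bigr => i _; have hi := ltn_ord i.
have /andP[/eqP sz hp] : (size s == n.+2) && gpath y s by rewrite -gcellPE.
by rewrite (raddfMz (aB n)) e2 ?gcellP_contract // (contract_mul_first _ hs hp) // sz.
Qed.

Definition contractf i (es : fam) : fam :=
  contract (fun e f z => gmul (e z) (f z)) i es.

Lemma ev_contract i (es : fam) z : ev (contractf i es) z = contract op i (ev es z).
Proof.
by elim: i es => [|i IH] [|e es] //=; [case: es | rewrite -[ev _ _]/(ev (contractf i es) z) IH].
Qed.

Lemma ev_take i (es : fam) z : ev (take i es) z = take i (ev es z).
Proof. exact: map_take. Qed.

Section Etale.
Hypothesis hG : etale G.

Lemma good_take n x (es : fam) : good n.+1 x es -> good n x (take n.+1 es).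
Proof.
move=> [ces ges]; split.
  by elim: (n.+1) es ces {ges} => [|m IH] [|e es] //= [ce /IH].
by apply: filterS ges => z h; rewrite ev_take gcellP_take.
Qed.

Lemma good_contract n i x (es : fam) : (i < n.+1)%N ->
  good n.+1 x es -> good n x (contractf i es).
Proof.
move=> hi [ces ges]; split; last first.
  by apply: filterS ges => z h; rewrite ev_contract gcellP_contract.
have {ges} : \forall z \near x, exists y, gpath y (ev es z).
  by apply: filterS ges => z; rewrite gcellPE => /andP[_ h]; exists z.
elim: i es ces {hi} => [|i IH] [|e es] //=.
  case: es => [|f es] //= [ce [cf ces]] h; split=> //.
  apply: (etale_mul hG) => //; apply: filterS h => z [y].
  by move=> /and3P[_ /eqP -> _].
move=> [ce ces] h; split=> //; apply: IH => //.
by apply: filterS h => z [y /andP[_ h]]; exists (gsrc (e z)).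
Qed.

(** Truncations and contractions of continuous tuples are continuous, so boundaries of [lin]
    sections are [lin]; in degree 0 such a section goes to the sum of its coefficients, constant
    near x. *)
Lemma bar_map_hom n : is_hom (bar_map (G := G) n).
Proof.
apply: hom_of_sections; first exact: bar_local_homeo hG _.
- by move=> x a b; exact: raddfB.
- by move=> *; exact: bar_map_act.
move=> x a; have [u [ua hu]] := lin_ex hG a.
exists u; split=> //; first exact: (csec_lin hG hu).
have [I [b [es [hes hu']]]] := hu.
have hgood : \forall z \near x, forall i, gcellP n z (ev (es i) z).
  by apply: filter_forall => i; exact: (hes i).2.
have e : \forall z \near x, bar_map n z (u z) =
    \sum_i bar_map n z (bgen n z (ev (es i) z)) *~ b i.
  apply: filterS hu' => z ->; rewrite raddf_sum.
  by apply: eq_bigr => i _; rewrite raddfMz.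
case: n a u ua hu es hes hu' hgood e => [|n] a u ua hu es hes hu' hgood e.
  apply: (near_csec (s := fun=> \sum_i b i : Zsheaf G _)); first exact: csec_Zcst.
  apply: filterS (filterI e hgood) => z [ez hz]; apply/esym/(etrans ez).
  by apply: eq_bigr => i _; rewrite [bar_map _ _ _]bar_map0E // intz.
pose du i z := bgen n z (ev (take n.+1 (es i)) z) *~ (-1) ^+ n.+1 +
    \sum_(j < n.+1) bgen n z (ev (contractf j (es i)) z) *~ (-1) ^+ j : bar n z.
have hlin i : lin x (du i).
  apply: linD; first by apply: linMz; apply: lin_bgen; exact: good_take.
  by apply: lin_sum => j; apply: linMz; apply: lin_bgen; exact: good_contract.
have hd : lin x (fun z => \sum_i du i z *~ b i) by apply: lin_sum => i; exact: linMz.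
apply: near_csec (csec_lin hG hd) _.
apply: filterS (filterI e hgood) => z [ez hz]; apply/esym/(etrans ez).
apply: eq_bigr => i _; congr (_ *~ _); rewrite [LHS]bar_mapE // /du ev_take; congr (_ + _).
by apply: eq_bigr => j _; rewrite ev_contract.
Qed.
End Etale.

Definition bar_cone n x : {additive low bar n x -> bar n x} :=
  match n return {additive low bar n x -> bar n x} with
  | 0 => intmul (bgen 0 x [:: gunit x])
  | m.+1 => zlift (fun c : gcell m x => bgen m.+1 x (gunit x :: val c))
  end.

Lemma gcellP_cone n x s : gcellP n x s -> gcellP n.+1 x (gunit x :: s).
Proof. by rewrite !gcellPE /= gsrc_unit grng_unit eqxx eqSS. Qed.

Lemma bar_coneE n x s : gcellP n x s ->
  bar_cone n.+1 x (bgen n x s) = bgen n.+1 x (gunit x :: s).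
Proof. by move=> h; exact: (zlift_bgen (fun s => bgen n.+1 x (gunit x :: s))). Qed.

Lemma bar_cone0 x (m : int) : bar_map 0 x (bar_cone 0 x m) = m.
Proof.
have h : gcellP 0 x [:: gunit x] by rewrite gcellPE /= grng_unit eqxx.
by rewrite [bar_cone _ _ _]/= raddfMz [bar_map _ _ _]bar_map0E // intz.
Qed.

Lemma bar_homotopy n x (v : bar n x) :
  bar_map n.+1 x (bar_cone n.+1 x v) = v - bar_cone n x (bar_map n x v).
Proof.
pose f : {additive bar n x -> bar n x} := bar_map n.+1 x \o bar_cone n.+1 x.
pose f' : {additive bar n x -> bar n x} := idfun \- (bar_cone n x \o bar_map n x).
apply: (bar_ext (f := f) (f' := f')) => s h.
rewrite -[LHS]/(bar_map n.+1 x (bar_cone n.+1 x _)) bar_coneE // bar_mapE ?gcellP_cone //.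
rewrite -[RHS]/(_ - bar_cone n x (bar_map n x _)).
(* Multiplying the unit into the first arrow gives back [s]; contraction i + 1 of the cone is the
   cone over contraction i, with the opposite sign. *)
have -> : \sum_(i < n.+1) bgen n x (contract op i (gunit x :: s)) *~ (-1) ^+ i =
    bgen n x s - \sum_(i < n) bgen n x (gunit x :: contract op i s) *~ (-1) ^+ i.
  rewrite big_ord_recl expr0 mulr1z; congr (_ + _).
    case: s h => // g s; rewrite gcellPE /= => /andP[_ /andP[/eqP <- _]].
    by rewrite gmul1g.
  rewrite -sumrN; apply: eq_bigr => i _.
  by rewrite -mulrNz lift0 exprS mulN1r.
rewrite addrCA; congr (_ + _).
case: n h v {f f'} => [|n] h _.
  rewrite big_ord0 subr0 [bar_map _ _ _]bar_map0E //= expr1 mulrN1z mulr1z.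
  by case: s h => [|g [|]].
rewrite (bar_mapE h) (raddfD (bar_cone n.+1 x)) (raddfMz (bar_cone n.+1 x)).
rewrite (raddf_sum (bar_cone n.+1 x)) bar_coneE ?gcellP_take // opprD exprS mulN1r mulrNz.
congr (_ - _); apply: eq_bigr => i _.
by rewrite (raddfMz (bar_cone n.+1 x)) bar_coneE // gcellP_contract.
Qed.

(* [g_0, ..., g_n] is the translate by g_0 of the cone over [g_1, ..., g_n], so by
   equivariance the square of the boundary vanishes if it does on cones. *)
Lemma bar_dd_cone n :
  (forall y w, bar_map n y (bar_cone n y (bar_map n y w)) = bar_map n y w) ->
  forall x (v : bar n.+1 x), bar_map n x (bar_map n.+1 x v) = 0.
Proof.
move=> hn x.
pose f : {additive bar n.+1 x -> low bar n x} := bar_map n x \o bar_map n.+1 x.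
apply: (bar_ext (f := f) (f' := @zero_map (bar n.+1 x) (low bar n x))) => s h.
have {h} : [&& size s == n.+2 & gpath x s] by rewrite -gcellPE.
case: s => // g s /and3P[sz /eqP hr hp].
have h : gcellP n (gsrc g) s by rewrite gcellPE; apply/andP; split.
have <- : gact (s := bar n.+1) hr erefl (bar_cone n.+1 (gsrc g) (bgen n _ s)) =
    bgen n.+1 x (g :: s).
  by rewrite bar_coneE // gact_bgen ?gcellP_cone //= gmulg1.
rewrite -[LHS]/(bar_map n x (bar_map n.+1 x _)) !bar_map_act bar_homotopy raddfB hn subrr.
case: n {hn f h sz hp} => [|n] //=.
exact: (raddf0 (zlift (fun c : gcell n (gsrc g) => bgen n x (mul_first op g (val c))))).
Qed.

(** Vanishing in one degree turns [bar_homotopy] into the hypothesis of [bar_dd_cone] for the next;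
    no double sum is ever manipulated. *)
Lemma bar_dd n x (v : bar n.+1 x) : bar_map n x (bar_map n.+1 x v) = 0.
Proof.
elim: n x v => [|n IH]; apply: bar_dd_cone => y w; first exact: bar_cone0.
by rewrite bar_homotopy IH raddf0 subr0.
Qed.
End BarMaps.

Lemma bar_exact (G : groupoid) : etale G -> exact_resolution (bar_resolution G).
Proof.
move=> hG; split.
- exact: bar_is_gsheaf.
- exact: bar_map_hom.
- by move=> x m; exists (bar_cone 0 x m); exact: bar_cone0.
- exact: bar_dd.
move=> n x q e; exists (bar_cone n.+1 x q).
by rewrite [LHS]bar_homotopy [bar_map n x q]e raddf0 subr0.
Qed.

(** * The path groupoid *)

Section Degrees.
Variable k : nat.
Implicit Types j l m n p q : deg k.

Lemma daddE p q i : (p + q) i = (p i + q i)%N.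
Proof. by rewrite ffunE. Qed.

Lemma dle_addl p q : dle q (p + q).
Proof. by apply/dleP => i; rewrite daddE leq_addl. Qed.

Lemma dle_addr p q : dle q (q + p).
Proof. by rewrite addrC; exact: dle_addl. Qed.

Lemma dle_ex p q : dle p q -> exists r, q = r + p.
Proof. by move=> h; exists (dsub q p); rewrite addrC dsubK. Qed.

Lemma dint_sub_eq j l m n : dint j - dint l = dint m - dint n <-> j + n = m + l.
Proof.
split=> /ffunP e; apply/ffunP => i; have := e i; rewrite !(daddE, ffunE); lia.
Qed.
End Degrees.

Section InitialSegments.
Variables (k : nat) (L : kgraph k).
Implicit Types (x y z : ipath L) (p q : deg k) (l : arr L).

Definition pre x p : arr L := path_arr x (dle0 p).

Lemma path_arr_eq x (m n m' n' : deg k) (h : dle m n) (h' : dle m' n') :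
  m = m' -> n = n' -> path_arr x h = path_arr x h'.
Proof. by move=> e e'; subst m' n'; rewrite (bool_irrelevance h h'). Qed.

Lemma kdeg_path_arr0 x p : kdeg (pre x p) = p.
Proof. by rewrite path_deg; apply/ffunP => i; rewrite !ffunE subn0. Qed.

Lemma pre_comp x p q (h : dle p q) : pre x q = kcomp (pre x p) (path_arr x h).
Proof. exact: path_comp. Qed.

(** Unique factorisation: x(0, q) determines its initial part of degree p. *)
Lemma pre_le x y p q : dle p q -> pre x q = pre y q -> pre x p = pre y p.
Proof.
move=> h; rewrite !(pre_comp _ h) => /kfact_inj[] //.
- by rewrite path_rng path_src.
- by rewrite path_rng path_src.
- by rewrite !kdeg_path_arr0.
Qed.

Lemma path_arr_le x y p q (h : dle p q) : pre x q = pre y q ->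
  path_arr x h = path_arr y h.
Proof.
rewrite !(pre_comp _ h) => /kfact_inj[] //.
- by rewrite path_rng path_src.
- by rewrite path_rng path_src.
- by rewrite !kdeg_path_arr0.
Qed.

Lemma ipath_eq x y : (forall p, pre x p = pre y p) -> x = y.
Proof. by move=> h; apply: ipathP => m n hmn; exact: path_arr_le. Qed.

Lemma pre_shiftE x p q : pre (shift p x) q = path_arr x (dle_addl q p).
Proof. by rewrite /pre /=; apply: path_arr_eq => //; rewrite add0r. Qed.

Lemma pre_shift x y p q : pre x (q + p) = pre y (q + p) ->
  pre (shift p x) q = pre (shift p y) q.
Proof. by rewrite !pre_shiftE => h; exact: path_arr_le. Qed.

Lemma pre_add x p q : pre x (q + p) = kcomp (pre x p) (pre (shift p x) q).
Proof. by rewrite pre_shiftE -pre_comp. Qed.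

Lemma shift_eq x y p : pre x p = pre y p -> shift p x = shift p y -> x = y.
Proof.
move=> e h; apply: ipath_eq => q.
by apply: (pre_le (dle_addr p q)); rewrite !pre_add e h.
Qed.

Lemma shift_vtx0 p x : (shift p x) 0 = x p.
Proof. by rewrite /= add0r. Qed.

Lemma src_pre x p : src (pre x p) = x p.
Proof. exact: path_src. Qed.

Lemma rng_pre x p : rng (pre x p) = x 0.
Proof. exact: path_rng. Qed.

Lemma pre_prepend l y : src l = y 0 -> pre (prepend l y) (kdeg l) = l.
Proof. by case/prependP. Qed.

Lemma shift_prepend l y : src l = y 0 -> shift (kdeg l) (prepend l y) = y.
Proof. by case/prependP. Qed.

Lemma prepend_shift l x : pre x (kdeg l) = l -> prepend l (shift (kdeg l) x) = x.
Proof.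
move=> h; have e : src l = (shift (kdeg l) x) 0 by rewrite -{1}h src_pre shift_vtx0.
by apply: (@shift_eq _ _ (kdeg l)); rewrite ?pre_prepend ?shift_prepend.
Qed.

Lemma rng_prepend l y : src l = y 0 -> (prepend l y) 0 = rng l.
Proof. by move=> h; rewrite -{2}(pre_prepend h) rng_pre. Qed.

Lemma pre_prepend_add l y q : src l = y 0 ->
  pre (prepend l y) (q + kdeg l) = kcomp l (pre y q).
Proof. by move=> h; rewrite pre_add pre_prepend // shift_prepend. Qed.

Lemma prepend_comp l m y : src l = rng m -> src m = y 0 ->
  prepend (kcomp l m) y = prepend l (prepend m y).
Proof.
move=> h h'; have h2 : src l = (prepend m y) 0 by rewrite rng_prepend.
have e : pre (prepend l (prepend m y)) (kdeg (kcomp l m)) = kcomp l m.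
  by rewrite kdeg_comp // addrC pre_prepend_add // pre_prepend.
rewrite -[RHS](prepend_shift e); congr prepend.
by rewrite kdeg_comp // addrC -shiftD !shift_prepend.
Qed.

(* To check sigma^p(a) = sigma^r(c), compare initial segments with those of a pair
   x, z satisfying this equation, and compare the tails further out. *)
Lemma shift_eq_extend x z a c p r q :
  shift p x = shift r z -> pre a (q + p) = pre x (q + p) ->
  pre c (q + r) = pre z (q + r) -> shift (q + p) a = shift (q + r) c ->
  shift p a = shift r c.
Proof.
move=> e ea ec; rewrite -!shiftD; apply: shift_eq.
by rewrite (pre_shift ea) e (pre_shift ec).
Qed.

Local Notation X := (path_space L).

Lemma near_pre (x : X) p : \forall z \near x, pre z p = pre x p.
Proof.
have o : open (cylinder (pre x p) : set X) by apply: gentop_open; exists (pre x p).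
have cx : cylinder (pre x p) x.
  by rewrite /cylinder /=; apply: path_arr_eq => //; exact: kdeg_path_arr0.
apply: filterS (open_nbhs_nbhs (conj o cx)) => z <-.
by apply: path_arr_eq; rewrite ?kdeg_path_arr0.
Qed.

(** Membership in finitely many cylinders is decided by one initial segment, of a degree above all
    of theirs. *)
Lemma nbhs_pre (x : X) W : nbhs x W ->
  exists p, forall z, pre z p = pre x p -> W z.
Proof.
move=> /nbhs_gentop[D [hB hx hW]].
suff [p hp] : exists p, forall z, pre z p = pre x p -> forall V, V \in D -> V z.
  by exists p => z /hp /hW.
elim: D hB hx {hW} => [|V D IH] hB hx; first by exists 0.
have [V' h'|V' h'|p hp] := IH _ _.
- by apply: hB; rewrite inE h' orbT.
- by apply: hx; rewrite inE h' orbT.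
have [l _ el] := hB V (mem_head _ _); have Vx := hx V (mem_head _ _).
exists (dmax (kdeg l) p) => z hz V'; rewrite inE => /orP[/eqP ->|h']; last first.
  by apply: hp h'; exact: pre_le (dle_maxr _ _) hz.
have {}Vx : pre x (kdeg l) = l by move: Vx; rewrite -el.
by rewrite -el; apply: etrans Vx; exact: pre_le (dle_maxl _ _) hz.
Qed.

End InitialSegments.

(** * The path groupoid is etale *)

Section Etale.
Variables (k : nat) (L : kgraph k).
Local Notation X := (path_space L).
Local Notation A := (path_arrow_space L).
Implicit Types (x y z : ipath L) (p q : deg k) (l m : arr L).

(** The existential path of [path_bisection] is the common tail of range and source, so it can be
    eliminated. *)
Lemma bisectionP l m (g : path_garr L) : src l = src m ->
  path_bisection l m g <->
  [/\ pre (path_grng g) (kdeg l) = l, pre (path_gsrc g) (kdeg m) = m,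
      path_gdeg g = dint (kdeg l) - dint (kdeg m) &
      shift (kdeg l) (path_grng g) = shift (kdeg m) (path_gsrc g)].
Proof.
move=> lm; rewrite /path_grng /path_gsrc /path_gdeg; split.
  move=> [z hz /= ->] /=.
  by rewrite !pre_prepend ?shift_prepend -?lm.
move=> [hl hm hd e]; exists (shift (kdeg l) (val g).1.1).
  by rewrite shift_vtx0 -src_pre hl.
by rewrite prepend_shift // e prepend_shift // -hd; case: (val g) => -[].
Qed.

Lemma path_garr_ex (g : path_garr L) : exists j l : deg k,
  path_gdeg g = dint j - dint l /\ shift j (path_grng g) = shift l (path_gsrc g).
Proof. exact: (asboolP _ (valP g)). Qed.

(** The neighbourhood is the bisection of the initial segments of degrees p + j and p + l. The free
    parameter p makes the control of range and source as fine as desired. *)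
Lemma near_garr (g : A) (j l p : deg k) :
  path_gdeg g = dint j - dint l -> shift j (path_grng g) = shift l (path_gsrc g) ->
  \forall h \near g, [/\ path_gdeg h = path_gdeg g,
    pre (path_grng h) (p + j) = pre (path_grng g) (p + j),
    pre (path_gsrc h) (p + l) = pre (path_gsrc g) (p + l) &
    shift (p + j) (path_grng h) = shift (p + l) (path_gsrc h)].
Proof.
move=> hd e; set a := pre (path_grng g) (p + j); set b := pre (path_gsrc g) (p + l).
have e' : shift (p + j) (path_grng g) = shift (p + l) (path_gsrc g).
  by rewrite -!shiftD e.
have ab : src a = src b by rewrite !src_pre -(shift_vtx0 (p + j)) -(shift_vtx0 (p + l)) e'.
have ed : dint (kdeg a) - dint (kdeg b) = path_gdeg g.
  rewrite !kdeg_path_arr0 hd; apply/dint_sub_eq.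
  by apply/ffunP => i; rewrite !(daddE, ffunE); lia.
have o : open (path_bisection a b : set A) by apply: gentop_open; exists a, b.
have gab : path_bisection a b g by apply/(bisectionP _ ab); rewrite ed !kdeg_path_arr0.
apply: filterS (open_nbhs_nbhs (conj o gab)) => h /(bisectionP _ ab).
by rewrite ed !kdeg_path_arr0 => -[? ? ? ?]; split.
Qed.

Lemma cts_grng (g : A) : @cts A X (@path_grng k L) g.
Proof.
move=> W /nbhs_pre[p hp]; have [j [l [hd e]]] := path_garr_ex g.
apply: filterS (near_garr p hd e) => h [_ hr _ _]; apply: hp.
exact: pre_le (dle_addr _ _) hr.
Qed.

Lemma cts_gsrc (g : A) : @cts A X (@path_gsrc k L) g.
Proof.
move=> W /nbhs_pre[p hp]; have [j [l [hd e]]] := path_garr_ex g.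
apply: filterS (near_garr p hd e) => h [_ _ hr _]; apply: hp.
exact: pre_le (dle_addr _ _) hr.
Qed.

(** On a bisection the range determines the tail of the source, whose initial segment is fixed. *)
Lemma loc_inj_grng : @loc_inj A X (@path_grng k L).
Proof.
move=> g; have [j [l [hd e]]] := path_garr_ex g.
have [V [oV Vg hV]] := near_open (near_garr 0 hd e).
exists V; split=> // h h' /set_mem/hV[d1 _ s1 f1] /set_mem/hV[d2 _ s2 f2] er.
apply: path_garrP => //; first by rewrite d1.
by apply: (@shift_eq _ _ _ _ (0 + l)); rewrite ?s1 // -f1 -f2 er.
Qed.

(** As functions of z these are the local sections of the range map; the arrows produced by psi have
    the same form, with j = p for the first and j = 0 for the others. *)
Definition farr (j : deg k) m z : path_garr L :=
  mkarr z (dint j - dint (kdeg m)) (prepend m (shift j z)).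

Lemma farrE j m z : src m = z j ->
  val (farr j m z) = (z, dint j - dint (kdeg m), prepend m (shift j z)).
Proof.
move=> h; apply: mkarrE; apply/asboolP; exists j, (kdeg m); split=> //=.
by rewrite shift_prepend // shift_vtx0.
Qed.

Lemma cts_farr j m z : src m = z j -> @cts X A (farr j m) z.
Proof.
move=> mz; apply: cts_gentop => _ [a [b [ab ->]]] /(bisectionP _ ab).
rewrite /path_grng /path_gsrc /path_gdeg farrE //= => -[za zb ed e].
(* Agreement of z' with z up to the maximum p + j = q + d(a) controls the ranges; after prefixing m
   it becomes agreement of the sources up to p + d(m), which [eL] identifies with q + d(b). *)
have [p ep] := dle_ex (dle_maxl j (kdeg a)); have [q eq] := dle_ex (dle_maxr j (kdeg a)).
have eL : p + kdeg m = q + kdeg b.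
  have /dint_sub_eq/ffunP ed' := ed; rewrite eq in ep; move/ffunP: ep => ep.
  by apply/ffunP => i; have := ed' i; have := ep i; rewrite !(daddE, ffunE); lia.
apply: filterS (near_pre z (dmax j (kdeg a))) => z' hz.
have mz' : src m = z' j by rewrite -src_pre (pre_le (dle_maxl _ _) hz) src_pre.
have hm x : src m = x j -> src m = (shift j x) 0 by rewrite shift_vtx0.
have hy : pre (prepend m (shift j z')) (q + kdeg b) = pre (prepend m (shift j z)) (q + kdeg b).
  rewrite -eL !pre_prepend_add //; [|exact: hm|exact: hm]; congr kcomp.
  by apply: pre_shift; rewrite -ep.
apply/(bisectionP _ ab); rewrite /path_grng /path_gsrc /path_gdeg farrE //=; split=> //.
- by rewrite (pre_le (dle_maxr _ _) hz).
- by rewrite (pre_le (dle_addl _ _) hy).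
apply: (shift_eq_extend e _ hy); first by rewrite -eq.
rewrite -eq -eL ep -[in RHS]shiftD shift_prepend ?shiftD //; exact: hm.
Qed.

Lemma path_etale : etale (path_groupoid L).
Proof.
split=> [|||g|T e f t ce cf hef].
- exact: cts_grng.
- exact: cts_gsrc.
- exact: loc_inj_grng.
- have [j [l [hd e]]] := path_garr_ex g; pose m := pre (path_gsrc g) l.
  have dm : kdeg m = l by rewrite kdeg_path_arr0.
  have hm : src m = path_grng g j by rewrite src_pre -(shift_vtx0 l) -(shift_vtx0 j) e.
  exists (farr j m); split.
    apply: val_inj; rewrite farrE //= dm -hd e.
    rewrite -{1}dm prepend_shift ?dm //.
    by case: (g : path_garr L) => -[[]].
  apply: filterS (near_pre (path_grng g : X) j) => z hz.
  have hmz : src m = z j by rewrite hm -!src_pre hz.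
  by split; [exact: cts_farr | rewrite /= /path_grng farrE].
have e0 : path_gsrc (e t) = path_grng (f t) := nbhs_singleton hef.
apply: cts_gentop => _ [a [b [ab ->]]] /(bisectionP _ ab).
rewrite path_grng_mul // path_gsrc_mul // path_gdeg_mul // => -[xa zb ed exz].
have [j [l [hd h]]] := path_garr_ex (e t).
have [j' [l' [hd' h']]] := path_garr_ex (f t).
(* The extensions are chosen so that both factors describe the middle path up to the same degree
   ([E2]), while the outer segments exceed d(a) and d(b) by the same j + j' ([E1], [E3]), as
   [shift_eq_extend] requires. *)
have n1 := ce _ (near_garr (j' + kdeg a) hd h).
have n2 := cf _ (near_garr (l + kdeg a) hd' h').
have E1 : j' + kdeg a + j = (j + j') + kdeg a by rewrite addrC addrA.
have E2 : l + kdeg a + j' = j' + kdeg a + l by rewrite addrC [l + _]addrC addrA.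
have E3 : l + kdeg a + l' = (j + j') + kdeg b.
  rewrite hd hd' in ed; move/ffunP: ed => ed.
  by apply/ffunP => i; have := ed i; rewrite !(daddE, ffunE); lia.
apply: filterS (filterI hef (filterI n1 n2)) => u [ue [[d1 r1 s1 f1] [d2 r2 s2 f2]]].
have {}ue : path_gsrc (e u) = path_grng (f u) := ue.
apply/(bisectionP _ ab); rewrite path_grng_mul // path_gsrc_mul // path_gdeg_mul //.
rewrite E1 in r1 f1; rewrite E3 in s2 f2; split.
- by rewrite (pre_le (dle_addl _ _) r1).
- by rewrite (pre_le (dle_addl _ _) s2).
- by rewrite d1 d2.
by apply: (shift_eq_extend exz r1 s2); rewrite f1 -f2 E2 ue.
Qed.
End Etale.

(** * The sheaf of a module *)

Section Casts.
Variables (k : nat) (L : kgraph k) (A : rmod L).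
Implicit Types (x y z : ipath L) (p q r s : deg k) (u v w : vtx L).

Lemma castv_id u (e : u = u) (a : A u) : castv e a = a.
Proof. by rewrite (Prop_irrelevance e erefl). Qed.

Lemma castv_trans u v w (e : u = v) (e' : v = w) (a : A u) :
  castv e' (castv e a) = castv (etrans e e') a.
Proof. by subst v w. Qed.

Lemma castv_irr u v (e e' : u = v) (a : A u) : castv e a = castv e' a.
Proof. by rewrite (Prop_irrelevance e e'). Qed.

Lemma castv_is_zmod_morphism u v (e : u = v) : zmod_morphism (@castv k L A u v e).
Proof. by subst v. Qed.

Lemma castvD u v (e : u = v) (a b : A u) : castv e (a + b) = castv e a + castv e b.
Proof. by subst v. Qed.

Lemma castvN u v (e : u = v) (a : A u) : castv e (- a) = - castv e a.
Proof. by subst v. Qed.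

Lemma castv_mact (l l' : arr L) u v u' v' (hr : rng l = u) (hs : src l = v)
    (hr' : rng l' = u') (hs' : src l' = v') (eu : u = u') (ev : v = v') a :
  l = l' -> castv ev (mact A hr hs a) = mact A hr' hs' (castv eu a).
Proof.
move=> e; move: hr' hs'; case: _ / eu; case: _ / ev => hr' hs'.
by rewrite !castv_id; exact: mact_eq.
Qed.

Lemma shift_vtx x y p q : shift p x = shift q y -> y q = x p.
Proof. by move=> e; rewrite -(shift_vtx0 q) -e shift_vtx0. Qed.

(** Beyond p and q the two paths have the same tail, hence the same connecting maps. *)
Lemma dlphi_cast_step x y p q (e : y q = x p) (b : A (y q)) s r t
    (h : dle q r) (e' : y r = x t) :
  shift p x = shift q y -> r = s + q -> t = s + p ->
  dlphi (castv e' (step A y h b)) = dlphi (castv e b).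
Proof.
move=> es er et; subst r t; rewrite -(dlphi_step (dle_addl s p)); congr dlphi.
apply: castv_mact.
have -> : path_arr x (dle_addl s p) = pre (shift p x) s by rewrite pre_shiftE.
by rewrite es pre_shiftE; exact: path_arr_eq.
Qed.

(** The two elements become equal at some stage r of y. As p - q = p' - q', the corresponding stages
    of x reached from p and from p' coincide. This makes the graph of the action that of a
    function. *)
Lemma act_graph_uniq x y p q p' q' (e : y q = x p) (e' : y q' = x p')
    (b : A (y q)) (b' : A (y q')) :
  shift p x = shift q y -> shift p' x = shift q' y ->
  dint p - dint q = dint p' - dint q' -> dlphi b = dlphi b' ->
  dlphi (castv e b) = dlphi (castv e' b').
Proof.
move=> es es' ed /dlphi_eq[r [h [h' eb]]].
have [s er] := dle_ex h; have [s' er'] := dle_ex h'.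
have et : s + p = s' + p'.
  have /dint_sub_eq/ffunP ed' := ed; rewrite er in er'; move/ffunP: er' => er'.
  by apply/ffunP => i; have := ed' i; have := er' i; rewrite !(daddE, ffunE); lia.
have e1 : y r = x (s + p) by rewrite er; apply: shift_vtx; rewrite -!shiftD es.
rewrite -(dlphi_cast_step e b h e1 es er erefl) eb.
exact: (dlphi_cast_step e' b' h' e1 es' er' et).
Qed.
End Casts.

Section UnderlineSheaf.
Variables (k : nat) (L : kgraph k).
Local Notation G := (path_groupoid L).
Implicit Types (x y z : ipath L) (p q r s : deg k) (u v w : vtx L) (g : path_garr L).

Lemma underline_actE (A : rmod L) g x y (hr : @grng G g = x) (hs : @gsrc G g = y)
    p q (e : y q = x p) (b : A (y q)) :
  path_gdeg g = dint p - dint q -> shift p x = shift q y ->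
  gact (s := underline A) hr hs (dlphi b) = dlphi (castv e b).
Proof.
move=> ed es; rewrite /gact /=; set S := underline_act_graph _ _.
have [p' [q' [e' [b' [ed' es' eb ->]]]]] : S (xget 0 S).
  by apply: (@xgetPex _ 0 S); exists (dlphi (castv e b)), p, q, e, b.
by apply/esym/act_graph_uniq => //; rewrite -ed.
Qed.

Lemma path_garr_ge g s : exists j l : deg k, [/\ path_gdeg g = dint j - dint l,
  shift j (path_grng g) = shift l (path_gsrc g), dle s j & dle s l].
Proof.
have [j [l [hd e]]] := path_garr_ex g; exists (s + j), (s + l).
split; [|by rewrite -!shiftD e|exact: dle_addr|exact: dle_addr].
by rewrite hd; apply/dint_sub_eq/ffunP => i; rewrite !(daddE, ffunE); lia.
Qed.

Lemma underline_rep (A : rmod L) g x y (hr : @grng G g = x) (hs : @gsrc G g = y)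
    (c : dlim A y) : exists p q (e : y q = x p) (b : A (y q)),
  [/\ path_gdeg g = dint p - dint q, shift p x = shift q y & c = dlphi b].
Proof.
have [q0 [b0 ->]] := dlphi_surj c.
have [p [q [ed es _ hq]]] := path_garr_ge g q0.
rewrite -[path_grng g]/(@grng G g) hr -[path_gsrc g]/(@gsrc G g) hs in es.
by exists p, q, (shift_vtx es), (step A y hq b0); rewrite dlphi_step.
Qed.

(* The section y |-> phi^y_p(a), extended by 0 to the paths with y(p) <> v. *)
Definition vsec (A : rmod L) p v (a : A v) y : dlim A y :=
  if pselect (v = y p) is left e then dlphi (castv e a) else 0.

Lemma vsecE (A : rmod L) p v (a : A v) y (e : v = y p) : vsec p a y = dlphi (castv e a).
Proof. by rewrite /vsec; case: pselect => // e'; rewrite (castv_irr e e'). Qed.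

Lemma vsec_dlphi (A : rmod L) p y (a : A (y p)) : vsec p a y = dlphi a.
Proof. by rewrite (vsecE a erefl). Qed.

Lemma vsecD (A : rmod L) p v (a b : A v) y : vsec p (a + b) y = vsec p a y + vsec p b y.
Proof.
by rewrite /vsec; case: pselect => [e|_]; rewrite ?addr0 // castvD raddfD.
Qed.

Lemma vsecN (A : rmod L) p v (a : A v) y : vsec p (- a) y = - vsec p a y.
Proof. by rewrite /vsec; case: pselect => [e|_]; rewrite ?oppr0 // castvN raddfN. Qed.

Lemma vsec_le (A : rmod L) x z p r (h : dle p r) v (a : A v) (e : v = x p)
    (er : x r = z r) : pre z r = pre x r ->
  vsec p a z = dlphi (castv er (step A x h (castv e a))).
Proof.
move=> ez; subst v.
have e' : x p = z p by rewrite -!src_pre (pre_le h ez).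
rewrite (vsecE a e') castv_id -(dlphi_step h (castv e' a)); congr dlphi.
by apply/esym/castv_mact/esym/path_arr_le.
Qed.

Section Sheaf.
Variable A : rmod L.
Let U := underline A.

(** The degree and the source of l are named by variables p and v with equations, so that they can
    be rewritten without touching the type of [a]. *)
Definition und_bs (V : set (gobj G)) (s : forall y, U y) : Prop :=
  exists l p v (a : A v), [/\ kdeg l = p, src l = v, V = cylinder l & s = vsec p a].

Lemma cyl_vtx l y : cylinder l y -> src l = y (kdeg l).
Proof. by move=> <-; rewrite kdeg_path_arr0 path_src. Qed.

Lemma cyl_pre x y p : cylinder (pre x p) y <-> pre y p = pre x p.
Proof.
by rewrite /cylinder /= /pre -(path_arr_eq y (dle0 p)) // kdeg_path_arr0.
Qed.

Lemma und_bs_gen S : @sgen G U S ->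
  exists V (s : forall y, U y), und_bs V s /\ S = [set existT _ z (s z) | z in V].
Proof.
move=> [l [a ->]]; exists (cylinder l), (vsec (kdeg l) a); split.
  by exists l, (kdeg l), (src l), a.
apply/seteqP; split=> [_ [y [e [cy ->]]]|_ [y cy <-]].
  by exists y => //; rewrite (vsecE a e).
by exists y, (cyl_vtx cy); split=> //; rewrite (vsecE a (cyl_vtx cy)).
Qed.

Lemma gen_und_bs V (s : forall y, U y) : und_bs V s ->
  @sgen G U [set existT _ z (s z) | z in V].
Proof.
move=> [l [p [v [a [ep ev -> ->]]]]]; subst p v; exists l, a.
apply/seteqP; split=> [_ [y cy <-]|_ [y [e [cy ->]]]].
  by exists y, (cyl_vtx cy); split=> //; rewrite (vsecE a (cyl_vtx cy)).
by exists y => //; rewrite (vsecE a e).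
Qed.

Lemma und_bs_open V (s : forall y, U y) : und_bs V s -> open V.
Proof. by move=> [l [p [v [a [_ _ -> _]]]]]; apply: gentop_open; exists l. Qed.

(** Equality in the limit at x holds already at a finite stage r, and what happens up to that stage
    depends only on the initial segment x(0, r). *)
Lemma und_bs_uniq V (s : forall y, U y) V' t x : und_bs V s -> und_bs V' t ->
  V x -> V' x -> s x = t x -> \forall z \near (x : gobj G), s z = t z.
Proof.
move=> [l [p [v [a [ep ev -> ->]]]]] [m [q [w [b [eq ew -> ->]]]]] hl hm.
have e : v = x p by rewrite -ev -ep; exact: cyl_vtx.
have e' : w = x q by rewrite -ew -eq; exact: cyl_vtx.
rewrite (vsecE a e) (vsecE b e') => /dlphi_eq[r [h [h' eab]]].
apply: filterS (near_pre (x : gobj G) r) => z ez.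
have er : x r = z r by rewrite -!src_pre ez.
by rewrite (vsec_le h a e er ez) (vsec_le h' b e' er ez) eab.
Qed.

Lemma und_bs_ex x (a : U x) W : nbhs (x : gobj G) W ->
  exists V (s : forall y, U y), [/\ und_bs V s, V x, s x = a & V `<=` W].
Proof.
move=> /nbhs_pre[q hq]; have [p [b ->]] := dlphi_surj a.
pose r := dmax p q; exists (cylinder (pre x r)), (vsec r (step A x (dle_maxl p q) b)).
split.
- by exists (pre x r), r, (x r), (step A x (dle_maxl p q) b); rewrite kdeg_path_arr0 src_pre.
- exact/cyl_pre.
- by rewrite vsec_dlphi dlphi_step.
by move=> z /cyl_pre hz; apply: hq; exact: pre_le (dle_maxr _ _) hz.
Qed.

Lemma csec_vsec p v (a : A v) x : v = x p -> @csec G U x (vsec p a).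
Proof.
move=> e; apply: (bs_csec und_bs_gen und_bs_open und_bs_uniq (U := cylinder (pre x p))).
  by exists (pre x p), p, v, a; rewrite kdeg_path_arr0 src_pre.
exact/cyl_pre.
Qed.

Lemma underline_local_homeo : local_homeo (@sproj G U).
Proof. exact: (local_homeo_bs und_bs_gen gen_und_bs und_bs_open und_bs_uniq und_bs_ex). Qed.

Lemma underline_is_gsheaf : is_gsheaf U.
Proof.
have hG := path_etale L.
apply: is_gsheaf_of_sections.
- exact: etale_src hG.
- exact: underline_local_homeo.
- move=> x a b; have [p [a' [b' [-> ->]]]] := dl_common a b.
  exists (vsec p a'), (vsec p b'); rewrite !vsec_dlphi; split=> //; try exact: csec_vsec.
  have c := csec_vsec (a := a' + b') (erefl (x p)); apply: (near_csec c).
  by apply: filterE => z; rewrite vsecD.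
- move=> x a; have [p [a' ->]] := dlphi_surj a.
  exists (vsec p a'); rewrite vsec_dlphi; split=> //; first exact: csec_vsec.
  have c := csec_vsec (a := - a') (erefl (x p)); apply: (near_csec c).
  by apply: filterE => z; rewrite vsecN.
- move=> g x y hr hs a b.
  have [q0 [a' [b' [-> ->]]]] := dl_common a b.
  have [p [q [ed es _ hq]]] := path_garr_ge g q0.
  rewrite -[path_grng g]/(@grng G g) hr -[path_gsrc g]/(@gsrc G g) hs in es.
  rewrite -(dlphi_step hq a') -(dlphi_step hq b') -raddfB.
  by rewrite !(underline_actE hr hs (shift_vtx es) _ ed es) castv_is_zmod_morphism raddfB.
- move=> x hr hs a; have [p [a' ->]] := dlphi_surj a.
  rewrite (underline_actE hr hs erefl a') ?subrr //.
- move=> g h x y z gr gs hr hs ghr ghs a; have [q0 [a' ->]] := dlphi_surj a.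
  have [j2 [l2 [ed2 es2]]] := path_garr_ex g.
  (* The arrow h is represented so far out that l1 reaches the stage q0 of a' and j1 reaches l2;
     then g can be represented with second index j1, and the two actions meet at the same stage of
     y. *)
  have [j1 [l1 [ed1 es1 hj hl]]] := path_garr_ge h (q0 + l2).
  have gh : path_gsrc g = path_grng h by rewrite [LHS]gs [RHS]hr.
  have edm := path_gdeg_mul gh.
  rewrite -[path_grng g]/(@grng G g) gr -[path_gsrc g]/(@gsrc G g) gs in es2.
  rewrite -[path_grng h]/(@grng G h) hr -[path_gsrc h]/(@gsrc G h) hs in es1.
  have [t et] := dle_ex (dle_trans (dle_addl q0 l2) hj).
  have es2' : shift (t + j2) x = shift j1 y by rewrite et -!shiftD es2.
  have ed2' : path_gdeg g = dint (t + j2) - dint j1.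
    rewrite ed2 et; apply/dint_sub_eq/ffunP => i; rewrite !(daddE, ffunE); lia.
  have hq0 := dle_trans (dle_addr l2 q0) hl.
  rewrite -(dlphi_step hq0 a') (underline_actE hr hs (shift_vtx es1) _ ed1 es1).
  rewrite (underline_actE gr gs (shift_vtx es2') _ ed2' es2') castv_trans.
  apply: underline_actE; last by rewrite es2' es1.
  by rewrite [LHS]edm ed1 ed2' addrA subrK.
move=> g a; have [p [q [e [b [ed es ->]]]]] :=
  underline_rep (erefl (@grng G g)) (erefl (@gsrc G g)) a.
exists (vsec q b); split; [exact: vsec_dlphi | exact: csec_vsec |].
(* All arrows h near g act through the same p and q, so they take [vsec q b] at s(h) to [vsec p b]
   at r(h). *)
have c : @cts (garr G) (total U) (fun h => @point G U (@grng G h) (vsec p b (@grng G h))) g.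
  apply: (@cts_comp (garr G) (gobj G) (total U) (@grng G)
    (fun z => @point G U z (vsec p b z)) g); first exact: cts_grng.
  exact: csec_vsec.
apply: near_cts c _.
apply: filterS (near_garr 0 ed es) => h [dh rh sh eh]; congr point.
rewrite !add0r in rh sh eh; rewrite ed in dh.
have e1 : path_gsrc g q = path_gsrc h q by rewrite -!src_pre sh.
have e2 := shift_vtx eh.
rewrite (vsecE b (etrans e1 e2)) [vsec q b (@gsrc G h)](vsecE b e1).
by rewrite [RHS](underline_actE erefl erefl e2 _ dh eh) castv_trans.
Qed.
End Sheaf.

Lemma castv_map (A B : rmod L) (f : rmod_hom A B) u v (e : u = v) (a : A u) :
  f v (castv e a) = castv e (f u a).
Proof. by subst v. Qed.

Lemma underline_mapE (A B : rmod L) (f : rmod_hom A B) x p (a : A (x p)) :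
  underline_map f x (dlphi a) = dlphi (f (x p) a).
Proof. exact: dlliftE. Qed.

Lemma underline_map_hom (A B : rmod L) (f : rmod_hom A B) : is_hom (underline_map f).
Proof.
apply: hom_of_sections; first exact: underline_local_homeo.
- by move=> x a b; exact: raddfB.
- move=> g x y hr hs a; have [p [q [e [b [ed es ->]]]]] := underline_rep hr hs a.
  rewrite /fmap_of_amap (underline_actE hr hs e b ed es) !underline_mapE castv_map.
  by rewrite (underline_actE hr hs e (f (y q) b) ed es).
move=> x a; have [p [b ->]] := dlphi_surj a; exists (vsec p b); split.
- exact: vsec_dlphi.
- exact: csec_vsec.
have c := csec_vsec (a := f (x p) b) (erefl (x p)); apply: (near_csec c).
apply: filterE => z; rewrite /vsec /fmap_of_amap; case: pselect => [e|_].
  by rewrite underline_mapE castv_map.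
by rewrite raddf0.
Qed.

Lemma underline_constE x p (c : int) :
  underline_const x (dlphi (c : zconst L (x p))) = c.
Proof. exact: (dlliftE (A := zconst L) (f := fun=> idfun)). Qed.

Lemma underline_const_hom : is_hom (@underline_const k L).
Proof.
have castc u v (e : u = v) (c : zconst L u) : castv e c = c by subst v.
apply: hom_of_sections; first exact: underline_local_homeo.
- by move=> x a b; exact: raddfB.
- move=> g x y hr hs a; have [p [q [e [b [ed es ->]]]]] := underline_rep hr hs a.
  rewrite /fmap_of_amap (underline_actE hr hs e b ed es) !underline_constE.
  exact: castc.
move=> x a; have [p [b ->]] := dlphi_surj a; exists (vsec p b); split.
- exact: vsec_dlphi.
- exact: csec_vsec.
have c := @csec_Zcst G x (b : int); apply: (near_csec c).
apply: filterS (near_pre (x : gobj G) p) => z hz.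
have e : x p = z p by rewrite -!src_pre hz.
by rewrite (vsecE b e) /fmap_of_amap underline_constE castc.
Qed.
End UnderlineSheaf.

(** * Exactness of the resolution P *)

Section ContractRcons.
Variables (T : Type) (op : T -> T -> T).

Lemma contract_rcons i (s : seq T) a : (i.+1 < size s)%N ->
  contract op i (rcons s a) = rcons (contract op i s) a.
Proof.
elim: i s => [|i IH] [|b s] //=; first by case: s.
by rewrite ltnS => /IH ->.
Qed.

Lemma contract_rcons2 (s : seq T) b a :
  contract op (size s) (rcons (rcons s b) a) = rcons s (op b a).
Proof. by elim: s => //= c s ->. Qed.
End ContractRcons.

Section BarModuleExact.
Variables (k : nat) (L : kgraph k).
Implicit Types (v : vtx L) (l : arr L) (s : seq (arr L)).
Local Notation P := (Pmod L).

Lemma pdE n v s : pcellP n.+1 v s ->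
  pd n.+1 v (pgen n.+1 v s) = pgen n v (behead s) +
    \sum_(i < n.+1) pgen n v (contract kcomp i s) *~ (-1) ^+ i.+1.
Proof.
move=> h; have <- : \sum_(1 <= i < n.+2) pgen n v (contract kcomp i.-1 s) *~ (-1) ^+ i =
    \sum_(i < n.+1) pgen n v (contract kcomp i s) *~ (-1) ^+ i.+1.
  by rewrite big_add1 big_mkord.
exact: (zlift_pgen (fun s => pgen n v (behead s) +
    \sum_(1 <= i < n.+2) pgen n v (contract kcomp i.-1 s) *~ (-1) ^+ i)).
Qed.

Lemma pd0E v s : pcellP 0 v s -> pd 0 v (pgen 0 v s) = 1.
Proof. by move=> h; exact: (zlift_pgen (fun=> 1 : int)). Qed.

Lemma pmod_ext n v (M : zmodType) (f f' : {additive P n v -> M}) :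
  (forall s, pcellP n v s -> f (pgen n v s) = f' (pgen n v s)) -> f =1 f'.
Proof. by move=> h; apply: freeg_ext => c; rewrite -pgenE; apply: h; exact: valP. Qed.

Lemma pact_pgen n l u v (hr : rng l = u) (hs : src l = v) s : pcellP n u s ->
  mact (P n) hr hs (pgen n u s) = pgen n v (mul_last kcomp s l).
Proof. by move=> h; exact: (zlift_pgen (fun s => pgen n v (mul_last kcomp s l))). Qed.

Definition pcone n v : {additive lowPmod L n v -> P n v} :=
  match n return {additive lowPmod L n v -> P n v} with
  | 0 => intmul (pgen 0 v [:: idm v])
  | m.+1 => zlift (fun c : pcell m v => pgen m.+1 v (rcons (val c) (idm v)))
  end.

Lemma pcellP_cone n v s : pcellP n v s -> pcellP n.+1 v (rcons s (idm v)).
Proof.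
case/lastP: s => // s l; rewrite !pcellP_rcons src_id eqxx size_rcons eqSS.
case/and3P=> -> hc /eqP hl; rewrite andbT /=.
by move: hc; case: s => [|a s] /=; rewrite ?rcons_path ?last_rcons rng_id ?hl ?eqxx // => ->.
Qed.

Lemma pconeE n v s : pcellP n v s ->
  pcone n.+1 v (pgen n v s) = pgen n.+1 v (rcons s (idm v)).
Proof. by move=> h; exact: (zlift_pgen (fun s => pgen n.+1 v (rcons s (idm v)))). Qed.

Lemma pd_cone0 v (m : int) : pd 0 v (pcone 0 v m) = m.
Proof.
have h : pcellP 0 v [:: idm v] by rewrite /pcellP /= src_id eqxx.
by rewrite [pcone _ _ _]/= raddfMz [pd _ _ _]pd0E // intz.
Qed.

(** Appending an identity commutes with deleting the first entry (for n > 0) and with all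
    contractions but the last. That one absorbs the identity into l_n and returns the tuple with
    sign (-1)^(n+1). *)
Lemma pd_homotopy n v (a : P n v) :
  pd n.+1 v (pcone n.+1 v a) = pcone n v (pd n v a) + a *~ (-1) ^+ n.+1.
Proof.
have mzD : zmod_morphism (fun a : P n v => a *~ (-1) ^+ n.+1).
  by move=> b c; rewrite mulrzBl.
pose mzM := GRing.isZmodMorphism.Build _ _ _ mzD.
pose mz : {additive P n v -> P n v} := HB.pack (fun a : P n v => a *~ (-1) ^+ n.+1) mzM.
pose f : {additive P n v -> P n v} := pd n.+1 v \o pcone n.+1 v.
pose f' : {additive P n v -> P n v} := (pcone n v \o pd n v) \+ mz.
apply: (pmod_ext (f := f) (f' := f')) => s h.
rewrite -[LHS]/(pd n.+1 v (pcone n.+1 v _)) pconeE // pdE ?pcellP_cone //.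
rewrite -[RHS]/(pcone n v (pd n v _) + _ *~ _).
rewrite big_ord_recr /= addrA.
have -> : contract kcomp n (rcons s (idm v)) = s.
  move: h; case/lastP: s => // s l; rewrite pcellP_rcons => /and3P[/eqP <- _ /eqP <-].
  by rewrite contract_rcons2 kcomp_id_r.
congr (_ + _); case: n a h {mzD mzM mz f f'} => [|n] _ h.
  rewrite big_ord0 addr0 [pd _ _ _]pd0E //= mulr1z.
  by case: s h => [|g [|]].
rewrite (pdE h) (raddfD (pcone n.+1 v)) (raddf_sum (pcone n.+1 v)).
rewrite pconeE ?pcellP_behead //; congr (_ + _); first by case: s h.
apply: eq_bigr => i _; rewrite (raddfMz (pcone n.+1 v)) pconeE ?pcellP_contract //.
by rewrite contract_rcons //; case/and3P: h => /eqP -> _ _; exact: ltn_ord i.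
Qed.

(* [l_0, ..., l_n] is the image under l_n of the cone over [l_0, ..., l_(n-1)]. *)
Lemma pd_dd_cone n :
  (forall v w, pd n v (pcone n v (pd n v w)) = pd n v w *~ (-1) ^+ n) ->
  forall v (a : P n.+1 v), pd n v (pd n.+1 v a) = 0.
Proof.
move=> hn v.
pose f : {additive P n.+1 v -> lowPmod L n v} := pd n v \o pd n.+1 v.
apply: (pmod_ext (f := f) (f' := @zero_map (P n.+1 v) (lowPmod L n v))) => s.
case/lastP: s => // s l; rewrite pcellP_rcons => /and3P[/eqP sz hc /eqP hl].
have h : pcellP n (rng l) s.
  rewrite /pcellP sz eqxx /=; case: s sz hc => //= a s _.
  by rewrite rcons_path => /andP[-> ->].
have <- : mact (P n.+1) erefl hl (pcone n.+1 (rng l) (pgen n _ s)) =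
    pgen n.+1 v (rcons s l).
  by rewrite pconeE // pact_pgen ?pcellP_cone // mul_last_rcons kcomp_id_l.
rewrite -[LHS]/(pd n v (pd n.+1 v _)) pd_nat.
rewrite [X in pd n v (_ X)]pd_homotopy -[mact (lowPmod L n.+1) _ _ _]/(mact (P n) _ _ _) pd_nat.
by rewrite raddfD hn raddfMz exprS mulN1r mulrNz subrr raddf0.
Qed.

Lemma pd_dd n v (a : P n.+1 v) : pd n v (pd n.+1 v a) = 0.
Proof.
elim: n v a => [|n IH]; apply: pd_dd_cone => v w; first by rewrite pd_cone0 expr0 mulr1z.
by rewrite pd_homotopy IH raddf0 add0r.
Qed.

Lemma pd_exact n v (a : P n v) : pd n v a = 0 -> exists b, pd n.+1 v b = a.
Proof.
move=> e; exists (pcone n.+1 v a *~ (-1) ^+ n.+1).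
by rewrite raddfMz pd_homotopy e raddf0 add0r -mulrzA -exprD addnn -signr_odd odd_double mulr1z.
Qed.

Lemma underline_diffE n (x : ipath L) p (a : P n.+1 (x p)) :
  underline_diff n.+1 x (dlphi a) = dlphi (pd n.+1 (x p) a).
Proof. exact: (underline_mapE (pdiff L n.+1)). Qed.

Lemma underline_diff0E (x : ipath L) p (a : P 0 (x p)) :
  underline_diff 0 x (dlphi a) = pd 0 (x p) a.
Proof.
rewrite -[LHS]/(underline_const x (underline_map (pdiff L 0) x (dlphi a))).
by rewrite (underline_mapE (pdiff L 0)) underline_constE.
Qed.

Lemma underline_exact : exact_resolution (underline_resolution L).
Proof.
split.
- by move=> n; exact: underline_is_gsheaf.
- case=> [|n]; last exact: underline_map_hom.
  exact: (is_hom_comp (@underline_const_hom k L) (underline_map_hom (pdiff L 0))).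
- move=> x m; exists (dlphi (pcone 0 (x 0) m)).
  by rewrite [LHS]underline_diff0E pd_cone0.
- move=> n x q; have [p [a ->]] := dlphi_surj q.
  rewrite [X in res_map _ _ _ X]underline_diffE.
  case: n a q => [|n] a q; first by rewrite [LHS]underline_diff0E pd_dd.
  by rewrite [LHS]underline_diffE pd_dd raddf0.
move=> n x q; have [p [a ->]] := dlphi_surj q => e.
(* A cycle of the limit is represented by a cycle of the module complex at a later stage r, where
   [pd_exact] applies. In degree 0 the target is Z itself and no later stage is needed. *)
have [r [h er]] : exists r (h : dle p r), pd n (x r) (step (P n) x h a) = 0.
  case: n a q e => [|n] a q e.
    by exists p, (dle_refl p); rewrite step_id; move: e; rewrite [LHS]underline_diff0E.
  move: e; rewrite [LHS]underline_diffE -(raddf0 (dlphi (p := p))).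
  move=> /dlphi_eq[r [h [h' e]]]; exists r, h.
  by rewrite pd_nat [LHS]e raddf0.
have [b eb] := pd_exact er; exists (dlphi b).
by rewrite [LHS]underline_diffE eb dlphi_step.
Qed.
End BarModuleExact.

(** * The maps psi *)

Lemma contract_rev (T : Type) (op : T -> T -> T) i j (s : seq T) :
  size s = (i + j).+2 ->
  contract (fun a b => op b a) j (rev s) = rev (contract op i s).
Proof.
elim: i s => [|i IH] [|a s] //=.
  by case: s => // b s []; rewrite add0n => <-; rewrite !rev_cons -(size_rev s) contract_rcons2.
move=> [sz]; rewrite !rev_cons contract_rcons ?IH // size_rev sz.
by rewrite !ltnS leq_addl.
Qed.

Section Psi.
Variables (k : nat) (L : kgraph k).
Local Notation G := (path_groupoid L).
Local Notation bar := (bar_sheaf G).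
Local Notation P := (Pmod L).
Local Notation rcomp := (fun a b : arr L => kcomp b a).
Implicit Types (x y z : ipath L) (p q : deg k) (l m : arr L) (r s : seq (arr L)).

Fixpoint rpath (v : vtx L) r : bool :=
  if r is l :: r' then (src l == v) && rpath (rng l) r' else true.

Lemma pcellP_rev n v r : pcellP n v (rev r) = (size r == n.+1) && rpath v r.
Proof.
case: r => [|l r] //.
have hc : composable (rev (l :: r)) = rpath (rng l) r.
  by rewrite /composable rev_sorted /=; elim: r l => //= m r IH l; rewrite IH.
by rewrite rev_cons pcellP_rcons size_rev -rev_cons hc /= eqSS [_ && (_ == v)]andbC.
Qed.

Lemma pcellP_rpath n v s : pcellP n v s = (size (rev s) == n.+1) && rpath v (rev s).
Proof. by rewrite -pcellP_rev revK. Qed.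

(* [r] lists l_n, ..., l_0: a tuple [l_0, ..., l_n] is read backwards. *)
Fixpoint psi_seq x p r : seq (path_garr L) :=
  if r is l :: r' then farr p l x :: psi_seq (path_gsrc (farr p l x)) 0 r' else [::].

Lemma farr_rng p l x : src l = x p -> path_grng (farr p l x) = x.
Proof. by move=> h; rewrite /path_grng farrE. Qed.

Lemma farr_gdeg p l x : src l = x p -> path_gdeg (farr p l x) = dint p - dint (kdeg l).
Proof. by move=> h; rewrite /path_gdeg farrE. Qed.

Lemma farr_src p l x : src l = x p -> path_gsrc (farr p l x) = prepend l (shift p x).
Proof. by move=> h; rewrite /path_gsrc farrE. Qed.

Lemma farr_src0 p l x : src l = x p -> (path_gsrc (farr p l x)) 0 = rng l.
Proof. by move=> h; rewrite farr_src // rng_prepend // shift_vtx0. Qed.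

Lemma psi_chainE y r : rpath (y 0) r -> psi_chain y r = psi_seq y 0 r.
Proof.
elim: r y => //= l r IH y /andP[/eqP hl hr].
have -> : mkarr y (- dint (kdeg l)) (prepend l y) = farr 0 l y.
  rewrite /farr shift0; congr mkarr; apply/ffunP => i; rewrite !(daddE, ffunE); lia.
by rewrite farr_src // shift0 IH // rng_prepend.
Qed.

Lemma size_psi_seq x p r : size (psi_seq x p r) = size r.
Proof. by elim: r x p => //= l r IH x p; rewrite IH. Qed.

Lemma gpath_psi_seq x p r : rpath (x p) r -> gpath (G := G) x (psi_seq x p r).
Proof.
elim: r x p => //= l r IH x p /andP[/eqP hl hr].
by rewrite farr_rng // eqxx IH // farr_src0.
Qed.

Lemma gcellP_psi_seq n x p s : pcellP n (x p) s ->
  gcellP (G := G) n x (psi_seq x p (rev s)).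
Proof. by rewrite pcellP_rpath gcellPE size_psi_seq => /andP[-> /gpath_psi_seq]. Qed.

Lemma farr_src_comp p l m x : src l = x p -> src m = rng l ->
  path_gsrc (farr 0 m (path_gsrc (farr p l x))) = path_gsrc (farr p (kcomp m l) x).
Proof.
move=> hl hm; rewrite [LHS]farr_src ?farr_src0 // [RHS]farr_src ?src_comp //.
by rewrite shift0 farr_src // prepend_comp // shift_vtx0.
Qed.

Lemma farr_mul p l m x : src l = x p -> src m = rng l ->
  path_gmul (farr p l x) (farr 0 m (path_gsrc (farr p l x))) = farr p (kcomp m l) x.
Proof.
move=> hl hm; have hm0 : src m = (path_gsrc (farr p l x)) 0 by rewrite farr_src0.
have hc : src (kcomp m l) = x p by rewrite src_comp.
have e : path_gsrc (farr p l x) = path_grng (farr 0 m (path_gsrc (farr p l x))).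
  by rewrite farr_rng.
apply: path_garrP; rewrite ?path_grng_mul ?path_gdeg_mul ?path_gsrc_mul //.
- by rewrite !farr_rng.
- rewrite !farr_gdeg // kdeg_comp //.
  by apply/ffunP => i; rewrite !(daddE, ffunE); lia.
exact: farr_src_comp.
Qed.

Lemma contract_psi_seq j x p r : rpath (x p) r -> (j.+1 < size r)%N ->
  contract (@path_gmul k L) j (psi_seq x p r) = psi_seq x p (contract rcomp j r).
Proof.
elim: j x p r => [|j IH] x p [|l r] //= /andP[/eqP hl hr].
  case: r hr => //= m r /andP[/eqP hm hr] _.
  by rewrite farr_mul // farr_src_comp.
by rewrite ltnS => hj; rewrite IH // farr_src0.
Qed.

Lemma take_psi_seq i x p r : take i (psi_seq x p r) = psi_seq x p (take i r).
Proof. by elim: i x p r => [|i IH] x p [|l r] //=; rewrite IH. Qed.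

(** Prefixing l x(p, q) to sigma^q(x) is prefixing l to sigma^p(x), and the degrees q - (d(l) + q -
    p) and p - d(l) agree. This is what makes psi compatible with the direct limit. *)
Lemma farr_step p q (h : dle p q) l x : src l = x p ->
  farr q (kcomp l (path_arr x h)) x = farr p l x.
Proof.
move=> hl; set m := path_arr x h.
have dm : kdeg m + p = q by rewrite path_deg addrC dsubK.
have lm : src l = rng m by rewrite path_rng.
have em : pre (shift p x) (kdeg m) = m.
  by rewrite pre_shiftE; apply: path_arr_eq.
rewrite /farr kdeg_comp // prepend_comp //; last by rewrite shift_vtx0 path_src.
rewrite -{2}dm -shiftD prepend_shift //; congr mkarr.
by apply/dint_sub_eq; rewrite -dm addrA addrC addrA.
Qed.

Lemma psi_seq_step n p q (h : dle p q) x s : pcellP n (x p) s ->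
  psi_seq x q (rev (mul_last kcomp s (path_arr x h))) = psi_seq x p (rev s).
Proof.
case/lastP: s => // s l; rewrite mul_last_rcons !rev_rcons pcellP_rcons.
by move=> /and3P[_ _ /eqP hl] /=; rewrite farr_step.
Qed.

Definition psi_at n x p : {additive P n (x p) -> bar n x} :=
  zlift (fun c : pcell n (x p) =>
    bgen (G := G) n x (psi_seq x p (rev (val c))) *~ (-1) ^+ uphalf n).

Lemma psi_atE n x p s : pcellP n (x p) s ->
  psi_at n x p (pgen n (x p) s) =
  bgen (G := G) n x (psi_seq x p (rev s)) *~ (-1) ^+ uphalf n.
Proof.
move=> h; exact: (zlift_pgen (fun s =>
  bgen (G := G) n x (psi_seq x p (rev s)) *~ (-1) ^+ uphalf n)).
Qed.

Lemma psi_at_step n x p q (h : dle p q) a :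
  psi_at n x q (step (P n) x h a) = psi_at n x p a.
Proof.
apply: (pmod_ext (f := psi_at n x q \o step (P n) x h) (f' := psi_at n x p)) => s hs.
rewrite -[LHS]/(psi_at n x q (step (P n) x h _)) [step _ _ _ _]pact_pgen //.
rewrite !psi_atE //; last exact: pcellP_mul_last (path_rng x h) (path_src x h) hs.
by rewrite (psi_seq_step _ hs).
Qed.

Definition psi n : amap (underlineP L n) (bar n) :=
  fun x => dllift (psi_at_step (n := n) (x := x)).

Lemma psiE n x p (a : P n (x p)) : psi n x (dlphi a) = psi_at n x p a.
Proof. exact: dlliftE. Qed.

Lemma psi_is_psi n : is_psi (psi n).
Proof.
move=> x p ls l h; rewrite psiE psi_atE // rev_rcons /psi_gen -[mkarr _ _ _]/(farr p l x).
move: h; rewrite pcellP_rpath rev_rcons => /andP[_ /andP[/eqP hl hr]].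
by rewrite /= psi_chainE // farr_src0.
Qed.

Lemma psi_chain_map n x a :
  lowmap (fun i : nat => psi i) n x (res_map (underline_resolution L) n x a) =
  res_map (bar_resolution G) n x (psi n x a).
Proof.
have [p [a' ->]] := dlphi_surj a; rewrite [psi n x _]psiE.
case: n a a' => [|n] _ a.
  rewrite [LHS]underline_diff0E.
  pose f : {additive P 0 (x p) -> int} := pd 0 (x p).
  pose f' : {additive P 0 (x p) -> int} := @bar_map G 0 x \o psi_at 0 x p.
  apply: (pmod_ext (f := f) (f' := f')) => s h.
  rewrite -[LHS]/(pd 0 (x p) _).
  rewrite -[RHS]/(@bar_map G 0 x (psi_at 0 x p _)) psi_atE // pd0E // mulr1z.
  by rewrite [RHS]bar_map0E // gcellP_psi_seq.
rewrite [X in lowmap _ _ _ X]underline_diffE [LHS]psiE.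
pose f : {additive P n.+1 (x p) -> bar n x} := psi_at n x p \o pd n.+1 (x p).
pose f' : {additive P n.+1 (x p) -> bar n x} := @bar_map G n.+1 x \o psi_at n.+1 x p.
apply: (pmod_ext (f := f) (f' := f')) => s h.
rewrite -[LHS]/(psi_at n x p (pd n.+1 (x p) _)) -[RHS]/(@bar_map G n.+1 x (psi_at n.+1 x p _)).
rewrite pdE // psi_atE // raddfD raddfMz [bar_map _ _ _]bar_mapE ?gcellP_psi_seq //.
rewrite psi_atE ?pcellP_behead //.
have /andP[/eqP sz hr] : (size (rev s) == n.+2) && rpath (x p) (rev s).
  by rewrite -pcellP_rpath.
have szs : size s = n.+2 by rewrite -size_rev.
(* Deleting l_0 has sign 1 in d and (-1)^(n+1) in the bar boundary; contraction number i has sign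
   (-1)^(i+1) in d and lands in position n - i, with sign (-1)^(n-i). The quotient is (-1)^(n+1)
   throughout. *)
have eps : (-1) ^+ uphalf n.+1 = (-1) ^+ uphalf n * (-1) ^+ n.+1 :> int.
  rewrite -exprD -signr_odd -[RHS]signr_odd; congr (_ ^+ nat_of_bool _).
  rewrite oddD /= uphalf_half oddD oddb; case: (odd n); case: (odd _) => //.
rewrite mulrzDl; congr (_ + _).
  rewrite take_psi_seq -mulrzA eps mulrCA -expr2 sqrr_sign mulr1.
  congr (@bgen G _ _ (psi_seq _ _ _) *~ _).
  case: (s) szs => // b t /= [<-]; rewrite rev_cons -cats1 take_size_cat //.
  by rewrite size_rev.
(* Position j of the reversed tuple is position [rev_ord j] = n - j of [s]. *)
rewrite raddf_sum (reindex_inj rev_ord_inj) mulrz_suml; apply: eq_bigr => j _.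
have hj := ltn_ord j; have hj' := ltn_ord (rev_ord j).
rewrite raddfMz psi_atE ?pcellP_contract // contract_psi_seq ?sz //.
have es : size s = (rev_ord j + j).+2 by rewrite szs /= subSS subnK.
rewrite (contract_rev _ es) -!mulrzA eps; congr (_ *~ _).
rewrite [RHS]mulrCA; congr (_ * _); rewrite -exprD.
rewrite -signr_odd -[RHS]signr_odd; congr (_ ^+ nat_of_bool _).
rewrite /= subSS oddD /= oddB //.
by case: (odd n); case: (odd j).
Qed.

Lemma farr_act (g : path_garr L) p q l :
  path_gdeg g = dint p - dint q -> shift p (path_grng g) = shift q (path_gsrc g) ->
  src l = path_gsrc g q ->
  path_gmul g (farr q l (path_gsrc g)) = farr p l (path_grng g).
Proof.
move=> ed es hl; have e : path_gsrc g = path_grng (farr q l (path_gsrc g)).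
  by rewrite farr_rng.
have hl' : src l = path_grng g p by rewrite hl (shift_vtx es).
apply: path_garrP; rewrite ?path_grng_mul ?path_gdeg_mul ?path_gsrc_mul //.
- by rewrite farr_rng.
- by rewrite !farr_gdeg // ed addrA subrK.
by rewrite !farr_src // es.
Qed.

Lemma castv_pgen n u v (e : u = v) s :
  castv e (pgen n u s : P n u) = pgen n v s.
Proof. by subst v. Qed.

Lemma psi_act n (g : garr G) x y (hr : grng g = x) (hs : gsrc g = y)
    (a : underlineP L n y) :
  psi n x (gact hr hs a) = gact hr hs (psi n y a).
Proof.
have [p [q [e [b [ed es ->]]]]] := underline_rep hr hs a.
rewrite (underline_actE hr hs e b ed es) !psiE.
pose cM := GRing.isZmodMorphism.Build _ _ _ (@castv_is_zmod_morphism _ _ (P n) _ _ e).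
pose ca : {additive P n (y q) -> P n (x p)} := HB.pack (@castv _ _ (P n) _ _ e) cM.
pose aB : {additive bar n y -> bar n x} :=
  zlift (fun c : @gcell G n y => @bgen G n x (mul_first (@gmul G) g (val c))).
apply: (pmod_ext (f := psi_at n x p \o ca) (f' := aB \o psi_at n y q)) => s h.
rewrite -[LHS]/(psi_at n x p (castv e _)) -[RHS]/(aB (psi_at n y q _)) castv_pgen.
have h' : pcellP n (x p) s by rewrite -e.
rewrite !psi_atE // raddfMz [aB _](gact_bgen hr hs) ?gcellP_psi_seq //.
congr (@bgen G _ _ _ *~ _); move: h; rewrite pcellP_rpath.
case: (rev s) => // l r /andP[_ /andP[/eqP hl _]] /=.
subst x y; have efa := farr_act ed es hl.
(* Acting by g changes the first arrow only and keeps its source, on which all further arrows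
   depend. *)
rewrite [path_gmul _ _]efa; congr (_ :: psi_seq _ _ _).
by rewrite -efa path_gsrc_mul // farr_rng.
Qed.

(** [psi_seq] as a list of functions of the path, the form required by [good]. *)
Fixpoint psi_fam p r : seq (gobj G -> garr G) :=
  if r is l :: r' then
    farr p l :: compl (psi_fam 0 r') (fun z => path_gsrc (farr p l z))
  else [::].

Lemma ev_psi_fam p r z : ev (psi_fam p r) z = psi_seq z p r.
Proof. by elim: r p z => //= l r IH p z; rewrite [ev _ _]ev_comp IH. Qed.

Lemma ctsl_psi_fam p r x : rpath (x p) r -> ctsl (psi_fam p r) (x : gobj G).
Proof.
elim: r p x => //= l r IH p x /andP[/eqP hl hr].
have cf := cts_farr hl; split=> //.
apply: (ctsl_comp (p := fun z : gobj G => path_gsrc (farr p l z) : gobj G)).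
  exact: (cts_comp cf (@cts_gsrc _ _ _)).
by apply: IH; rewrite farr_src0.
Qed.

Lemma good_psi_fam n p s x : pcellP n (x p) s ->
  good n (x : gobj G) (psi_fam p (rev s)).
Proof.
move=> h; split.
  by apply: ctsl_psi_fam; move: h; rewrite pcellP_rpath => /andP[].
apply: filterS (near_pre (x : gobj G) p) => z hz.
by rewrite ev_psi_fam gcellP_psi_seq // -src_pre hz src_pre.
Qed.

(** Additivity in b reduces this to a generator, whose image near x is the continuous tuple
    [psi_fam] up to sign. *)
Lemma lin_psi_vsec n x p (b : P n (x p)) :
  lin (x : gobj G) (fun z => psi n z (vsec p b z)).
Proof.
have vM z : zmod_morphism (fun b : P n (x p) => vsec p b z).
  by move=> b1 b2; rewrite vsecD vsecN.
pose va z : {additive P n (x p) -> underlineP L n z} :=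
  HB.pack (fun b : P n (x p) => vsec p b z) (GRing.isZmodMorphism.Build _ _ _ (vM z)).
have e z : psi n z (vsec p b z) =
    \sum_(c <- dom b) psi n z (vsec p (<< c >> : P n (x p)) z) *~ coeff c b.
  rewrite -[vsec p b z]/(va z b) -[X in va z X]freeg_sumE 2!raddf_sum.
  apply: eq_bigr => c _.
  have -> : << coeff c b *g c >> = << c >> *~ coeff c b :> P n (x p).
    by rewrite freegU_mulz intz.
  by rewrite 2!raddfMz.
suff hl : @lin G n x (fun z =>
    \sum_(c <- dom b) psi n z (vsec p (<< c >> : P n (x p)) z) *~ coeff c b).
  by apply: lin_near hl _; apply: filterE => z; rewrite e.
apply: lin_sum => c; apply: linMz; rewrite -pgenE.
have hc := valP c; have hg := good_psi_fam hc.
apply: lin_near (linMz ((-1) ^+ uphalf n) (lin_bgen hg)) _.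
apply: filterS (near_pre (x : gobj G) p) => z hz.
have ez : x p = z p by rewrite -!src_pre hz.
by rewrite (vsecE _ ez) castv_pgen psiE psi_atE ?ev_psi_fam // -ez.
Qed.

Lemma psi_hom n : is_hom (psi n).
Proof.
apply: hom_of_sections; first exact: underline_local_homeo.
- by move=> x a b; exact: raddfB.
- by move=> *; exact: psi_act.
move=> x a; have [p [b ->]] := dlphi_surj a; exists (vsec p b); split.
- exact: vsec_dlphi.
- exact: csec_vsec.
exact: (csec_lin (path_etale L) (lin_psi_vsec b)).
Qed.
End Psi.

Theorem proposition4p5 (k : nat) (L : kgraph k)
    (hL : row_finite_source_free L) :
  let G := path_groupoid L in
  let P := underline_resolution L in
  let B := bar_resolution G in
  exists psi : forall n : nat, amap (P n) (B n),
    (forall n : nat, is_psi (psi n)) /\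
    forall n : nat,
      [/\ is_hom (psi n),
          forall (x : gobj G) (a : P n x),
            lowmap (fun m => psi m) n x (res_map P n x a) =
            res_map B n x (psi n x a),
          forall A : sheaf_data G, is_gsheaf A -> rho_triangle (psi n) A &
          forall M : rmod L, rho_triangle (psi n) (underline M)].
Proof.
move=> G P B; have hG := path_etale L.
have triangle (A : sheaf_data G) : is_gsheaf A ->
    forall n, rho_triangle (Q := P) (R := B) (@psi k L n) A.
  move=> hA; exact: (rho_triangle_of_chain_map (etale_src hG) hA (underline_exact L)
    (bar_exact hG) (@psi_hom k L) (@psi_chain_map k L)).
exists (@psi k L); split; first exact: psi_is_psi.
move=> n; split.
- exact: psi_hom.
- exact: psi_chain_map.
- by move=> A hA; exact: triangle.
by move=> M; apply: triangle; exact: underline_is_gsheaf.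
Qed.
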